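(* Let $d\ge2$, $\alpha\in(0,2)$, let $\nu$ be the L\'evy measure on $\mathbb{R}^d$ with spectral measure $\mu$, and assume that $\nu$ is a $\gamma$-measure on the unit sphere. For every multiindex $\beta\in\mathbb{N}_0^d$ there exists a constant $c=c(\beta)$ such that for every $R>0$ we have $$|D^\beta p_1(y)-D^\beta p_1(x)|\le c\,(1+R)^{-\alpha-\gamma}\,(|y-x|\wedge1),$$ provided $x,y\in B(0,R)^c$ and $|y-x|<R/4$. Here $p_1$ is the density at time $1$ of the stable semigroup generated by $\nu$, $D^0=\mathrm{Id}$, and $a\wedge b=\min(a,b)$.
   Context: Setting. $d\ge2$ is an integer, $\alpha\in(0,2)$, $B(x,r)$ is the open Euclidean ball, $\mathbb{S}=\{x\in\mathbb{R}^d:|x|=1\}$. The spectral measure $\mu$ is a finite positive Borel measure on $\mathbb{S}$ that is symmetric ($\mu(D)=\mu(-D)$) and nondegenerate (its support is not contained in a proper linear subspace of $\mathbb{R}^d$; in particular $\mu\ne0$). The L\'evy measure is $\nu(D)=\int_{\mathbb{S}}\int_0^\infty \mathbf{1}_D(r\xi)\,r^{-1-\alpha}\,dr\,\mu(d\xi)$. We say that $\nu$ is a $\gamma$-measure on $\mathbb{S}$ if there is a constant $c$ with $\nu(B(x,r))\le c r^\gamma$ for all $|x|=1$, $0<r<1/2$ (necessarily $\gamma\le d$). $\{P_t,t>0\}$ is the convolution semigroup of symmetric $\alpha$-stable probability measures on $\mathbb{R}^d$ with $\int e^{iu\cdot y}P_t(dy)=\exp(-t\Phi(u))$, $\Phi(u)=\int(1-\cos(u\cdot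 y))\,\nu(dy)$; $P_t$ has a smooth bounded density $p_t$. Convention on constants: constants $c$ depend only on $\mu,\gamma,d,\alpha$, and additionally on the quantities explicitly indicated. *)

(* Defs.v *)
From HB Require Import structures.
From mathcomp Require Import all_boot all_order all_algebra.
From mathcomp Require Import complex.
From mathcomp Require Import all_classical all_reals all_analysis.
From mathcomp Require Import measurable_realfun.

Set Implicit Arguments.
Unset Strict Implicit.
Unset Printing Implicit Defensive.

Import Order.TTheory GRing.Theory Num.Theory.
Import numFieldNormedType.Exports.

Local Open Scope classical_set_scope.
Local Open Scope ring_scope.

(* Row vectors carry the Borel sigma-algebra.  The library norm `|x| on
   'rV[R]_d is the sup norm; it induces the usual topology, but all metric
   statements about R^d below use the Euclidean norm enorm. *)
HB.instance Definition _ (R : realType) (d : nat) :=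
  @isMeasurable.Build (sigma_display (@open 'rV[R]_d)) 'rV[R]_d
    <<s @open 'rV[R]_d >> (@sigma_algebra0 _ setT _) (@sigma_algebraC _ _)
    (@sigma_algebra_bigcup _ setT _).

Section coordinates.
Context {R : realType} {d : nat}.

Lemma measurable_open_rV (U : set 'rV[R]_d) : open U -> measurable U.
Proof. by move=> oU; exact: sub_sigma_algebra. Qed.

Lemma measurable_coord (i : 'I_d) :
  measurable_fun setT (fun x : 'rV[R]_d => x ord0 i).
Proof.
apply: (measurability _ (RGenOpens.measurableE R)).
move=> _ [_ [a [b ->]] <-]; rewrite setTI; apply: measurable_open_rV.
by apply: open_comp; [move=> x _; exact: coord_continuous|exact: interval_open].
Qed.

Lemma open_rV_ratballs (U : set 'rV[R]_d) : open U ->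
  U = \bigcup_(p in [set p : 'rV[rat]_d * nat |
        ball (map_mx ratr p.1 : 'rV[R]_d) p.2.+1%:R^-1 `<=` U])
      ball (map_mx ratr p.1 : 'rV[R]_d) p.2.+1%:R^-1.
Proof.
move=> oU; apply/seteqP; split => [x Ux|x [p pU]]; last exact: pU.
have : nbhs x U by move: oU; rewrite openE; exact.
move=> /nbhs_ballP[e /= e0 eU].
have [n] := ltr_add_invr (divr_gt0 e0 (ltr0n R 2)); rewrite add0r => ne.
have n0 : 0 < n.+1%:R^-1 :> R by rewrite invr_gt0.
have qP i : exists q : rat, `|x ord0 i - ratr q| < n.+1%:R^-1.
  have [|q] := @rat_in_itvoo R (x ord0 i - n.+1%:R^-1) (x ord0 i).
    by rewrite ltrBlDr ltrDl.
  rewrite in_itv /= => /andP[q1 q2]; exists q.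
  by rewrite ger0_norm ?subr_ge0 ?ltW// ltrBlDr addrC -ltrBlDr.
pose q : 'rV[rat]_d := \row_i projT1 (cid (qP i)).
have qx : ball (map_mx ratr q : 'rV[R]_d) n.+1%:R^-1 x.
  split=> // i j; rewrite ord1 !mxE /ball /= distrC.
  by case: cid.
exists (q, n) => //= y qy; apply: eU.
apply: (@le_ball _ _ _ (n.+1%:R^-1 + n.+1%:R^-1)).
  by rewrite [leRHS]splitr lerD// ltW.
by apply: ball_triangle qy; exact: ball_sym.
Qed.

Lemma measurable_fun_coord d' (T : measurableType d') (f : T -> 'rV[R]_d) :
  (forall i, measurable_fun setT (fun t => f t ord0 i)) ->
  measurable_fun setT f.
Proof.
move=> mf; apply: (measurability (@open 'rV[R]_d)) => //.
move=> _ [U oU <-]; rewrite setTI (open_rV_ratballs oU) preimage_bigcup.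
rewrite bigcup_mkcond.
apply: countable_bigcupT_measurable; first exact: countableP.
move=> -[q n]; case: ifPn => // _ /=.
have n0 : 0 < n.+1%:R^-1 :> R by rewrite invr_gt0.
rewrite (_ : _ @^-1` _ = \bigcap_(i in [set: 'I_d])
   ((fun t => f t ord0 i) @^-1` ball (ratr (q ord0 i) : R) n.+1%:R^-1)).
  apply: fin_bigcap_measurable => // i _; rewrite -[X in measurable X]setTI.
  by apply: mf => //; apply: open_measurable; exact: ball_open.
apply/seteqP; split => t /=.
  by move=> -[_ h] i _; have := h ord0 i; rewrite mxE.
move=> h; split=> // i j; rewrite ord1 mxE; exact: h.
Qed.

End coordinates.

Lemma product_sigma_finite d1 d2 (T1 : measurableType d1)
    (T2 : measurableType d2) (R : realType)
    (m1 : {sigma_finite_measure set T1 -> \bar R})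
    (m2 : {sigma_finite_measure set T2 -> \bar R}) :
  sigma_finite setT (m1 \x m2)%E.
Proof.
have /sigma_finiteP[F [TF ndF Foo]] := sigma_finiteT m1.
have /sigma_finiteP[G [TG ndG Goo]] := sigma_finiteT m2.
exists (fun n => F n `*` G n).
  rewrite -setXTT TF TG predeqE => -[x y]; split.
    move=> [/= [n _ Fnx] [k _ Gky]]; exists (maxn n k) => //; split.
    - by move: x Fnx; exact/subsetPset/ndF/leq_maxl.
    - by move: y Gky; exact/subsetPset/ndG/leq_maxr.
  by move=> [n _ []/= ? ?]; split; exists n.
move=> k; have [? ?] := Foo k; have [? ?] := Goo k.
split; first exact: measurableX.
by rewrite product_measure1E// lte_mul_pinfty// ge0_fin_numE.
Qed.

Section lebesgue_measure_rV.
Context {R : realType}.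

Definition rV_cons n (p : R * 'rV[R]_n) : 'rV[R]_n.+1 :=
  row_mx (p.1%:M : 'rV[R]_1) p.2.

Definition rV_uncons n (x : 'rV[R]_n.+1) : R * 'rV[R]_n :=
  (x ord0 ord0, rsubmx (x : 'rV[R]_(1 + n))).

Lemma rV_consK n : cancel (@rV_cons n) (@rV_uncons n).
Proof.
move=> [t y]; rewrite /rV_uncons /rV_cons /= row_mxKr; congr pair.
have -> : ord0 = lshift n ord0 :> 'I_(1 + n) by exact/val_inj.
by rewrite (row_mxEl (t%:M : 'rV[R]_1)) mxE.
Qed.

Lemma measurable_rV_cons n : measurable_fun setT (@rV_cons n).
Proof.
apply: measurable_fun_coord => i.
case: (split_ordP (i : 'I_(1 + n))) => j ->.
  apply: (eq_measurable_fun fst) => [p _|]; last exact: measurable_fst.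
  by rewrite /rV_cons (row_mxEl (p.1%:M : 'rV[R]_1)) mxE !ord1.
apply: (eq_measurable_fun ((fun y : 'rV[R]_n => y ord0 j) \o snd)) => [p _|].
  by rewrite /rV_cons (row_mxEr (p.1%:M : 'rV[R]_1)).
by apply: measurableT_comp; [exact: measurable_coord|exact: measurable_snd].
Qed.

Lemma measurable_rV_uncons n : measurable_fun setT (@rV_uncons n).
Proof.
apply/measurable_fun_pairP; split; first exact: measurable_coord.
apply: measurable_fun_coord => i; apply: (eq_measurable_fun
  (fun x : 'rV[R]_n.+1 => x ord0 (rshift 1 i))) => [x _|].
  by rewrite /= mxE.
exact: measurable_coord.
Qed.

Section step.
Variables (n : nat) (m : {sigma_finite_measure set 'rV[R]_n -> \bar R}).

Definition lebesgue_rV_step : set 'rV[R]_n.+1 -> \bar R :=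
  pushforward (@lebesgue_measure R \x m)%E (@rV_cons n).

Let step0 : lebesgue_rV_step set0 = 0%E.
Proof. by rewrite /lebesgue_rV_step /pushforward preimage_set0 measure0. Qed.

Let step_ge0 A : (0 <= lebesgue_rV_step A)%E.
Proof. by rewrite /lebesgue_rV_step /pushforward measure_ge0. Qed.

Let step_sigma_additive : semi_sigma_additive lebesgue_rV_step.
Proof.
pose M := measure_function_pushforward__canonical__measure_function_Measure.
exact: (@measure_semi_sigma_additive _ _ _
  (M _ _ _ _ _ (@lebesgue_measure R \x m)%E _ (@measurable_rV_cons n))).
Qed.

HB.instance Definition _ := isMeasure.Build _ _ _ lebesgue_rV_step
  step0 step_ge0 step_sigma_additive.

Let step_sigma_finite : sigma_finite setT lebesgue_rV_step.
Proof.
have [F FT Foo] := product_sigma_finite (@lebesgue_measure R) m.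
exists (fun k => @rV_uncons n @^-1` F k).
  by rewrite -preimage_bigcup -FT preimage_setT.
move=> k; have [mF Fk] := Foo k; split.
  by rewrite -[X in measurable X]setTI; exact: measurable_rV_uncons.
rewrite /lebesgue_rV_step /pushforward -comp_preimage.
rewrite (_ : _ \o _ = id)//; apply/funext => p /=; exact: rV_consK.
Qed.

HB.instance Definition _ := Measure_isSigmaFinite.Build _ _ _ lebesgue_rV_step
  step_sigma_finite.

End step.

(* d-dimensional Lebesgue measure, as an iterated product of
   lebesgue_measure along R * R^n ~ R^(n+1). *)
Fixpoint lebesgue_rV (d : nat) : {sigma_finite_measure set 'rV[R]_d -> \bar R} :=
  match d with
  | 0 => \d_(0 : 'rV[R]_0)
  | n.+1 => lebesgue_rV_step (lebesgue_rV n)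
  end.

End lebesgue_measure_rV.

Section euclidean.
Context {R : realType} {d : nat}.
Implicit Types x y : 'rV[R]_d.

Definition dotv x y : R := \sum_i x ord0 i * y ord0 i.

Definition enorm x : R := Num.sqrt (dotv x x).

Definition eball x (r : R) : set 'rV[R]_d := [set y | enorm (y - x) < r].

Definition usphere : set 'rV[R]_d := [set x | enorm x = 1].

Lemma measurable_usphere : measurable usphere.
Proof.
rewrite (_ : usphere = enorm @^-1` [set 1]); last by apply/seteqP; split.
rewrite -[X in measurable X]setTI.
suff : measurable_fun setT enorm by apply => //; exact: measurable_set1.
have msqrt : measurable_fun setT (@Num.sqrt R).
  by apply: continuous_measurable_fun; exact: sqrt_continuous.
apply: (measurableT_comp msqrt); apply: measurable_sum => i.
by apply: measurable_funM; exact: measurable_coord.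
Qed.

End euclidean.

Section levy_measure.
Context {R : realType} {d : nat}.
Variables (alpha : R) (mu : {finite_measure set 'rV[R]_d -> \bar R}).

Definition levy_measure (D : set 'rV[R]_d) : \bar R :=
  (\int[mu]_(xi in usphere) \int[@lebesgue_measure R]_(r in `]0%R, +oo[)
     (\1_D (r *: xi) * r `^ (- 1 - alpha))%:E)%E.

Let f (D : set 'rV[R]_d) (p : 'rV[R]_d * R) : \bar R :=
  ((\1_D (p.2 *: p.1) * p.2 `^ (- 1 - alpha)) * \1_(`]0%R, +oo[) p.2)%:E.

Let f_ge0 D p : (0 <= f D p)%E.
Proof. by rewrite lee_fin !mulr_ge0// ?powR_ge0. Qed.

Let levy_fubini D : levy_measure D =
  (\int[mu]_(xi in usphere) fubini_F (@lebesgue_measure R) (f D) xi)%E.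
Proof.
apply: eq_integral => xi _; rewrite integral_mkcond; apply: eq_integral => r _.
rewrite patchE /f /= [\1_(`]0, +oo[) r]indicE.
by case: ifPn => _; rewrite ?mulr1 ?mulr0.
Qed.

Let mscale : measurable_fun setT (fun p : 'rV[R]_d * R => p.2 *: p.1).
Proof.
apply: measurable_fun_coord => i.
apply: (eq_measurable_fun (fun p : 'rV[R]_d * R => p.2 * p.1 ord0 i)).
  by move=> p _; rewrite mxE.
apply: measurable_funM; first exact: measurable_snd.
exact: (measurableT_comp (measurable_coord i) measurable_fst).
Qed.

Let mf D : measurable D -> measurable_fun setT (f D).
Proof.
move=> mD; apply/measurable_EFinP; apply: measurable_funM.
  apply: measurable_funM.
    exact: (measurableT_comp (measurable_indic mD) mscale).
  exact: (measurableT_comp (measurable_powR (- 1 - alpha)) measurable_snd).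
have mI : measurable (`]0%R, +oo[ : set R) by exact: measurable_itv.
exact: (measurableT_comp (measurable_indic mI) measurable_snd).
Qed.

Let levy0 : levy_measure set0 = 0%E.
Proof.
rewrite /levy_measure integral0_eq// => xi _.
by rewrite integral0_eq// => r _; rewrite indic0 mul0r.
Qed.

Let levy_ge0 D : (0 <= levy_measure D)%E.
Proof. by rewrite levy_fubini; do 2 apply: integral_ge0 => ? _. Qed.

Let levy_sigma_additive : semi_sigma_additive levy_measure.
Proof.
move=> F mF tF mUF.
rewrite [X in _ --> X](_ : _ = \sum_(n <oo) levy_measure (F n))%E.
  by apply/cvg_closeP; split; [exact: is_cvg_nneseries|rewrite closeE].
rewrite levy_fubini; under eq_eseriesr do rewrite levy_fubini.
rewrite -integral_nneseries; last 3 first.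
- exact: measurable_usphere.
- move=> n; apply: measurable_funTS.
  by apply: measurable_fun_fubini_tonelli_F => //; exact: mf.
- by move=> n xi _; apply: integral_ge0.
apply: eq_integral => xi _; rewrite /fubini_F -integral_nneseries//; last first.
  by move=> n; apply: (measurable_fun_pair2 xi); exact: mf.
apply: eq_integral => r _.
pose w := r `^ (- 1 - alpha) * \1_(`]0%R, +oo[) r.
have fE D : f D (xi, r) = (w%:E * (\1_D (r *: xi))%:E)%E.
  by rewrite /f /w /= -EFinM -mulrA mulrC.
rewrite fE (indic_bigcup _ tF) -nneseriesZl//.
by apply: eq_eseriesr => n _; rewrite fE.
Qed.

HB.instance Definition _ := isMeasure.Build _ _ _ levy_measure
  levy0 levy_ge0 levy_sigma_additive.

End levy_measure.

Section spectral_measure.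
Context {R : realType} {d : nat}.
Implicit Type mu : {finite_measure set 'rV[R]_d -> \bar R}.

Definition msupport mu : set 'rV[R]_d :=
  [set x | forall U, open U -> U x -> (0 < mu U)%E].

(* A measure on the unit sphere is encoded as a measure on R^d that does not
   charge the complement of the sphere. *)
Record spectral_measure mu : Prop := SpectralMeasure {
  spectral_sphere : mu (~` usphere) = 0%E ;
  spectral_symmetric : forall D : set 'rV[R]_d,
    measurable D -> mu [set - x | x in D] = mu D ;
  spectral_nondegenerate : forall V : {vspace 'rV[R]_d},
    msupport mu `<=` [set` V] -> V = fullv }.

End spectral_measure.

Section stable_semigroup.
Context {R : realType} {d : nat}.
Implicit Types (nu : {measure set 'rV[R]_d -> \bar R}).

(* The hypothesis gamma <= d is not imposed: it is a consequence. *)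
Definition gamma_measure nu (gamma : R) : Prop :=
  exists c : R, forall (x : 'rV[R]_d) (r : R),
    enorm x = 1 -> 0 < r < 1 / 2 -> (nu (eball x r) <= (c * r `^ gamma)%:E)%E.

Definition charf (P : probability 'rV[R]_d R) (u : 'rV[R]_d) : R[i] :=
  ((\int[P]_y cos (dotv u y)) +i* (\int[P]_y sin (dotv u y)))%C.

Definition levy_exponent nu (u : 'rV[R]_d) : R :=
  \int[nu]_y (1 - cos (dotv u y)).

(* The value of the family P at t <= 0 is unconstrained. *)
Record levy_semigroup nu (P : R -> probability 'rV[R]_d R) : Prop :=
  LevySemigroup {
  semigroup_convolution : forall s t A, 0 < s -> 0 < t -> measurable A ->
    P (s + t) A = (\int[P t]_y P s [set x | A (x + y)%R])%E ;
  semigroup_charf : forall t u, 0 < t ->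
    charf (P t) u = (expR (- (t * levy_exponent nu u)))%:C%C }.

End stable_semigroup.

Section smooth_density.
Context {R : realType} {d : nat}.
Implicit Types (p : 'rV[R]_d -> R) (s : seq 'I_d).

Definition partial (i : 'I_d) p : 'rV[R]_d -> R := 'D_(delta_mx ord0 i) p.

Definition partials s p : 'rV[R]_d -> R := foldr partial p s.

(* D^beta.  The partial derivatives are taken in decreasing order of the index
   (last coordinate first); for a smooth p the order is irrelevant. *)
Definition mderiv (beta : 'I_d -> nat) p : 'rV[R]_d -> R :=
  partials (flatten [seq nseq (beta i) i | i <- enum 'I_d]) p.

(* C^infinity: every iterated partial derivative exists and is continuous
   (lim, hence 'D_v, is total, so existence has to be required). *)
Definition smooth p : Prop := forall s, continuous (partials s p) /\
  forall x i, derivable (partials s p) x (delta_mx ord0 i).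

Record density (P : probability 'rV[R]_d R) p : Prop := Density {
  density_ge0 : forall x, 0 <= p x ;
  densityE : forall A, measurable A ->
    P A = (\int[lebesgue_rV d]_(x in A) (p x)%:E)%E }.

End smooth_density.

(* Main.v *)
(* Let [E = exp (- Phi_1)], where [Phi_1] is the part of the characteristic exponent
   coming from the jumps [|y| < 1], and let [nu_2] be the restriction of [nu] to
   [|y| >= 1], a finite measure of mass [M] with cosine transform [N].  Then
   [exp (- Phi) = exp (- M) E exp N].
   - By scaling and nondegeneracy, [Phi_1 u >= c |u|^alpha] for [|u| >= 1], so [E]
     decays rapidly; the Fourier transform of [E] times any polynomial decays faster
     than any power.
   - Write [V x = (1 + |x|)^(-alpha-gamma)].  The gamma-measure property gives
     [int V (x - z) nu_2(dz) <= C V x]; since multiplication by [N] is convolution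
     with [nu_2], expanding [exp N] bounds the transform of any polynomial times
     [exp (- Phi)] by a multiple of [V].
   - Fourier inversion, with the transform of [E] as approximate identity, shows
     that [p_1] is a constant multiple of the transform of [exp (- Phi)].  All its
     derivatives are thus at most a multiple of [V], and the increments follow from
     the mean value theorem if [|y - x| <= 1], trivially otherwise. *)
Require Import Defs.
From HB Require Import structures.
From mathcomp Require Import all_boot all_order all_algebra.
From mathcomp Require Import complex.
From mathcomp Require Import all_classical all_reals all_analysis.
From mathcomp Require Import measurable_realfun ring lra.
Import Order.TTheory GRing.Theory Num.Theory.
Import numFieldNormedType.Exports.
Local Open Scope classical_set_scope.
Local Open Scope ring_scope.

Set Implicit Arguments.
Unset Strict Implicit.
Unset Printing Implicit Defensive.

(** Integrating [exp (- Phi)] by parts repeatedly is impossible: [Phi] is homogeneous of degree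
    [alpha < 2], hence not twice differentiable at the origin. Discarding the jumps [|y| >= 1]
    removes this singularity, and the discarded factor [exp N] is never differentiated. For the
    small jumps the only analytic input is the truncated second moment of [nu]: first derivatives of
    the exponent suffice, because the induction on the decay order runs over all polynomials and all
    phases at once. Transforms are real throughout, a cosine with a phase taking the place of the
    complex exponential; the sine parts that convolution produces vanish by symmetry of the
    measures. The factor [kappa] in the inversion formula is the integral of the transform of [E].
    It depends on [mu] and [alpha] but not on the semigroup, so the final constant can be fixed
    before [P] and [p1] are given; its value is not computed, only [kappa <> 0] is shown. The
    estimates require a nonnegative exponent, so a negative [gamma] is first replaced by 0, which is
    always admissible. *)

(** * Elementary inequalities for sine, cosine and the exponential *)

Section calculus.
Context {R : realType}.
Implicit Types (a b s t x : R) (f : R -> R).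

Lemma MVT_le f (df : R -> R) a b B :
  (forall x, is_derive x 1 f (df x)) ->
  (forall x, Num.min a b <= x <= Num.max a b -> `|df x| <= B) ->
  `|f b - f a| <= B * `|b - a|.
Proof.
move=> fdf; wlog ab : a b / a <= b => [hw|] dfB.
  have [/hw|/ltW ba] := leP a b; first exact.
  rewrite distrC [`|b - a|]distrC; apply: hw => // x hx; apply: dfB.
  by rewrite minC maxC.
have cf : {within `[a, b], continuous f}.
  apply: continuous_subspaceT => x.
  by apply: differentiable_continuous; apply/derivable1_diffP; case: (fdf x).
have [c ci ->] := @MVT_segment R f df a b ab (fun x _ => fdf x) cf.
rewrite normrM ler_wpM2r// dfB// (min_idPl ab) (max_idPr ab).
by move: ci; rewrite in_itv.
Qed.

Lemma norm_sin_le1 x : `|sin x| <= 1.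
Proof. by rewrite ler_norml sin_geN1 sin_le1. Qed.

Lemma norm_cos_le1 x : `|cos x| <= 1.
Proof. by rewrite ler_norml cos_geN1 cos_le1. Qed.

Lemma sin_lip a b : `|sin a - sin b| <= `|a - b|.
Proof.
rewrite -[leRHS]mul1r; apply: (@MVT_le _ cos) => x _.
by rewrite norm_cos_le1.
Qed.

Lemma norm_sin_le x : `|sin x| <= `|x|.
Proof. by have := sin_lip x 0; rewrite sin0 !subr0. Qed.

(** Mean value inequality for [cos (a + s) + s sin a]: its derivative [sin a - sin (a + s)] is at
    most [|t|] because sine is 1-Lipschitz. This one estimate supplies every second-order remainder
    below. *)
Lemma cos_taylor2 a t : `|cos (a + t) - cos a + t * sin a| <= t ^+ 2.
Proof.
pose g := fun s : R => cos (a + s) + s * sin a.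
have dg x : is_derive x 1 g (- sin (a + x) + sin a).
  rewrite /g; apply: is_derive_eq; rewrite !(scale1r, scaler0, add0r, addr0).
  by rewrite /GRing.scale/= mulr1; ring.
have := @MVT_le g _ 0 t `|t| dg.
rewrite /g addr0 mul0r addr0 subr0 -normrM -expr2 ger0_norm ?sqr_ge0//.
rewrite -addrA [_ * _ - _]addrC addrA; apply => x hx.
rewrite addrC (le_trans (sin_lip _ _))// opprD addrA subrr sub0r normrN.
by move: hx; have [t0|t0] := leP 0 t; move=> /andP[h1 h2];
  [rewrite !ger0_norm|rewrite !ler0_norm ?lerN2 // ltW].
Qed.

Lemma onem_cos_ge0 x : 0 <= 1 - cos x.
Proof. by rewrite subr_ge0 cos_le1. Qed.

Lemma onem_cos_le2 x : 1 - cos x <= 2.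
Proof. by have := cos_geN1 x; lra. Qed.

Lemma onem_cos_le x : 1 - cos x <= x ^+ 2.
Proof.
have := cos_taylor2 0 x; rewrite add0r cos0 sin0 mulr0 addr0 distrC.
by move=> /(le_trans (ler_norm _)).
Qed.

(** Write [1 - cos x = 2 sin (x / 2) ^ 2]. On [[0, 1/2]] the cosine is at least 1/2, hence
    [sin t >= t / 2] by the mean value theorem. *)
Lemma onem_cos_ge x : `|x| <= 1 -> x ^+ 2 / 8 <= 1 - cos x.
Proof.
wlog x0 : x / 0 <= x => [hw x1|].
  case: (leP 0 x) => [|/ltW] x0; first exact: hw.
  by rewrite -cosN -sqrrN; apply: hw; rewrite ?normrN ?oppr_ge0.
rewrite ger0_norm// => x1.
have -> : x = (x / 2) *+ 2 by rewrite mulr2n -splitr.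
set t := x / 2; have t0 : 0 <= t <= 1 / 2 by rewrite /t; lra.
have : t / 2 <= sin t.
  have [c] := @MVT_segment R sin cos 0 t (proj1 (andP t0)) (fun x _ => is_derive_sin x)
    (continuous_subspaceT (@continuous_sin R)).
  rewrite in_itv/= sin0 !subr0 => /andP[c0 ct] ->.
  have : c ^+ 2 <= 1 / 4 by nra.
  by have := onem_cos_le c; nra.
move=> ts; rewrite cos_mulr2n cos2sin2.
have : (t / 2) ^+ 2 <= sin t ^+ 2.
  by move: t0 => /andP[t0 _]; rewrite ler_pXn2r ?nnegrE//; lra.
by move=> h; nra.
Qed.

(** Both halves come from [1 + z <= exp z], applied at [- (b - a)] and at [b - a]. The error
    involves only the two endpoint values, so decay of [exp (- phi)] at [u] and at its translate is
    enough, with no supremum over a segment. *)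
Lemma expRN_taylor2 a b :
  `|expR (- b) - expR (- a) + expR (- a) * (b - a)| <=
  (b - a) ^+ 2 * (expR (- a) + expR (- b)).
Proof.
have hA : expR (- a) * (1 - (b - a)) <= expR (- b).
  have -> : expR (- b) = expR (- a) * expR (- (b - a)).
    by rewrite -expRD; congr expR; lra.
  by rewrite ler_wpM2l ?expR_ge0// expR_ge1Dx.
have hB : expR (- b) * (1 + (b - a)) <= expR (- a).
  have -> : expR (- a) = expR (- b) * expR (b - a).
    by rewrite -expRD; congr expR; lra.
  by rewrite ler_wpM2l ?expR_ge0// expR_ge1Dx.
have eA := expR_ge0 (- a); have eB := expR_ge0 (- b).
move: (expR (- a)) (expR (- b)) hA hB eA eB => A B hA hB eA eB.
set D := b - a in hA hB *.
have D2 : 0 <= D ^+ 2 by exact: sqr_ge0.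
have h : D * (A - B) <= D ^+ 2 * (A + B).
  have [D0|D0] := leP 0 D.
    have : D * (A - B) <= D * (A * D) by rewrite ler_wpM2l//; lra.
    by move=> /le_trans; apply; rewrite expr2; nra.
  have : (- D) * (B - A) <= (- D) * (- (B * D)) by rewrite ler_wpM2l//; lra.
  have : 0 <= D ^+ 2 * A by rewrite mulr_ge0.
  by rewrite expr2; lra.
by rewrite ler_norml; apply/andP; split; lra.
Qed.

End calculus.

(** * Euclidean norm and inner product, with their Borel measurability *)

Section euclid.
Context {R : realType} {d : nat}.
Implicit Types (x y z u v : 'rV[R]_d).

Lemma dotvC x y : dotv x y = dotv y x.
Proof. by apply: eq_bigr => i _; rewrite mulrC. Qed.

Lemma dotvDl x y z : dotv (x + y) z = dotv x z + dotv y z.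
Proof. by rewrite /dotv -big_split; apply: eq_bigr => i _; rewrite mxE mulrDl. Qed.

Lemma dotvDr x y z : dotv z (x + y) = dotv z x + dotv z y.
Proof. by rewrite !(dotvC z) dotvDl. Qed.

Lemma dotvZl a x y : dotv (a *: x) y = a * dotv x y.
Proof. by rewrite /dotv mulr_sumr; apply: eq_bigr => i _; rewrite mxE mulrA. Qed.

Lemma dotvZr a x y : dotv x (a *: y) = a * dotv x y.
Proof. by rewrite !(dotvC x) dotvZl. Qed.

Lemma dotvNl x y : dotv (- x) y = - dotv x y.
Proof. by rewrite -scaleN1r dotvZl mulN1r. Qed.

Lemma dotvNr x y : dotv x (- y) = - dotv x y.
Proof. by rewrite !(dotvC x) dotvNl. Qed.

Lemma dotvBr x y z : dotv z (x - y) = dotv z x - dotv z y.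
Proof. by rewrite dotvDr dotvNr. Qed.

Lemma dotv0r x : dotv x 0 = 0.
Proof. by rewrite -(scale0r 0) dotvZr mul0r. Qed.

Lemma dotv0l x : dotv 0 x = 0.
Proof. by rewrite dotvC dotv0r. Qed.

Lemma dotv_delta x i : dotv x (delta_mx ord0 i) = x ord0 i.
Proof.
rewrite /dotv (bigD1 i)//= mxE !eqxx mulr1 big1 ?addr0// => j ji.
by rewrite mxE (negbTE ji) andbF mulr0.
Qed.

Lemma dotv_ge0 x : 0 <= dotv x x.
Proof. by apply: sumr_ge0 => i _; rewrite -expr2 sqr_ge0. Qed.

Lemma sqr_enorm x : enorm x ^+ 2 = dotv x x.
Proof. by rewrite sqr_sqrtr// dotv_ge0. Qed.

Lemma enorm_ge0 x : 0 <= enorm x.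
Proof. exact: sqrtr_ge0. Qed.

Lemma coord_le x i : `|x ord0 i| <= enorm x.
Proof.
rewrite -sqrtr_sqr ler_sqrt ?dotv_ge0// expr2 /dotv (bigD1 i)//= lerDl.
by apply: sumr_ge0 => j _; rewrite -expr2 sqr_ge0.
Qed.

Lemma enorm0_eq0 x : enorm x = 0 -> x = 0.
Proof.
move=> x0; apply/rowP => i; rewrite mxE; apply/eqP.
by rewrite -normr_eq0 eq_le normr_ge0 -x0 coord_le.
Qed.

Lemma enorm0 : enorm (0 : 'rV[R]_d) = 0.
Proof. by rewrite /enorm dotv0r sqrtr0. Qed.

Lemma enorm_gt0 x : x != 0 -> 0 < enorm x.
Proof.
rewrite lt_neqAle enorm_ge0 andbT eq_sym; apply: contra => /eqP h.
by apply/eqP/esym/enorm0_eq0.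
Qed.

Lemma enormZ a x : enorm (a *: x) = `|a| * enorm x.
Proof. by rewrite /enorm dotvZl dotvZr mulrA -expr2 sqrtrM ?sqr_ge0// sqrtr_sqr. Qed.

Lemma enormN x : enorm (- x) = enorm x.
Proof. by rewrite -scaleN1r enormZ normrN1 mul1r. Qed.

Lemma dotv_le x y : `|dotv x y| <= enorm x * enorm y.
Proof.
have [->|y0] := eqVneq y 0; first by rewrite dotv0r normr0 enorm0 mulr0.
have ny := enorm_gt0 y0.
rewrite -(@ler_pXn2r _ 2%N)// ?nnegrE ?mulr_ge0 ?enorm_ge0//.
rewrite real_normK ?num_real// exprMn.
have : 0 <= dotv (enorm y ^+ 2 *: x - dotv x y *: y) (enorm y ^+ 2 *: x - dotv x y *: y).
  exact: dotv_ge0.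
rewrite !(dotvDl, dotvDr, dotvNl, dotvNr, dotvZl, dotvZr) (dotvC y x) -!sqr_enorm.
have : 0 < enorm y ^+ 2 by rewrite exprn_gt0.
move: (enorm y ^+ 2) (enorm x ^+ 2) (dotv x y) => Y X c Y0 h.
rewrite -subr_ge0 -(pmulr_rge0 _ Y0); apply: le_trans h _; nra.
Qed.

Lemma enormD x y : enorm (x + y) <= enorm x + enorm y.
Proof.
rewrite -(@ler_pXn2r _ 2%N)// ?nnegrE ?addr_ge0 ?enorm_ge0//.
rewrite sqr_enorm !(dotvDl, dotvDr) (dotvC y x) sqrrD -!sqr_enorm.
by have := le_trans (ler_norm _) (dotv_le x y); lra.
Qed.

Lemma enormB x y : enorm (x - y) = enorm (y - x).
Proof. by rewrite -enormN opprB. Qed.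

Lemma enorm_le_sum x : enorm x <= \sum_i `|x ord0 i|.
Proof.
rewrite -(@ler_pXn2r _ 2%N)// ?nnegrE ?enorm_ge0 ?sumr_ge0//.
rewrite sqr_enorm expr2 mulr_suml; apply: ler_sum => i _.
rewrite -expr2 -(@real_normK _ (x ord0 i)) ?num_real// expr2 ler_wpM2l//.
by rewrite (bigD1 i)//= lerDl sumr_ge0.
Qed.

Lemma measurable_enorm : measurable_fun setT (@enorm R d).
Proof.
have msqrt : measurable_fun setT (@Num.sqrt R).
  by apply: continuous_measurable_fun; exact: sqrt_continuous.
apply: (measurableT_comp msqrt); apply: measurable_sum => i.
by apply: measurable_funM; exact: measurable_coord.
Qed.

Lemma measurable_dotv d' (T : measurableType d') (f g : T -> 'rV[R]_d) :
  measurable_fun setT f -> measurable_fun setT g ->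
  measurable_fun setT (fun t => dotv (f t) (g t)).
Proof.
move=> mf mg; apply: measurable_sum => i; apply: measurable_funM.
  exact: (measurableT_comp (measurable_coord i) mf).
exact: (measurableT_comp (measurable_coord i) mg).
Qed.

Lemma measurable_rVZ a : measurable_fun setT (fun x : 'rV[R]_d => a *: x).
Proof.
apply: measurable_fun_coord => i; apply: (eq_measurable_fun (fun x => a * x ord0 i)).
  by move=> x _; rewrite mxE.
by apply: measurable_funM => //; exact: measurable_coord.
Qed.

Lemma measurable_rVD d' (T : measurableType d') (f g : T -> 'rV[R]_d) :
  measurable_fun setT f -> measurable_fun setT g ->
  measurable_fun setT (fun t => f t + g t).
Proof.
move=> mf mg; apply: measurable_fun_coord => i.
apply: (eq_measurable_fun (fun t => f t ord0 i + g t ord0 i)).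
  by move=> t _; rewrite mxE.
apply: measurable_funD; first exact: (measurableT_comp (measurable_coord i) mf).
exact: (measurableT_comp (measurable_coord i) mg).
Qed.

Lemma measurable_rVN d' (T : measurableType d') (f : T -> 'rV[R]_d) :
  measurable_fun setT f -> measurable_fun setT (fun t => - f t).
Proof.
move=> mf; under eq_fun do rewrite -scaleN1r.
exact: (measurableT_comp (measurable_rVZ _) mf).
Qed.

Lemma eball_preimage x r : eball x r = (fun y => enorm (y - x)) @^-1` `]-oo, r[.
Proof. by apply/seteqP; split => y /=; rewrite in_itv. Qed.

Lemma measurable_eball x r : measurable (eball x r).
Proof.
rewrite eball_preimage -[X in measurable X]setTI.
apply: (measurableT_comp measurable_enorm) => //.
by apply: measurable_rVD => //; exact: measurable_cst.
Qed.

End euclid.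

(** * Real-valued integrals: domination, Fubini, measures with a density *)

Section real_integral.
Context d (T : measurableType d) (R : realType).
Variable m : {measure set T -> \bar R}.
Implicit Types (f g : T -> R).

Lemma integrable_dominated f g : measurable_fun setT f ->
  (forall x, `|f x| <= g x) -> m.-integrable setT (EFin \o g) ->
  m.-integrable setT (EFin \o f).
Proof.
move=> mf fg; apply: le_integrable => //; first exact/measurable_EFinP.
by move=> x _; rewrite /= lee_fin (le_trans (fg x))// ler_norm.
Qed.

Lemma norm_Rintegral_le f g : measurable_fun setT f ->
  (forall x, `|f x| <= g x) -> m.-integrable setT (EFin \o g) ->
  `|\int[m]_x f x| <= \int[m]_x g x.
Proof.
move=> mf fg ig; have if_ := integrable_dominated mf fg ig.
apply: (le_trans (le_normr_Rintegral measurableT if_)).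
apply: le_Rintegral => //; exact: integrable_norm.
Qed.

Lemma EFin_Rintegral f : m.-integrable setT (EFin \o f) ->
  (\int[m]_x f x)%:E = (\int[m]_x (f x)%:E)%E.
Proof. by move=> fi; rewrite fineK//; exact: integrable_fin_num. Qed.

Lemma Rintegral_dct (f_ : (T -> R)^nat) f g :
  (forall n, measurable_fun setT (f_ n)) -> measurable_fun setT f ->
  (forall x, f_ ^~ x @ \oo --> f x) ->
  m.-integrable setT (EFin \o g) -> (forall n x, `|f_ n x| <= g x) ->
  (fun n => \int[m]_x f_ n x) @ \oo --> \int[m]_x f x.
Proof.
move=> mf_ mf cf ig fg.
have [|||||if_ _ h] := @dominated_convergence _ _ _ m setT measurableT
  (fun n => EFin \o f_ n) (EFin \o f) (EFin \o g).
- by move=> n; exact/measurable_EFinP.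
- exact/measurable_EFinP.
- by apply/aeW => x _; apply: cvg_EFin => //; [exact: nearW|exact: cf].
- exact: ig.
- by apply/aeW => x n _; rewrite /= lee_fin.
by apply: fine_cvg; rewrite EFin_Rintegral.
Qed.

End real_integral.

(** Tonelli for the positive and the negative part separately. Sections need not be integrable:
    where the extended integral is infinite, [fine] returns its default value and measurability
    persists. *)
Lemma measurable_Rintegral d1 d2 (T1 : measurableType d1) (T2 : measurableType d2)
    (R : realType) (m : {sigma_finite_measure set T2 -> \bar R}) (F : T1 * T2 -> R) :
  measurable_fun setT F -> measurable_fun setT (fun x => \int[m]_y F (x, y)).
Proof.
move=> mF; apply: (measurableT_comp (f := fine)) => //.
have mEF : measurable_fun setT (EFin \o F) by exact/measurable_EFinP.
have hp : measurable_fun setT (fubini_F m (EFin \o F)^\+%E).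
  by apply: measurable_fun_fubini_tonelli_F => //; exact: measurable_funepos.
have hn : measurable_fun setT (fubini_F m (EFin \o F)^\-%E).
  by apply: measurable_fun_fubini_tonelli_F => //; exact: measurable_funeneg.
rewrite (_ : (fun x => _) = fubini_F m (EFin \o F)^\+%E \- fubini_F m (EFin \o F)^\-%E)%E.
  exact: emeasurable_funB.
apply/funext => x; rewrite [LHS]integralE /fubini_F.
by congr (_ - _)%E; apply: eq_integral => y _; rewrite ?funeposE ?funenegE.
Qed.

Section real_fubini.
Context d1 d2 (T1 : measurableType d1) (T2 : measurableType d2) (R : realType).
Variables (m1 : {sigma_finite_measure set T1 -> \bar R})
  (m2 : {sigma_finite_measure set T2 -> \bar R}).
Variables (F : T1 * T2 -> R) (g : T1 -> R) (h : T2 -> R).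
Hypotheses (mF : measurable_fun setT F)
  (Fgh : forall x y, `|F (x, y)| <= g x * h y)
  (ig : m1.-integrable setT (EFin \o g)) (ih : m2.-integrable setT (EFin \o h)).

Let integrable_prod : (m1 \x m2)%E.-integrable setT (EFin \o F).
Proof.
apply/integrable12ltyP; first exact/measurable_EFinP.
apply: (@le_lt_trans _ _ (\int[m1]_x (`|(g x)%:E| * \int[m2]_y `|(h y)%:E|))%E).
  apply: ge0_le_integral => //.
  - by move=> x _; apply: integral_ge0.
  - apply: (measurable_fun_fubini_tonelli_F (abse \o (EFin \o F))) => //=.
    by apply: measurableT_comp => //; exact/measurable_EFinP.
  - apply: emeasurable_funM => //.
    by apply: measurableT_comp => //; exact: measurable_int ig.
  - move=> x _; rewrite -ge0_integralZl//; last first.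
      by apply: measurableT_comp => //; exact: measurable_int ih.
    apply: ge0_le_integral => //.
    + apply: measurableT_comp => //; apply/measurable_EFinP.
      exact: (measurableT_comp mF (pair1_measurable x)).
    + apply: measurable_funeM; apply: measurableT_comp => //.
      exact: measurable_int ih.
    + move=> y _; rewrite lee_fin -normrM.
      by rewrite (le_trans (Fgh x y))// ler_norm.
have [_ hi] := integrableP _ _ _ ih; have [mg gi] := integrableP _ _ _ ig.
rewrite ge0_integralZr//; first by apply: lte_mul_pinfty => //;
  [exact: integral_ge0|rewrite ge0_fin_numE// integral_ge0].
  exact: measurableT_comp.
exact: integral_ge0.
Qed.

Let section1 x : m2.-integrable setT (fun y => (F (x, y))%:E).
Proof.
apply: (@integrable_dominated _ _ _ m2 (fun y => F (x, y)) (fun y => g x * h y)).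
- exact: (measurableT_comp mF (pair1_measurable x)).
- exact: Fgh.
- exact: (integrableZl measurableT _ ih).
Qed.

Let section2 y : m1.-integrable setT (fun x => (F (x, y))%:E).
Proof.
apply: (@integrable_dominated _ _ _ m1 (fun x => F (x, y)) (fun x => g x * h y)).
- exact: (measurableT_comp mF (pair2_measurable y)).
- by move=> x; exact: Fgh.
- by under eq_fun do rewrite mulrC; exact: (integrableZl measurableT _ ig).
Qed.

(** Domination by a product [g x * h y] yields integrability on the product space and of every
    section, so the real integrals coincide with the extended ones. *)
Lemma Rintegral_Fubini :
  \int[m1]_x \int[m2]_y F (x, y) = \int[m2]_y \int[m1]_x F (x, y).
Proof.
congr fine; under eq_integral do rewrite (EFin_Rintegral (section1 _)).
under [RHS]eq_integral do rewrite (EFin_Rintegral (section2 _)).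
exact: (Fubini integrable_prod).
Qed.

End real_fubini.

Section density_integral.
Context d (T : measurableType d) (R : realType).
Variables (m n : {measure set T -> \bar R}) (p : T -> R).
Hypotheses (mp : measurable_fun setT p) (p0 : forall x, 0 <= p x)
  (npE : forall A, measurable A -> n A = (\int[m]_(x in A) (p x)%:E)%E).
Local Open Scope ereal_scope.

Import HBNNSimple.

Let density_indic E : measurable E ->
  \int[n]_x (\1_E x)%:E = \int[m]_x ((\1_E x)%:E * (p x)%:E).
Proof.
move=> mE; rewrite integral_indic// setIT npE// integral_mkcond.
apply: eq_integral => x _; rewrite patchE indicE; case: ifPn => _.
  by rewrite mul1e.
by rewrite mul0e.
Qed.

Let density_nnsfun (h : {nnsfun T >-> R}) :
  \int[n]_x (h x)%:E = \int[m]_x ((h x)%:E * (p x)%:E).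
Proof.
under [LHS]eq_integral do rewrite fimfunE -fsumEFin//.
rewrite [LHS]ge0_integral_fsum//; last 2 first.
  - by move=> r; exact/measurable_EFinP/measurableT_comp.
  - by move=> k x _; rewrite EFinM nnfun_muleindic_ge0.
under [RHS]eq_integral.
  move=> x xD; rewrite fimfunE -fsumEFin// muleC ge0_mule_fsumr; last first.
    by move=> r; rewrite EFinM nnfun_muleindic_ge0.
  over.
rewrite [RHS]ge0_integral_fsum//; last 2 first.
  - move=> r; apply: emeasurable_funM; first exact/measurable_EFinP.
    by apply/measurable_EFinP; apply/measurableT_comp.
  - move=> k x _; rewrite mule_ge0// ?lee_fin//.
    by have := nnfun_muleindic_ge0 h k x; rewrite -EFinM lee_fin.
apply: eq_fsbigr => r _.
rewrite integralZl_indic_nnsfun// density_indic//.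
have [r0|r0] := leP 0%R r.
  rewrite -ge0_integralZl//.
  - by apply: eq_integral => x _; rewrite [in RHS]EFinM [RHS]muleC -muleA.
  - by apply: emeasurable_funM; apply/measurable_EFinP.
  - by move=> x _; rewrite mule_ge0// lee_fin.
rewrite (_ : _ @^-1` _ = set0) ?indic0; last first.
  by rewrite preimage_nnfun0.
by rewrite !integral0_eq ?mule0// => x _; rewrite ?indic0 ?mulr0 ?mule0 ?mul0e.
Qed.

(** The density relation is known on sets only; it extends through indicators, simple functions and
    monotone limits. It serves for [p1] and, with an indicator as density, for restrictions of a
    measure. *)
Lemma ge0_integral_density (f : T -> \bar R) :
  measurable_fun setT f -> (forall x, 0 <= f x) ->
  \int[n]_x f x = \int[m]_x (f x * (p x)%:E).
Proof.
move=> mf f0; pose f_ := nnsfun_approx measurableT mf.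
transitivity (limn (fun k => \int[n]_x (f_ k x)%:E)).
  rewrite -monotone_convergence//=.
  - apply: eq_integral => x /[!inE] xD; apply/esym/cvg_lim => //=.
    exact: cvg_nnsfun_approx.
  - by move=> k; apply: measurableT_comp => //; exact: measurable_funTS.
  - by move=> k x _; rewrite lee_fin.
  - by move=> x _ a b ab; rewrite lee_fin//; exact/lefP/nd_nnsfun_approx.
rewrite (_ : \int[m]_x _ =
    limn (fun k => \int[m]_x ((f_ k x)%:E * (p x)%:E))); last first.
  rewrite -monotone_convergence//=.
  - apply: eq_integral => x /[!inE] xD; apply/esym/cvg_lim => //.
    by apply: cvgeZr => //; exact: cvg_nnsfun_approx.
  - by move=> k; apply: emeasurable_funM; apply/measurable_EFinP => //;
      exact/measurable_funTS.
  - by move=> k x _; rewrite mule_ge0 ?lee_fin.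
  - move=> x _ a b ab; rewrite lee_wpmul2r ?lee_fin//.
    exact/lefP/nd_nnsfun_approx.
by congr (limn _); apply/funext => k /=; rewrite density_nnsfun.
Qed.

End density_integral.

(** * Lebesgue measure under affine maps, in one and in several dimensions *)

Section affine1.
Context {R : realType}.
Notation leb := (@lebesgue_measure R).

Let aff (a b : R) := fun t : measurableTypeR R => (a * t + b : measurableTypeR R).

Let measurable_aff a b : measurable_fun setT (aff a b).
Proof. by apply: measurable_funD => //; exact: measurable_funM. Qed.

(** Uniqueness of Lebesgue measure reduces this to half-open intervals. For [a < 0] the preimage is
    closed at the other end, which leaves its length unchanged. *)
Lemma lebesgue_measure_affine (a b : R) : a != 0 ->
  forall A, measurable A -> leb A = (`|a|%:E * leb (aff a b @^-1` A))%E.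
Proof.
move=> a0 A mA.
pose M := measure_function_pushforward__canonical__measure_function_Measure.
pose pf : {measure set _ -> \bar R} := M _ _ _ _ _ leb _ (measurable_aff a b).
pose na : {nonneg R} := NngNum (normr_ge0 a).
apply: (etrans (lebesgue_measure_unique (mu := mscale na pf) _ mA)) => // _ [[p q]] _ <-.
rewrite [RHS](_ : _ = (`|a|%:E * leb (aff a b @^-1` `]p, q]%classic))%E)//.
have [a_gt0|a_lt0] := ltP 0 a.
  have -> : aff a b @^-1` `]p, q]%classic = `](p - b) / a, (q - b) / a]%classic.
    apply/seteqP; split => t /=; rewrite !in_itv/= /aff.
      by rewrite ltr_pdivrMr// ler_pdivlMr// ltrBlDr lerBrDr mulrC.
    by rewrite ltr_pdivrMr// ler_pdivlMr// ltrBlDr lerBrDr mulrC.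
  rewrite !lebesgue_measure_itv/= !lte_fin ltr_pM2r ?invr_gt0// ltrD2r.
  case: ifP => _; last by rewrite mule0.
  by rewrite -!EFinB -EFinM gtr0_norm// -mulrBl mulrCA divff// mulr1 opprD addrACA subrr addr0.
have {}a_lt0 : a < 0 by rewrite lt_neqAle a0.
have -> : aff a b @^-1` `]p, q]%classic = `[(q - b) / a, (p - b) / a[%classic.
  by apply/seteqP; split => t /=; rewrite !in_itv/= /aff;
    rewrite ltr_ndivlMr// ler_ndivrMr// ltrBlDr lerBrDr mulrC andbC.
rewrite !lebesgue_measure_itv/= !lte_fin ltr_nM2r ?invr_lt0// ltrD2r.
case: ifP => _; last by rewrite mule0.
rewrite -!EFinB -EFinM ltr0_norm// -mulrBl mulNr mulrCA divff// mulr1; congr EFin; ring.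
Qed.

Lemma ge0_integral_affine1 (a b : R) (f : R -> \bar R) : a != 0 ->
  measurable_fun setT f -> (forall x, 0 <= f x)%E ->
  (\int[leb]_t f t = `|a|%:E * \int[leb]_t f (a * t + b)%R)%E.
Proof.
move=> a0 mf f0.
pose M := measure_function_pushforward__canonical__measure_function_Measure.
pose pf : {measure set _ -> \bar R} := M _ _ _ _ _ leb _ (measurable_aff a b).
pose na : {nonneg R} := NngNum (normr_ge0 a).
rewrite (@eq_measure_integral _ _ _ setT (mscale na pf)); last first.
  by move=> A mA _; apply: (etrans (lebesgue_measure_affine b a0 mA)).
rewrite ge0_integral_mscale//; congr (_ * _)%E.
by rewrite (ge0_integral_pushforward (measurable_aff a b)).
Qed.

End affine1.

Section affine_rV.
Context {R : realType}.

Lemma ge0_integral_rV_step n (f : 'rV[R]_n.+1 -> \bar R) :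
  measurable_fun setT f -> (forall x, 0 <= f x)%E ->
  (\int[lebesgue_rV n.+1]_x f x =
   \int[@lebesgue_measure R]_t \int[lebesgue_rV n]_y f (rV_cons (t, y)))%E.
Proof.
move=> mf f0.
transitivity (\int[(@lebesgue_measure R \x lebesgue_rV n)]_p (f \o @rV_cons R n) p)%E.
  have := @ge0_integral_pushforward _ _ (measurableTypeR R * 'rV[R]_n)%type 'rV[R]_n.+1
    R (@rV_cons R n) (@measurable_rV_cons R n)
    (@lebesgue_measure R \x lebesgue_rV n)%E setT f measurableT mf (fun y _ => f0 y).
  rewrite preimage_setT => <-.
  apply: eq_measure_integral => [|A mA _ //]; exact: measurable_rV_cons.
apply: (@fubini_tonelli1 _ _ (measurableTypeR R) 'rV[R]_n R _ _ (f \o @rV_cons R n)).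
  by apply: measurableT_comp => //; exact: measurable_rV_cons.
by move=> x; exact: f0.
Qed.

(** Induction on the dimension, peeling off the first coordinate as in the construction of
    [lebesgue_rV]. Negative [a] is allowed because the inversion argument reflects [z] to
    [x - z]. *)
Lemma ge0_integral_affine d (a : R) (h : 'rV[R]_d) (f : 'rV[R]_d -> \bar R) :
  a != 0 -> measurable_fun setT f -> (forall x, 0 <= f x)%E ->
  (\int[lebesgue_rV d]_x f x =
   (`|a| ^+ d)%:E * \int[lebesgue_rV d]_x f (a *: x + h)%R)%E.
Proof.
move=> a0; elim: d h f => [|d IH] h f mf f0.
  by rewrite expr0 mul1e; apply: eq_integral => x _; congr f; apply/rowP => -[].
have maff : measurable_fun setT (fun x : 'rV[R]_d.+1 => a *: x + h).
  by apply: measurable_rVD; [exact: measurable_rVZ|exact: measurable_cst].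
rewrite !ge0_integral_rV_step//; last exact: measurableT_comp.
have aff_cons t y : a *: rV_cons (t, y) + h =
    rV_cons (a * t + (rV_uncons h).1, a *: y + (rV_uncons h).2).
  apply/rowP => i; rewrite 2!mxE /rV_cons /=.
  case: (split_ordP (i : 'I_(1 + d))) => j ->.
    rewrite !(row_mxEl (_%:M : 'rV[R]_1)) !mxE !ord1 eqxx !mulr1n.
    by congr (_ + h _ _); exact/val_inj.
  by rewrite !(row_mxEr (_%:M : 'rV[R]_1)) !mxE.
under [X in (_ * X)%E]eq_integral do under eq_integral do rewrite aff_cons.
have mc t : measurable_fun setT (fun y => f (rV_cons (t, y))).
  apply: (measurableT_comp mf).
  exact: (measurableT_comp (@measurable_rV_cons R d) (pair1_measurable t)).
pose g t := (\int[lebesgue_rV d]_y f (rV_cons (t, y)))%E.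
have mg : measurable_fun setT g.
  apply: (measurable_fun_fubini_tonelli_F (f \o @rV_cons R d)) => //.
    by apply: measurableT_comp => //; exact: measurable_rV_cons.
  by move=> x; exact: f0.
have g0 t : (0 <= g t)%E by exact: integral_ge0.
rewrite [in RHS]exprS mulrC EFinM -muleA.
rewrite (ge0_integral_affine1 (rV_uncons h).1 a0)//.
rewrite muleCA; congr (_ * _)%E.
rewrite -ge0_integralZl//.
- by apply: eq_integral => t _; rewrite (IH (rV_uncons h).2).
- under eq_fun do under eq_integral do rewrite -aff_cons.
  apply: (measurable_fun_fubini_tonelli_F (fun p => f (a *: rV_cons p + h))).
    apply: (measurableT_comp (measurableT_comp mf maff)).
    exact: measurable_rV_cons.
  by move=> x; exact: f0.
- by move=> t _; apply: integral_ge0.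
Qed.

End affine_rV.

(** * Dyadic summation of power weights *)

Section dyadic.
Context d (T : measurableType d) (R : realType).
Variables (m : {measure set T -> \bar R}) (A : set T) (rho : T -> R) (a b K : R).
Hypotheses (mA : measurable A) (mrho : measurable_fun setT rho) (rho0 : forall x, 0 <= rho x)
  (a0 : 0 <= a) (ba : b < a) (K0 : 0 <= K)
  (mK : forall k : nat,
    (m (A `&` [set x | (rho x < 2 ^+ k)%R]) <= (K * (2 ^+ k) `^ b)%:E)%E).

Let c k : R := 2 `^ a * (2 ^+ k) `^ (- a).

Let c0 k : 0 <= c k. Proof. by rewrite mulr_ge0// powR_ge0. Qed.

Let D k := A `&` [set x | rho x < 2 ^+ k].

Let mD k : measurable (D k).
Proof.
apply: measurableI => //.
rewrite (_ : [set x | _] = rho @^-1` `]-oo, 2 ^+ k[).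
  by rewrite -[X in measurable X]setTI; exact: mrho.
by apply/seteqP; split => y /=; rewrite in_itv.
Qed.

Let dyadic_bound x :
  ((\1_A x * (1 + rho x) `^ (- a))%:E <= \sum_(k <oo) (c k * \1_(D k) x)%:E)%E.
Proof.
have [Ax|nAx] := pselect (A x); last first.
  rewrite indicE memNset// mul0r; apply: nneseries_ge0 => k _ _.
  by rewrite lee_fin mulr_ge0// indicE.
rewrite [\1_A x]indicE mem_set// mul1r.
have [k0 hk0] : exists k : nat, rho x < 2 ^+ k.
  exists (Num.truncn (rho x)).+1; apply: lt_le_trans (truncnS_gt _) _.
  by rewrite -natrX ler_nat ltnW// ltn_expl.
(* The single term with the least [k] such that [rho x < 2 ^ k] already dominates the weight at
   [x]. *)
have [k kP kmin] := ex_minnP (ex_intro (fun k : nat => rho x < 2 ^+ k) k0 hk0).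
apply: le_trans (nneseries_lim_ge k.+1 _); last first.
  by move=> i _ _; rewrite lee_fin mulr_ge0// indicE.
rewrite big_nat_recr//= -[leLHS]add0e leeD//.
  by apply: sume_ge0 => i _; rewrite lee_fin mulr_ge0// indicE.
rewrite indicE mem_set// mulr1 lee_fin /c.
(* Minimality gives [2 ^ (k - 1) <= rho x]; for [k = 0] the summand 1 takes over. *)
have h2 : 2 ^+ k / 2 <= 1 + rho x.
  case: k {kP} kmin => [|k] kmin; first by have := rho0 x; rewrite expr0; lra.
  have : 2 ^+ k <= rho x.
    by rewrite leNgt; apply/negP => /kmin; rewrite ltnn.
  by rewrite exprS mulrC mulKf//; lra.
have p2 : 0 < 2 ^+ k :> R by rewrite exprn_gt0.
have -> : 2 `^ a * (2 ^+ k) `^ (- a) = (2 ^+ k / 2) `^ (- a).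
  rewrite powRM ?invr_ge0 ?exprn_ge0// mulrC; congr (_ * _).
  by rewrite -powR_inv1// -powRrM mulN1r opprK.
rewrite !powRN lef_pV2 ?posrE ?powR_gt0//; last by apply: lt_le_trans h2; rewrite divr_gt0.
by rewrite ge0_ler_powR// nnegrE; [rewrite divr_ge0// ltW|rewrite addr_ge0].
Qed.

(** The [k]-th term is at most [2 ^ a * K * 2 ^ (k (b - a))], a geometric series since [b < a]. It
    is applied with [rho] equal to [|u|] and [|r|] for Lebesgue measure, to [1 / |y|] for the second
    moment of [nu], and to [|z - x|] for the convolution estimate. *)
Lemma dyadic_integral :
  (\int[m]_x (\1_A x * (1 + rho x) `^ (- a))%:E <=
   (2 `^ a * K / (1 - 2 `^ (b - a)))%:E)%E.
Proof.
have mc k : measurable_fun setT (fun x => (c k * \1_(D k) x)%:E).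
  by apply/measurable_EFinP; apply: measurable_funM => //; exact: measurable_indic (mD k).
apply: (@le_trans _ _ (\int[m]_x \sum_(k <oo) (c k * \1_(D k) x)%:E)%E).
  apply: ge0_le_integral => //.
  - by move=> x _; rewrite lee_fin mulr_ge0 ?powR_ge0// indicE.
  - apply/measurable_EFinP; apply: measurable_funM; first exact: measurable_indic.
    by apply: (measurableT_comp (measurable_powR (- a))); exact: measurable_funD.
  - by apply: ge0_emeasurable_sum => // k x _ _; rewrite lee_fin mulr_ge0// indicE.
rewrite integral_nneseries//; last first.
  by move=> k x _; rewrite lee_fin mulr_ge0// indicE.
have z1 : 2 `^ (b - a) < 1 :> R.
  by rewrite /powR gt_eqF// expR_lt1 pmulr_llt0 ?subr_lt0// ln_gt0// ltr1n.
have z0 : 0 <= 2 `^ (b - a) :> R by exact: powR_ge0.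
apply: lime_le.
  by apply: is_cvg_nneseries => k _ _; apply: integral_ge0 => x _; rewrite lee_fin mulr_ge0// indicE.
apply: nearW => n.
apply: (@le_trans _ _ (\sum_(0 <= k < n) (2 `^ a * K * (2 `^ (b - a)) ^+ k)%:E)%E).
  apply: lee_sum => k _.
  under eq_integral do rewrite EFinM.
  rewrite ge0_integralZl ?lee_fin//; last first.
    by apply/measurable_EFinP; exact: measurable_indic (mD k).
  rewrite integral_indic// setIT.
  apply: le_trans (lee_wpmul2l _ (mK k)) _; first by rewrite lee_fin.
  rewrite -EFinM lee_fin /c -!mulrA ler_wpM2l ?powR_ge0//.
  rewrite mulrCA ler_wpM2l//.
  rewrite -powRD; last by apply/implyP => _; rewrite gt_eqF// exprn_gt0.
  by rewrite addrC -powR_mulrn ?powR_ge0// -powRrM -powR_mulrn// -powRrM mulrC.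
rewrite sumEFin lee_fin -mulr_sumr -!mulrA ler_wpM2l ?powR_ge0//.
rewrite ler_wpM2l// -[leRHS]mul1r ler_pdivlMr ?subr_gt0//.
move: (2 `^ (b - a)) z0 z1 => z z0 z1.
rewrite big_mkord mulrC -opprB mulNr -subrX1 opprB gerBl exprn_ge0//.
Qed.

End dyadic.

(** * Volume growth of balls and integrability of [(1 + |u|) ^ (- d - 1)] *)

Section lebesgue_ball.
Context {R : realType}.

Definition ubox d : set 'rV[R]_d := [set x | forall i, `|x ord0 i| < 1].

Lemma measurable_ubox d : measurable (@ubox d).
Proof.
rewrite (_ : @ubox d = \bigcap_(i in [set: 'I_d])
   ((fun x : 'rV[R]_d => x ord0 i) @^-1` ball (0 : R) 1)).
  apply: fin_bigcap_measurable => // i _; rewrite -[X in measurable X]setTI.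
  by apply: measurable_coord => //; apply: open_measurable; exact: ball_open.
by apply/seteqP; split => x /= h i; have := h i; rewrite /ball /= sub0r normrN // => /(_ I).
Qed.

(** A cube splits along the iterated product that defines [lebesgue_rV], which a ball does not;
    finiteness of the volume of the unit ball is deduced from the enclosing cube. *)
Lemma lebesgue_ubox_fin d : (lebesgue_rV d (@ubox d) < +oo)%E.
Proof.
elim: d => [|d IH].
  by rewrite /= diracE; case: (_ \in _); rewrite ltry.
rewrite -[@ubox _]setIT -integral_indic//; last exact: measurable_ubox.
rewrite ge0_integral_rV_step//; last first.
  by apply/measurable_EFinP; apply: measurable_indic; exact: measurable_ubox.
have E t y : (\1_(@ubox d.+1) (rV_cons (t, y)))%:E =
    ((\1_(ball (0 : R) 1) t)%:E * (\1_(@ubox d) y)%:E :> \bar R)%E.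
  rewrite -EFinM !indicE -natrM mulnb; congr (_%:R%:E).
  apply: (congr1 nat_of_bool); apply/idP/idP.
    rewrite inE => h; apply/andP; split; rewrite inE.
      have := h (lshift d (ord0 : 'I_1)).
      by rewrite /rV_cons (row_mxEl (t%:M : 'rV[R]_1)) mxE eqxx mulr1n /ball/= sub0r normrN.
    move=> i; have := h (rshift 1 i).
    by rewrite /rV_cons (row_mxEr (t%:M : 'rV[R]_1)).
  move=> /andP[]; rewrite !inE => ht hy i.
  case: (split_ordP (i : 'I_(1 + d))) => j ->.
    by rewrite /rV_cons (row_mxEl (t%:M : 'rV[R]_1)) mxE !ord1 eqxx mulr1n;
      move: ht; rewrite /ball/= sub0r normrN.
  by rewrite /rV_cons (row_mxEr (t%:M : 'rV[R]_1)).
under eq_integral do under eq_integral do rewrite E.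
under eq_integral => t _.
  rewrite ge0_integralZl//; first last.
    by apply/measurable_EFinP; apply: measurable_indic; exact: measurable_ubox.
  rewrite integral_indic ?setIT//; last exact: measurable_ubox.
  over.
rewrite ge0_integralZr//; last first.
  by apply/measurable_EFinP; apply: measurable_indic; exact: measurable_ball.
rewrite integral_indic ?setIT//; last exact: measurable_ball.
apply: lte_mul_pinfty => //; rewrite ge0_fin_numE//.
apply: (@le_lt_trans _ _ (1 *+ 2)%:E); last exact: ltry.
rewrite le_eqVlt; apply/predU1P; left; exact: lebesgue_measure_ball.
Qed.

Lemma lebesgue_eball d (r : R) : 0 < r ->
  (lebesgue_rV d (eball 0 r) = (r ^+ d)%:E * lebesgue_rV d (eball 0 1%R))%E.
Proof.
move=> r0; rewrite -[eball 0 r]setIT -integral_indic//; last exact: measurable_eball.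
rewrite (@ge0_integral_affine _ d r 0) ?gt_eqF//; last first.
  by apply/measurable_EFinP; apply: measurable_indic; exact: measurable_eball.
rewrite (gtr0_norm r0); congr (_ * _)%E.
rewrite -[eball 0 1]setIT -integral_indic//; last exact: measurable_eball.
apply: eq_integral => x _; rewrite !indicE; congr (_%:R%:E).
apply: (congr1 nat_of_bool); apply: asbool_equiv_eq.
by rewrite /eball /= !subr0 addr0 enormZ gtr0_norm// -ltr_pdivlMl// mulVf ?gt_eqF.
Qed.

Lemma integrable_weight d :
  (lebesgue_rV d).-integrable setT
    (EFin \o (fun u : 'rV[R]_d => (1 + enorm u) ^- d.+1)).
Proof.
have mw : measurable_fun setT (fun u : 'rV[R]_d => (1 + enorm u) `^ (- (d.+1%:R))).
  apply: (measurableT_comp (measurable_powR _)).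
  by apply: measurable_funD => //; exact: measurable_enorm.
have e u : (1 + enorm u) ^- d.+1 = (1 + enorm (u : 'rV[R]_d)) `^ (- (d.+1%:R)).
  by rewrite powRN powR_mulrn// addr_ge0// enorm_ge0.
under eq_fun do rewrite /= e.
apply/integrableP; split; first exact/measurable_EFinP.
rewrite (eq_integral (fun u : 'rV[R]_d =>
    (\1_([set: 'rV[R]_d]) u * (1 + enorm u) `^ (- (d.+1%:R)))%:E)); last first.
  by move=> u _; rewrite gee0_abs ?lee_fin ?powR_ge0//= indicE in_setT mul1r.
have Bfin : (lebesgue_rV d (eball (0 : 'rV[R]_d) 1%R) < +oo)%E.
  apply: le_lt_trans (lebesgue_ubox_fin d); apply: le_measure; rewrite ?inE.
  - exact: measurable_eball.
  - exact: measurable_ubox.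
  - by move=> x; rewrite /eball /= subr0 => x1 i; apply: le_lt_trans (coord_le _ _) x1.
apply: (le_lt_trans (@dyadic_integral _ _ R (lebesgue_rV d) setT (@enorm R d) d.+1%:R d%:R
   (fine (lebesgue_rV d (eball (0 : 'rV[R]_d) 1%R))) measurableT measurable_enorm (@enorm_ge0 R d) _ _ _ _)).
- by rewrite ler0n.
- by rewrite ltr_nat.
- by rewrite fine_ge0.
- move=> k; rewrite setTI (_ : [set x | _] = eball 0 (2 ^+ k)); last first.
    by apply/seteqP; split => x; rewrite /eball /= subr0.
  rewrite le_eqVlt; apply/predU1P; left.
  apply: (etrans (@lebesgue_eball d (2 ^+ k) _)); first by rewrite exprn_gt0.
  by rewrite powR_mulrn ?exprn_ge0// muleC EFinM fineK// ge0_fin_numE.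
- by rewrite ltry.
Qed.

End lebesgue_ball.

(** * Rapidly decaying functions and their real Fourier transforms *)

Section quadratic_derive.
Context {R : realType} {V : normedModType R}.

Lemma quadratic_is_derive (f : V -> R) (x v : V) (l C : R) :
  (forall t, `|f (t *: v + x) - f x - t * l| <= t ^+ 2 * C) -> is_derive x v f l.
Proof.
move=> fC.
have C0 : 0 <= C.
  by have := le_trans (normr_ge0 _) (fC 1); rewrite expr1n mul1r.
have cf : (fun h => h^-1 *: ((f \o shift x) (h *: v) - f x)) @ 0^' --> (l : R^o).
  apply/cvgrPdist_le => e e0; near=> h.
  have h0 : h != 0 by near: h; exact: nbhs_dnbhs_neq.
  have he : `|h| <= e / (C + 1).
    near: h; apply: dnbhs0_le; rewrite divr_gt0// ltr_wpDl//.
  rewrite /= distrC; have -> : h^-1 *: (f (h *: v + x) - f x) - l =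
      h^-1 * (f (h *: v + x) - f x - h * l).
    by rewrite [in RHS]mulrBr mulrA mulVf// mul1r.
  rewrite normrM normfV ler_pdivrMl ?normr_gt0//.
  apply: le_trans (fC h) _; rewrite -(real_normK (num_real h)) expr2 -mulrA.
  rewrite ler_wpM2l//; apply: (@le_trans _ _ (e / (C + 1) * C)); first by rewrite ler_wpM2r.
  by rewrite -mulrA ler_piMr ?(ltW e0)// mulrC ler_pdivrMr ?mul1r ?lerDl// ltr_wpDl.
split; first by apply/cvg_ex; exists l.
exact: cvg_lim cf.
Unshelve. all: by end_near. Qed.

End quadratic_derive.

Section rapid.
Context {R : realType} {d : nat}.
Notation Leb := (@lebesgue_rV R d).
Implicit Types (F G : 'rV[R]_d -> R) (x v u : 'rV[R]_d).

(** Decay alone, without smoothness: [exp (- Phi)] has to belong to this class although it is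
    singular at the origin. *)
Definition rapid F := measurable_fun setT F /\
  forall N : nat, exists A : R, forall u, `|F u| * (1 + enorm u) ^+ N <= A.

Lemma enorm1_ge1 u : 1 <= 1 + enorm u.
Proof. by rewrite lerDl enorm_ge0. Qed.

Lemma enorm1_gt0 u : 0 < 1 + enorm u.
Proof. by rewrite (lt_le_trans _ (enorm1_ge1 u)). Qed.

Lemma rapid_bound F : rapid F -> forall N : nat, exists2 A : R, 0 <= A &
  forall u, `|F u| <= A * (1 + enorm u) ^- N.
Proof.
move=> [_ rF] N; have [A FA] := rF N; exists A.
  by apply: le_trans (FA 0); rewrite mulr_ge0// exprn_ge0// (le_trans ler01 (enorm1_ge1 _)).
by move=> u; rewrite ler_pdivlMr// exprn_gt0// enorm1_gt0.
Qed.

Lemma rapid_integrable F : rapid F -> Leb.-integrable setT (EFin \o F).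
Proof.
move=> rF; have [A A0 FA] := rapid_bound rF d.+1.
apply: (integrable_dominated rF.1 FA).
exact: (integrableZl measurableT A (@integrable_weight R d)).
Qed.

Lemma rapidM F G (C : R) (k : nat) : rapid F -> measurable_fun setT G ->
  (forall u, `|G u| <= C * (1 + enorm u) ^+ k) -> rapid (fun u => G u * F u).
Proof.
move=> [mF rF] mG GC; split; first exact: measurable_funM.
move=> N; have [A FA] := rF (k + N)%N; exists (C * A) => u.
have C0 : 0 <= C.
  have := le_trans (normr_ge0 _) (GC 0).
  by rewrite pmulr_lge0// exprn_gt0// enorm1_gt0.
rewrite normrM; apply: (@le_trans _ _ (C * (1 + enorm u) ^+ k * `|F u| * (1 + enorm u) ^+ N)).
  by rewrite !ler_wpM2r// ?exprn_ge0// ltW// enorm1_gt0.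
by rewrite -!mulrA ler_wpM2l// mulrCA mulrA -mulrA -exprD FA.
Qed.

Lemma rapid_norm F : rapid F -> rapid (fun u => `|F u|).
Proof.
move=> [mF rF]; split; first exact: measurableT_comp.
by move=> N; have [A FA] := rF N; exists A => u; rewrite normr_id.
Qed.

Lemma rapid_bounded F G : rapid F -> measurable_fun setT G ->
  (forall u, `|G u| <= 1) -> rapid (fun u => G u * F u).
Proof.
move=> rF mG G1; apply: (rapidM (C := 1) (k := 0)) => // u.
by rewrite expr0 mulr1.
Qed.

Lemma rapidZ F (c : R) : rapid F -> rapid (fun u => c * F u).
Proof.
by move=> rF; apply: (rapidM (C := `|c|) (k := 0)) => // u; rewrite expr0 mulr1.
Qed.

Lemma rapidD F G : rapid F -> rapid G -> rapid (fun u => F u + G u).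
Proof.
move=> [mF rF] [mG rG]; split; first exact: measurable_funD.
move=> N; have [A FA] := rF N; have [B GB] := rG N; exists (A + B) => u.
apply: le_trans (lerD (FA u) (GB u)); rewrite -mulrDl ler_wpM2r ?ler_normD//.
by rewrite exprn_ge0// ltW// enorm1_gt0.
Qed.

Lemma rapid_dotv F v : rapid F -> rapid (fun u => dotv u v * F u).
Proof.
move=> rF; apply: (rapidM (C := enorm v) (k := 1)) => //.
  by apply: measurable_dotv => //; exact: measurable_cst.
move=> u; rewrite expr1 (le_trans (dotv_le _ _))// mulrC ler_wpM2l ?enorm_ge0//.
by rewrite lerDr.
Qed.

Lemma rapid_coord F i : rapid F -> rapid (fun u => u ord0 i * F u).
Proof.
move=> /(rapid_dotv (delta_mx ord0 i)).
by under eq_fun do rewrite dotv_delta.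
Qed.

Lemma measurable_cos_dotv d' (T : measurableType d') (f g : T -> 'rV[R]_d) (th : R) :
  measurable_fun setT f -> measurable_fun setT g ->
  measurable_fun setT (fun t => cos (dotv (f t) (g t) + th)).
Proof.
move=> mf mg; apply: measurableT_comp => //.
  by apply: continuous_measurable_fun; exact: continuous_cos.
by apply: measurable_funD => //; exact: measurable_dotv.
Qed.

Lemma measurable_sin_dotv d' (T : measurableType d') (f g : T -> 'rV[R]_d) (th : R) :
  measurable_fun setT f -> measurable_fun setT g ->
  measurable_fun setT (fun t => sin (dotv (f t) (g t) + th)).
Proof.
move=> mf mg; apply: measurableT_comp => //.
  by apply: continuous_measurable_fun; exact: continuous_sin.
by apply: measurable_funD => //; exact: measurable_dotv.
Qed.

Lemma rapid_cos F x (th : R) : rapid F -> rapid (fun u => F u * cos (dotv u x + th)).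
Proof.
move=> rF; under eq_fun do rewrite mulrC; apply: rapid_bounded => //.
  exact: measurable_cos_dotv.
by move=> u; exact: norm_cos_le1.
Qed.

(* Shifting the phase [th] by [pi / 2] differentiates the cosine, so this
   real-valued family is stable under derivatives without complex integrals. *)
Definition ft F (th : R) x : R := \int[Leb]_u (F u * cos (dotv u x + th)).

Lemma ft_bound F th x : rapid F -> `|ft F th x| <= \int[Leb]_u `|F u|.
Proof.
move=> rF; apply: norm_Rintegral_le.
- exact: (rapid_cos x th rF).1.
- by move=> u; rewrite normrM ler_piMr// norm_cos_le1.
- exact: rapid_integrable (rapid_norm rF).
Qed.

Lemma ftD F G th x : rapid F -> rapid G ->
  ft (fun u => F u + G u) th x = ft F th x + ft G th x.
Proof.
move=> rF rG; rewrite /ft -RintegralD//.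
- by apply: eq_Rintegral => u _; rewrite mulrDl.
- exact: rapid_integrable (rapid_cos x th rF).
- exact: rapid_integrable (rapid_cos x th rG).
Qed.

Lemma ftZ F (c : R) th x : rapid F ->
  ft (fun u => c * F u) th x = c * ft F th x.
Proof.
move=> rF; rewrite /ft -RintegralZl//.
- by apply: eq_Rintegral => u _; rewrite mulrA.
- exact: rapid_integrable (rapid_cos x th rF).
Qed.

Lemma rapid_sum (I : Type) (r : seq I) (F : I -> 'rV[R]_d -> R) :
  (forall i, rapid (F i)) -> rapid (fun u => \sum_(i <- r) F i u).
Proof.
move=> rF; elim: r => [|i r IH].
  under eq_fun do rewrite big_nil; split=> // N; exists 0 => u.
  by rewrite normr0 mul0r.
by under eq_fun do rewrite big_cons; exact: rapidD.
Qed.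

Lemma ft_sum (I : Type) (r : seq I) (F : I -> 'rV[R]_d -> R) th x :
  (forall i, rapid (F i)) ->
  ft (fun u => \sum_(i <- r) F i u) th x = \sum_(i <- r) ft (F i) th x.
Proof.
move=> rF; elim: r => [|i r IH].
  rewrite big_nil /ft; under eq_Rintegral do rewrite big_nil mul0r.
  by rewrite Rintegral_cst// mul0r.
rewrite big_cons -IH -ftD//; last exact: rapid_sum.
by congr ft; apply/funext => u; rewrite big_cons.
Qed.

(** Moving [x] by [t v] moves the argument of the cosine by [t <u, v>]. By [cos_taylor2] the
    remainder is at most [t ^ 2] times the integral of [<u, v> ^ 2 |F u|], and the linear term is a
    transform with phase [th + pi / 2] because [cos (a + pi / 2) = - sin a]. *)
Lemma ft_taylor F th x v : rapid F -> exists C : R, forall t : R,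
  `|ft F th (t *: v + x) - ft F th x -
    t * ft (fun u => dotv u v * F u) (th + pi / 2) x| <= t ^+ 2 * C.
Proof.
move=> rF; have rvF := rapid_dotv v rF; have rvvF := rapid_dotv v rvF.
exists (\int[Leb]_u `|dotv u v * (dotv u v * F u)|) => t.
have i1 := rapid_integrable (rapid_cos (t *: v + x) th rF).
have i2 := rapid_integrable (rapid_cos x th rF).
have i3 := rapid_integrable (rapid_cos x (th + pi / 2) rvF).
rewrite /ft -RintegralZl// -RintegralB// -RintegralB//; last 2 first.
- exact: (integrableB measurableT i1 i2).
- exact: (integrableZl measurableT t i3).
rewrite -RintegralZl//; last exact: rapid_integrable (rapid_norm rvvF).
apply: norm_Rintegral_le; last 1 first.
- exact: (integrableZl measurableT (t ^+ 2) (rapid_integrable (rapid_norm rvvF))).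
- apply: measurable_funB.
    by apply: measurable_funB; [exact: (rapid_cos _ _ rF).1|exact: (rapid_cos _ _ rF).1].
  by apply: measurable_funM => //; exact: (rapid_cos _ _ rvF).1.
move=> u; rewrite dotvDr dotvZr; set b := dotv u v; set a := dotv u x + th.
have -> : F u * cos (t * b + dotv u x + th) - F u * cos a -
    t * (b * F u * cos (dotv u x + (th + pi / 2))) =
    F u * (cos (a + t * b) - cos a + t * b * sin a).
  rewrite [_ + (th + _)]addrA -/a cosDpihalf.
  have -> : t * b + dotv u x + th = a + t * b by rewrite /a; ring.
  ring.
have -> : t ^+ 2 * `|b * (b * F u)| = `|F u| * (t * b) ^+ 2.
  by rewrite mulrA -expr2 normrM ger0_norm ?sqr_ge0// exprMn; ring.
by rewrite normrM ler_wpM2l// cos_taylor2.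
Qed.

Lemma is_derive_ft F th x v : rapid F ->
  is_derive x v (ft F th) (ft (fun u => dotv u v * F u) (th + pi / 2) x).
Proof.
by move=> rF; have [C hC] := ft_taylor th x v rF; exact: quadratic_is_derive hC.
Qed.

Lemma ft_dotv F th x v : rapid F ->
  ft (fun u => dotv u v * F u) th x = \sum_i v ord0 i * ft (fun u => u ord0 i * F u) th x.
Proof.
move=> rF; have rc i := rapid_coord i rF.
transitivity (ft (fun u => \sum_i v ord0 i * (u ord0 i * F u)) th x).
  congr ft; apply/funext => u; rewrite mulr_suml; apply: eq_bigr => i _; ring.
rewrite ft_sum; last by move=> i; exact: rapidZ.
by apply: eq_bigr => i _; rewrite ftZ.
Qed.

(** The bound [B] is asked for along the segment only: one use controls the coordinate transforms
    just within distance 1 of a point, the other uses that the segment stays away from the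
    origin. *)
Lemma ft_segment_le F th x v (B : R) : rapid F ->
  (forall i (t : R), 0 <= t <= 1 ->
    `|ft (fun u => u ord0 i * F u) (th + pi / 2) (t *: v + x)| <= B) ->
  `|ft F th (v + x) - ft F th x| <= enorm v * (d%:R * B).
Proof.
move=> rF hB; pose g (t : R) := ft F th (t *: v + x).
have dg t : is_derive (t : R^o) (1 : R^o) g
    (ft (fun u => dotv u v * F u) (th + pi / 2) (t *: v + x)).
  have [C hC] := ft_taylor th (t *: v + x) v rF.
  apply: (@quadratic_is_derive R R^o _ _ _ _ C) => h.
  have -> : h *: (1 : R^o) + t = h + t by rewrite /GRing.scale /= mulr1.
  by have := hC h; rewrite (addrA (h *: v)) -scalerDl.
have := @MVT_le R g _ 0 1 (enorm v * (d%:R * B)) dg.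
rewrite /g scale0r add0r scale1r subr0 normr1 mulr1; apply => t.
rewrite (min_idPl ler01) (max_idPr ler01) => t01.
rewrite ft_dotv// (le_trans (ler_norm_sum _ _ _))//.
have -> : enorm v * (d%:R * B) = \sum_(i < d) enorm v * B.
  by rewrite sumr_const card_ord -mulr_natr; ring.
apply: ler_sum => i _; rewrite normrM ler_pM// ?coord_le//.
exact: hB.
Qed.

(** Fubini, then expansion of [cos (a - <u, z>)]: the sine term integrates to zero by hypothesis. It
    is used for the large jumps and for the law [P 1] itself. *)
Lemma ft_convolution (m : {finite_measure set 'rV[R]_d -> \bar R}) F th x :
  rapid F -> (forall u, \int[m]_z sin (dotv u z) = 0) ->
  \int[m]_z ft F th (x - z) = ft (fun u => \int[m]_z cos (dotv u z) * F u) th x.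
Proof.
move=> rF m0; rewrite /ft.
have mFz : measurable_fun setT (fun p : 'rV[R]_d * 'rV[R]_d =>
    F p.1 * cos (dotv p.1 (x - p.2) + th)).
  apply: measurable_funM; first exact: (measurableT_comp rF.1 measurable_fst).
  apply: measurable_cos_dotv; first exact: measurable_fst.
  apply: measurable_rVD; first exact: measurable_cst.
  by apply: measurable_rVN; exact: measurable_snd.
rewrite -(@Rintegral_Fubini _ _ _ _ R Leb m _ (fun u => `|F u|) (cst 1) mFz); last 3 first.
- by move=> u z /=; rewrite normrM mulr1 ler_piMr// norm_cos_le1.
- exact: rapid_integrable (rapid_norm rF).
- exact: finite_measure_integrable_cst.
apply: eq_Rintegral => u _ /=.
have mc : m.-integrable setT (EFin \o (fun z => cos (dotv u z))).
  apply: (@integrable_dominated _ _ _ _ _ (cst 1)).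
  - have := @measurable_cos_dotv _ _ (cst u) id 0 (measurable_cst _) (@measurable_id _ _ _).
    by under eq_fun do rewrite addr0.
  - by move=> z; rewrite norm_cos_le1.
  - exact: finite_measure_integrable_cst.
have ms : m.-integrable setT (EFin \o (fun z => sin (dotv u z))).
  apply: (@integrable_dominated _ _ _ _ _ (cst 1)).
  - have := @measurable_sin_dotv _ _ (cst u) id 0 (measurable_cst _) (@measurable_id _ _ _).
    by under eq_fun do rewrite addr0.
  - by move=> z; rewrite norm_sin_le1.
  - exact: finite_measure_integrable_cst.
transitivity (\int[m]_z (F u * cos (dotv u x + th) * cos (dotv u z) +
                         F u * sin (dotv u x + th) * sin (dotv u z))).
  apply: eq_Rintegral => z _; rewrite dotvBr.
  have -> : dotv u x - dotv u z + th = dotv u x + th - dotv u z by ring.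
  by rewrite cosB mulrDr !mulrA.
rewrite RintegralD//; last 2 first.
- exact: (integrableZl measurableT _ mc).
- exact: (integrableZl measurableT _ ms).
by rewrite RintegralZl// RintegralZl// m0 mulr0 addr0; ring.
Qed.

End rapid.

Lemma integrable_EFin_measurable d (T : measurableType d) (R : realType)
    (m : {measure set T -> \bar R}) (f : T -> R) :
  m.-integrable setT (EFin \o f) -> measurable_fun setT f.
Proof. by move=> /measurable_int /measurable_EFinP. Qed.

(** * Derivatives through Taylor estimates, and vanishing integrals of derivatives *)

Section rdiff.
Context {R : realType} {d : nat}.
Notation Leb := (@lebesgue_rV R d).
Implicit Types (F G : 'rV[R]_d -> R) (x v u : 'rV[R]_d).

Let e_ (j : 'I_d) : 'rV[R]_d := delta_mx ord0 j.

Lemma enorm_delta j : enorm (e_ j) = 1.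
Proof. by rewrite /enorm dotv_delta mxE !eqxx sqrtr1. Qed.

(* [G'] is the j-th derivative of [G] in the sense of a second-order Taylor
   estimate, with polynomial growth ([pdiff]) or rapid decay ([rdiff]) of all the
   constants: enough for [int F' = 0] to follow from translation invariance. *)
Definition pdiff (j : 'I_d) G G' := [/\ measurable_fun setT G, measurable_fun setT G' &
  exists A : R, exists k : nat, [/\ 0 <= A,
    forall u, `|G u| <= A * (1 + enorm u) ^+ k,
    forall u, `|G' u| <= A * (1 + enorm u) ^+ k &
    forall u (h : R), `|h| <= 1 ->
      `|G (u + h *: e_ j) - G u - h * G' u| <= h ^+ 2 * (A * (1 + enorm u) ^+ k)]].

Definition rdiff (j : 'I_d) F F' := [/\ rapid F, rapid F' &
  forall N : nat, exists2 A : R, 0 <= A & forall u (h : R), `|h| <= 1 ->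
    `|F (u + h *: e_ j) - F u - h * F' u| <= h ^+ 2 * (A * (1 + enorm u) ^- N)].

Lemma enorm1_expr_ge0 u (k : nat) : 0 <= (1 + enorm u) ^+ k.
Proof. by rewrite exprn_ge0// ltW// enorm1_gt0. Qed.

Lemma enorm1_expr_gt0 u (k : nat) : 0 < (1 + enorm u) ^+ k.
Proof. by rewrite exprn_gt0// enorm1_gt0. Qed.

Lemma enorm1_expr_le u (k l : nat) : (k <= l)%N -> (1 + enorm u) ^+ k <= (1 + enorm u) ^+ l.
Proof. by move=> kl; rewrite ler_weXn2l// enorm1_ge1. Qed.

Lemma pdiff_rapid j G G' F : pdiff j G G' -> rapid F -> rapid (fun u => G u * F u).
Proof.
by move=> [mG _ [A [k [A0 GA _ _]]]] rF; exact: (rapidM (C := A) (k := k)).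
Qed.

Lemma pdiff_rapid' j G G' F : pdiff j G G' -> rapid F -> rapid (fun u => G' u * F u).
Proof.
by move=> [_ mG [A [k [A0 _ GA _]]]] rF; exact: (rapidM (C := A) (k := k)).
Qed.

Lemma rdiffM j G G' F F' : pdiff j G G' -> rdiff j F F' ->
  rdiff j (fun u => G u * F u) (fun u => G' u * F u + G u * F' u).
Proof.
move=> pG [rF rF' tF]; split; first exact: pdiff_rapid pG rF.
  by apply: rapidD; [exact: pdiff_rapid' pG rF|exact: pdiff_rapid pG rF'].
move: pG => [_ _ [A [k [A0 GA GA' tG]]]] N.
(* The growth order [k] of [G] is paid for by asking [k] more orders of decay from [F], [F'] and the
   remainder. *)
have [C1 C10 hF] := rapid_bound rF (N + k).
have [C2 C20 hF'] := rapid_bound rF' (N + k).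
have [C3 C30 hT] := tF (N + k)%N.
exists (A * (C2 + (C1 + C2 + C3) + (C3 + C3))) => [|u h h1].
  by rewrite mulr_ge0// !addr_ge0.
have := GA u; have := GA' u; have := tG u h h1; have := hF u; have := hF' u; have := hT u h h1.
set P := A * _ ^+ k; pose Q := (1 + enorm u) ^- (N + k).
have Q0 : 0 <= Q by rewrite invr_ge0 enorm1_expr_ge0.
have P0 : 0 <= P by rewrite mulr_ge0// enorm1_expr_ge0.
rewrite -/Q; set r := G _ - _ - _; set s := F _ - _ - _ => hs hF'u hFu hr hG' hG.
(* Product rule with remainders: the cross term is quadratic in [h], and every other term contains
   [r] or [s], which already are. *)
have -> : G (u + h *: e_ j) * F (u + h *: e_ j) - G u * F u - h * (G' u * F u + G u * F' u) =
   h ^+ 2 * (G' u * F' u) + r * (F u + h * F' u + s) + s * (G u + h * G' u).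
  by rewrite /r /s; ring.
have hh : 0 <= h ^+ 2 <= 1.
  by rewrite sqr_ge0 -(real_normK (num_real h)) expr_le1.
have -> : h ^+ 2 * (A * (C2 + (C1 + C2 + C3) + (C3 + C3)) * (1 + enorm u) ^- N) =
   h ^+ 2 * (P * (C2 * Q)) + h ^+ 2 * P * (C1 * Q + C2 * Q + C3 * Q) + h ^+ 2 * (C3 * Q) * (P + P).
  have -> : (1 + enorm u) ^- N = (1 + enorm u) ^+ k * Q.
    by rewrite /Q exprD invfM mulrCA divff ?mulr1// gt_eqF// enorm1_expr_gt0.
  by rewrite /P; ring.
have hF'h : `|h * F' u| <= C2 * Q.
  by rewrite normrM (le_trans _ hF'u)// ler_piMl.
have hG'h : `|h * G' u| <= P by rewrite normrM (le_trans _ hG')// ler_piMl.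
have hs1 : `|s| <= C3 * Q.
  by apply: le_trans hs _; rewrite ler_piMl ?mulr_ge0//; case/andP: hh.
case/andP: hh => h20 h21.
apply: le_trans (ler_normD _ _) _; apply: lerD.
  apply: le_trans (ler_normD _ _) _; apply: lerD.
    by rewrite normrM ger0_norm// ler_wpM2l// normrM ler_pM.
  rewrite normrM ler_pM//; apply: le_trans (ler_normD _ _) _; rewrite lerD//.
  by apply: le_trans (ler_normD _ _) _; rewrite lerD.
by rewrite normrM ler_pM//; apply: le_trans (ler_normD _ _) _; rewrite lerD.
Qed.

Lemma Rintegral_affine (a : R) x F : a != 0 -> Leb.-integrable setT (EFin \o F) ->
  Leb.-integrable setT (EFin \o (fun u => F (a *: u + x))) /\
  \int[Leb]_u F u = `|a| ^+ d * \int[Leb]_u F (a *: u + x).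
Proof.
move=> a0 iF; have mF := integrable_EFin_measurable iF.
have maff : measurable_fun setT (fun u : 'rV[R]_d => a *: u + x).
  by apply: measurable_rVD; [exact: measurable_rVZ|exact: measurable_cst].
have ad : 0 < `|a| ^+ d by rewrite exprn_gt0// normr_gt0.
have key (G : 'rV[R]_d -> R) : measurable_fun setT G -> (forall u, 0 <= G u) ->
    Leb.-integrable setT (EFin \o G) ->
    Leb.-integrable setT (EFin \o (fun u => G (a *: u + x))) /\
    \int[Leb]_u G u = `|a| ^+ d * \int[Leb]_u G (a *: u + x).
  move=> mG G0 iG.
  have E := @ge0_integral_affine R d a x (EFin \o G) a0 _ _.
  have {}E : (\int[Leb]_u (G u)%:E = (`|a| ^+ d)%:E * \int[Leb]_u (G (a *: u + x))%:E)%E.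
    by apply: E; [exact/measurable_EFinP|move=> u; rewrite lee_fin].
  have iGa : Leb.-integrable setT (EFin \o (fun u => G (a *: u + x))).
    apply/integrableP; split; first exact/measurable_EFinP/measurableT_comp.
    under eq_integral do rewrite gee0_abs ?lee_fin//.
    have : (\int[Leb]_u (G u)%:E < +oo)%E by exact: integrable_lty iG.
    rewrite E -(@lte_pdivlMl _ (`|a| ^+ d))//.
    by rewrite gt0_muley// lte_fin invr_gt0.
  split=> //; rewrite /Rintegral E fineM//.
  exact: integrable_fin_num iGa.
have [ip Ep] := key _ (measurable_funrpos mF) (funrpos_ge0 F) (integrable_funrpos measurableT iF).
have [im Em] := key _ (measurable_funrneg mF) (funrneg_ge0 F) (integrable_funrneg measurableT iF).
have FE u : F u = F^\+ u - F^\- u by rewrite -[in LHS](funrposBneg F).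
split.
  have := integrableB measurableT ip im; apply: eq_integrable => // u _ /=.
  by rewrite -EFinB -FE.
under eq_Rintegral do rewrite FE.
under [in RHS]eq_Rintegral do rewrite FE.
rewrite RintegralB//; last 2 first.
- exact: integrable_funrpos.
- exact: integrable_funrneg.
by rewrite RintegralB// Ep Em -mulrBr.
Qed.

(** By translation invariance [F (u + h e_j) - F u] integrates to zero, so [h] times the integral of
    [F'] equals, up to sign, the integral of a remainder of order [h ^ 2]. Divide by [h] and let [h]
    tend to 0. *)
Lemma rdiff_integral0 j F F' : rdiff j F F' -> \int[Leb]_u F' u = 0.
Proof.
(* Order [d + 1] makes the weight in the remainder integrable. *)
move=> [rF rF' tF]; have [A A0 hA] := tF d.+1.
set w := fun u => (1 + enorm u) ^- d.+1 in hA.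
have iw : Leb.-integrable setT (EFin \o w) := @integrable_weight R d.
have iF := rapid_integrable rF; have iF' := rapid_integrable rF'.
have hh (h : R) : 0 < h <= 1 -> `|\int[Leb]_u F' u| <= h * (A * \int[Leb]_u w u).
  move=> /andP[h0 h1].
  have [iFh Eh] := Rintegral_affine (h *: e_ j) (oner_neq0 R) iF.
  have {}iFh : Leb.-integrable setT (EFin \o (fun u => F (u + h *: e_ j))).
    by apply: eq_integrable iFh => // u _; rewrite /= scale1r.
  have {}Eh : \int[Leb]_u F u = \int[Leb]_u F (u + h *: e_ j).
    rewrite Eh normr1 expr1n mul1r; apply: eq_Rintegral => u _; by rewrite scale1r.
  have : \int[Leb]_u (F (u + h *: e_ j) - F u - h * F' u) = - (h * \int[Leb]_u F' u).
    rewrite RintegralB//; last 2 first.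
    - exact: (integrableB measurableT iFh iF).
    - exact: (integrableZl measurableT h iF').
    by rewrite RintegralB// RintegralZl// -Eh subrr sub0r.
  move=> /(congr1 Num.norm); rewrite normrN normrM (gtr0_norm h0) => E.
  rewrite -(ler_pM2l h0) -E.
  have -> : h * (h * (A * \int[Leb]_u w u)) = h ^+ 2 * (A * \int[Leb]_u w u) by ring.
  rewrite -RintegralZl// -RintegralZl//; last first.
    exact: (integrableZl measurableT A iw).
  apply: norm_Rintegral_le.
  - apply: measurable_funB; last by apply: measurable_funM => //; exact: rF'.1.
    apply: measurable_funB; last exact: rF.1.
    exact: integrable_EFin_measurable iFh.
  - by move=> u; rewrite hA// gtr0_norm.
  - exact: (integrableZl measurableT _ (integrableZl measurableT A iw)).
apply/eqP; rewrite -normr_eq0 eq_le normr_ge0 andbT.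
have W0 : 0 <= A * \int[Leb]_u w u.
  by rewrite mulr_ge0// Rintegral_ge0// => u _; rewrite invr_ge0 enorm1_expr_ge0.
apply/ler_addgt0Pl => e e0; rewrite addr0.
move: (A * _) W0 hh => W W0 hh.
have m0 : 0 < Num.min 1 (e / (W + 1)) by rewrite lt_min ltr01 divr_gt0// ltr_wpDl.
apply: le_trans (hh (Num.min 1 (e / (W + 1))) _) _; first by rewrite m0 ge_min lexx.
apply: (@le_trans _ _ (e / (W + 1) * W)); first by rewrite ler_wpM2r// ge_min lexx orbT.
by rewrite -mulrA ler_piMr ?(ltW e0)// mulrC ler_pdivrMr ?mul1r ?lerDl// ltr_wpDl.
Qed.

Lemma pdiff_cos j x (th : R) :
  pdiff j (fun u => cos (dotv u x + th)) (fun u => - (x ord0 j * sin (dotv u x + th))).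
Proof.
split; first exact: measurable_cos_dotv.
  by apply: measurableT_comp => //; apply: measurable_funM => //; exact: measurable_sin_dotv.
exists (1 + enorm x + enorm x ^+ 2), 0%N.
have nx := enorm_ge0 x; have nx2 : 0 <= enorm x ^+ 2 by rewrite sqr_ge0.
split=> [|u|u|u h h1]; rewrite ?expr0 ?mulr1.
- by rewrite !addr_ge0.
- by apply: le_trans (norm_cos_le1 _) _; rewrite -addrA lerDl addr_ge0.
- rewrite normrN normrM; apply: (@le_trans _ _ (enorm x)); last by lra.
  by apply: le_trans (coord_le x j); rewrite ler_piMr// norm_sin_le1.
rewrite dotvDl dotvZl [dotv (e_ j) x]dotvC dotv_delta.
have -> : dotv u x + h * x ord0 j + th = dotv u x + th + h * x ord0 j by ring.
rewrite mulrN opprK mulrA (le_trans (cos_taylor2 _ _))// exprMn ler_wpM2l ?sqr_ge0//.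
rewrite -(real_normK (num_real (x ord0 j))); apply: (@le_trans _ _ (enorm x ^+ 2)).
  by rewrite ler_pXn2r ?nnegrE// coord_le.
by lra.
Qed.

(* Polynomial functions. *)
Inductive symb : ('rV[R]_d -> R) -> Prop :=
| symb_cst c : symb (fun=> c)
| symb_coord i G : symb G -> symb (fun u => u ord0 i * G u)
| symb_add G H : symb G -> symb H -> symb (fun u => G u + H u).

Lemma symb_pdiff j G : symb G -> exists2 G', symb G' & pdiff j G G'.
Proof.
elim=> [c|i {}G sG [G' sG' pG]|{}G H sG [G' sG' pG] sH [H' sH' pH]].
- exists (fun=> 0); first exact: symb_cst.
  split; try exact: measurable_cst.
  exists `|c|, 0%N; split => // [u|u|u h h1]; rewrite ?expr0 ?mulr1//.
    by rewrite normr0.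
  by rewrite subrr mulr0 subr0 normr0 mulr_ge0// sqr_ge0.
- exists (fun u => (i == j)%:R * G u + u ord0 i * G' u).
    apply: symb_add; last exact: symb_coord.
    case: (i == j); last first.
      rewrite (_ : (fun _ => _) = (fun=> 0)); first exact: symb_cst.
      by apply/funext => u; rewrite mul0r.
    by rewrite (_ : (fun _ => _) = G)//; apply/funext => u; rewrite mul1r.
  have [mG mG' [A [k [A0 GA GA' tG]]]] := pG.
  have mi := @measurable_coord R d i.
  split; first exact: measurable_funM.
    by apply: measurable_funD; apply: measurable_funM.
  have ui u : `|u ord0 i| <= 1 + enorm u by rewrite (le_trans (coord_le _ _))// lerDr.
  have Ak u : 0 <= A * (1 + enorm u) ^+ k by rewrite mulr_ge0// enorm1_expr_ge0.
  have AS u : A * (1 + enorm u) ^+ k <= A * (1 + enorm u) ^+ k.+1.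
    by rewrite ler_wpM2l// enorm1_expr_le.
  have uA u (z : R) : `|z| <= A * (1 + enorm u) ^+ k ->
      `|u ord0 i * z| <= A * (1 + enorm u) ^+ k.+1.
    by move=> zA; rewrite normrM exprS mulrCA ler_pM.
  have dA u (z : R) : `|z| <= A * (1 + enorm u) ^+ k ->
      `|(i == j)%:R * z| <= A * (1 + enorm u) ^+ k.+1.
    move=> zA; apply: le_trans (AS u); rewrite normrM (le_trans _ zA)// ler_piMl//.
    by case: (i == j); rewrite ?normr1 ?normr0.
  (* One [A] for each of the three remainder terms: [u_i r], and, when [i = j], [h ^ 2 G'] and
     [h r]. *)
  exists (3 * A), k.+1; split => [|u|u|u h h1].
  - by rewrite mulr_ge0.
  - by apply: le_trans (uA u _ (GA u)) _; rewrite -mulrA; have := AS u; have := Ak u; lra.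
  - apply: le_trans (ler_normD _ _) _.
    by have := uA u _ (GA' u); have := dA u _ (GA u); have := AS u; have := Ak u; rewrite -mulrA; lra.
  have E : (u + h *: e_ j) ord0 i = u ord0 i + h * (i == j)%:R by rewrite !mxE.
  set r := G (u + h *: e_ j) - G u - h * G' u; have hr := tG u h h1; rewrite -/r in hr.
  have -> : (u + h *: e_ j) ord0 i * G (u + h *: e_ j) - u ord0 i * G u -
      h * ((i == j)%:R * G u + u ord0 i * G' u) =
      u ord0 i * r + (h ^+ 2 * ((i == j)%:R * G' u) + h * ((i == j)%:R * r)).
    by rewrite E /r; ring.
  have h2 : 0 <= h ^+ 2 by exact: sqr_ge0.
  have -> : h ^+ 2 * (3 * A * (1 + enorm u) ^+ k.+1) =
     (1 + enorm u) * (h ^+ 2 * (A * (1 + enorm u) ^+ k)) +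
     (h ^+ 2 * (A * (1 + enorm u) ^+ k.+1) + h ^+ 2 * (A * (1 + enorm u) ^+ k.+1)).
    by rewrite [(1 + enorm u) ^+ k.+1]exprS; ring.
  apply: le_trans (ler_normD _ _) _; apply: lerD.
    by rewrite normrM ler_pM.
  apply: le_trans (ler_normD _ _) _; apply: lerD.
    by rewrite normrM ger0_norm// ler_wpM2l// dA.
  rewrite normrM (le_trans (ler_piMl _ h1))//.
  apply: le_trans (_ : h ^+ 2 * (A * (1 + enorm u) ^+ k) <= _); last by rewrite ler_wpM2l.
  rewrite normrM (le_trans _ hr)// ler_piMl//.
  by case: (i == j); rewrite ?normr1 ?normr0.
- exists (fun u => G' u + H' u); first exact: symb_add.
  have [mG mG' [A [k [A0 GA GA' tG]]]] := pG.
  have [mH mH' [B [l [B0 HB HB' tH]]]] := pH.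
  split; [exact: measurable_funD|exact: measurable_funD|].
  have bA u : A * (1 + enorm u) ^+ k <= A * (1 + enorm u) ^+ (k + l).
    by rewrite ler_wpM2l// enorm1_expr_le// leq_addr.
  have bB u : B * (1 + enorm u) ^+ l <= B * (1 + enorm u) ^+ (k + l).
    by rewrite ler_wpM2l// enorm1_expr_le// leq_addl.
  exists (A + B), (k + l)%N; split => [|u|u|u h h1].
  - exact: addr_ge0.
  - rewrite mulrDl (le_trans (ler_normD _ _))// lerD//; first exact: le_trans (GA u) _.
    exact: le_trans (HB u) _.
  - rewrite mulrDl (le_trans (ler_normD _ _))// lerD//; first exact: le_trans (GA' u) _.
    exact: le_trans (HB' u) _.
  have -> : G (u + h *: e_ j) + H (u + h *: e_ j) - (G u + H u) - h * (G' u + H' u) =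
     (G (u + h *: e_ j) - G u - h * G' u) + (H (u + h *: e_ j) - H u - h * H' u) by ring.
  rewrite mulrDl mulrDr (le_trans (ler_normD _ _))// lerD//.
    by apply: le_trans (tG u h h1) _; rewrite ler_wpM2l// sqr_ge0.
  by apply: le_trans (tH u h h1) _; rewrite ler_wpM2l// sqr_ge0.
Qed.

End rdiff.

Section ft_measurable.
Context {R : realType} {d : nat}.
Notation Leb := (@lebesgue_rV R d).

Lemma measurable_ft (F : 'rV[R]_d -> R) th : rapid F -> measurable_fun setT (ft F th).
Proof.
move=> rF; apply: (measurable_Rintegral Leb
  (F := fun p : 'rV[R]_d * 'rV[R]_d => F p.2 * cos (dotv p.2 p.1 + th))).
apply: measurable_funM; first exact: (measurableT_comp rF.1 measurable_snd).
by apply: measurable_cos_dotv; [exact: measurable_snd|exact: measurable_fst].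
Qed.

Lemma symb_rapid (G F : 'rV[R]_d -> R) : symb G -> rapid F -> rapid (fun u => G u * F u).
Proof.
move=> sG rF; elim: sG => [c|i {}G _ IH|{}G H _ IHG _ IHH]; first exact: rapidZ.
  by under eq_fun do rewrite -mulrA; exact: rapid_coord.
by under eq_fun do rewrite mulrDl; exact: rapidD.
Qed.

End ft_measurable.

(** * Rapid decay of the transforms of the small-jump factor *)

Section small_jumps.
Context {R : realType} {d : nat}.
Notation Leb := (@lebesgue_rV R d).
Variables (nu : {sigma_finite_measure set 'rV[R]_d -> \bar R}) (D : set 'rV[R]_d).
Hypotheses (mD : measurable D) (D1 : forall y, D y -> enorm y <= 1)
  (iD : nu.-integrable setT (EFin \o (fun y => \1_D y * enorm y ^+ 2))).
Implicit Types (u x y : 'rV[R]_d).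

Let e_ (j : 'I_d) : 'rV[R]_d := delta_mx ord0 j.

Let q y : R := \1_D y * enorm y ^+ 2.
Let M : R := \int[nu]_y q y.

Definition small_exponent u : R := \int[nu]_y (\1_D y * (1 - cos (dotv u y))).

(** The [j]-th partial derivative of [small_exponent], in the quantitative sense of [phi_taylor]; it
    grows at most linearly. *)
Let psi j u : R := \int[nu]_y (\1_D y * (y ord0 j * sin (dotv u y))).

Notation phi := small_exponent.

Let ind_ge0 y : 0 <= \1_D y :> R.
Proof. by rewrite indicE. Qed.

Let q_ge0 y : 0 <= q y.
Proof. by rewrite mulr_ge0// sqr_ge0. Qed.

Let M_ge0 : 0 <= M.
Proof. exact: Rintegral_ge0. Qed.

Let mind : measurable_fun setT (fun y => \1_D y : R).
Proof. exact: measurable_indic. Qed.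

Let mcos u : measurable_fun setT (fun y => cos (dotv u y)).
Proof.
have := @measurable_cos_dotv R d _ _ (cst u) id 0 (measurable_cst _) (@measurable_id _ _ _).
by under eq_fun do rewrite addr0.
Qed.

Let msin u : measurable_fun setT (fun y => sin (dotv u y)).
Proof.
have := @measurable_sin_dotv R d _ _ (cst u) id 0 (measurable_cst _) (@measurable_id _ _ _).
by under eq_fun do rewrite addr0.
Qed.

Let integrable_q (f : 'rV[R]_d -> R) (c : R) : measurable_fun setT f ->
  (forall y, `|f y| <= c * q y) -> nu.-integrable setT (EFin \o f).
Proof.
by move=> mf fc; apply: integrable_dominated mf fc _; exact: (integrableZl measurableT c iD).
Qed.

Let integral_q (f : 'rV[R]_d -> R) (c : R) : measurable_fun setT f ->
  (forall y, `|f y| <= c * q y) -> `|\int[nu]_y f y| <= c * M.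
Proof.
move=> mf fc; rewrite -RintegralZl//.
by apply: norm_Rintegral_le mf fc _; exact: (integrableZl measurableT c iD).
Qed.

Let mphi_int u : measurable_fun setT (fun y => \1_D y * (1 - cos (dotv u y))).
Proof. by apply: measurable_funM => //; apply: measurable_funB. Qed.

Let phi_int_le u y : `|\1_D y * (1 - cos (dotv u y))| <= enorm u ^+ 2 * q y.
Proof.
rewrite normrM ger0_norm// /q mulrCA ler_wpM2l// ger0_norm ?onem_cos_ge0//.
rewrite (le_trans (onem_cos_le _))// -exprMn -(real_normK (num_real (dotv u y))).
by rewrite ler_pXn2r ?nnegrE ?mulr_ge0 ?enorm_ge0// dotv_le.
Qed.

Let mpsi_int j u : measurable_fun setT (fun y => \1_D y * (y ord0 j * sin (dotv u y))).
Proof.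
apply: measurable_funM => //; apply: measurable_funM => //.
exact: measurable_coord.
Qed.

Let psi_int_le j u y : `|\1_D y * (y ord0 j * sin (dotv u y))| <= enorm u * q y.
Proof.
rewrite normrM ger0_norm// /q mulrCA ler_wpM2l// normrM expr2 mulrCA ler_pM ?coord_le//.
by rewrite (le_trans (norm_sin_le _))// dotv_le.
Qed.

Let psi_le j u : `|psi j u| <= enorm u * M.
Proof. exact: integral_q. Qed.

Lemma small_exponent_ge0 u : 0 <= phi u.
Proof. by apply: Rintegral_ge0 => y _; rewrite mulr_ge0// onem_cos_ge0. Qed.

Let phi_taylor j u (h : R) : `|phi (u + h *: e_ j) - phi u - h * psi j u| <= h ^+ 2 * M.
Proof.
have i1 := integrable_q (mphi_int (u + h *: e_ j)) (phi_int_le (u + h *: e_ j)).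
have i2 := integrable_q (mphi_int u) (phi_int_le u).
have i3 := integrable_q (mpsi_int j u) (psi_int_le j u).
rewrite /phi /psi -RintegralZl// -RintegralB// -RintegralB//; last 2 first.
- exact: (integrableB measurableT i1 i2).
- exact: (integrableZl measurableT h i3).
apply: integral_q.
  apply: measurable_funB; last exact: measurable_funM.
  by apply: measurable_funB; exact: mphi_int.
move=> y; rewrite dotvDl dotvZl [dotv (e_ j) y]dotvC dotv_delta.
have -> : \1_D y * (1 - cos (dotv u y + h * y ord0 j)) - \1_D y * (1 - cos (dotv u y)) -
   h * (\1_D y * (y ord0 j * sin (dotv u y))) = - (\1_D y *
   (cos (dotv u y + h * y ord0 j) - cos (dotv u y) + (h * y ord0 j) * sin (dotv u y))).
  ring.
rewrite normrN normrM ger0_norm// /q mulrCA ler_wpM2l//.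
rewrite (le_trans (cos_taylor2 _ _))// exprMn ler_wpM2l ?sqr_ge0//.
by rewrite -(real_normK (num_real (y ord0 j))) ler_pXn2r ?nnegrE ?enorm_ge0// coord_le.
Qed.

Let E u := expR (- phi u).

Hypothesis rE : rapid E.

Let E_shift (N : nat) : exists2 A : R, 0 <= A & forall j u (h : R), `|h| <= 1 ->
  E u + E (u + h *: e_ j) <= A * (1 + enorm u) ^- N.
Proof.
have [A A0 hA] := rapid_bound rE N.
(* The factor [2 ^ N] comes from [1 + |u| <= 2 (1 + |u + h e_j|)], valid for [|h| <= 1]. *)
exists (A + 2 ^+ N * A) => [|j u h h1]; first by rewrite addr_ge0// mulr_ge0// exprn_ge0.
rewrite mulrDl lerD//; first exact: le_trans (ler_norm _) (hA u).
apply: le_trans (ler_norm _) _; apply: le_trans (hA _) _.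
rewrite -mulrA mulrCA ler_wpM2l//.
rewrite ler_pdivlMr ?enorm1_expr_gt0// mulrC ler_pdivrMr ?enorm1_expr_gt0// -exprMn.
rewrite lerXn2r ?nnegrE ?mulr_ge0 ?addr_ge0 ?enorm_ge0//.
have : enorm u <= enorm (u + h *: e_ j) + 1.
  have := enormD (u + h *: e_ j) (- (h *: e_ j)).
  by rewrite addrK enormN enormZ enorm_delta mulr1; lra.
by have := enorm_ge0 (u + h *: e_ j); lra.
Qed.

Let mE : measurable_fun setT E := rE.1.

Let mpair : measurable_fun setT (fun p : 'rV[R]_d * 'rV[R]_d => \1_D p.2 : R).
Proof. exact: (measurableT_comp mind measurable_snd). Qed.

Let rpsiE j F : rapid F -> rapid (fun u => psi j u * F u).
Proof.
move=> rF; split; last first.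
  move=> N; have [A A0 hA] := rapid_bound rF N.+1.
  exists (M * A) => u; rewrite normrM -mulrA.
  apply: le_trans (_ : M * ((1 + enorm u) * `|F u| * (1 + enorm u) ^+ N) <= _).
    rewrite mulrA mulrA [M * _]mulrA !ler_wpM2r ?enorm1_expr_ge0//.
    by rewrite (le_trans (psi_le j u))// mulrC ler_wpM2l// lerDr.
  rewrite ler_wpM2l// mulrAC -exprS mulrC.
  by rewrite -ler_pdivlMr ?enorm1_expr_gt0// hA.
have mG : measurable_fun setT (fun p : 'rV[R]_d * 'rV[R]_d =>
    \1_D p.2 * (p.2 ord0 j * sin (dotv p.1 p.2)) * F p.1).
  apply: measurable_funM; last exact: (measurableT_comp rF.1 measurable_fst).
  apply: measurable_funM => //; apply: measurable_funM.
    exact: (measurableT_comp (measurable_coord j) measurable_snd).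
  have := @measurable_sin_dotv R d _ _ fst snd 0 measurable_fst measurable_snd.
  by under eq_fun do rewrite addr0.
have := measurable_Rintegral nu mG.
rewrite /=; under eq_fun => u.
  rewrite RintegralZr//; last exact: integrable_q (psi_int_le j u).
  over.
exact.
Qed.

Let rdiff_E j : rdiff j E (fun u => - (psi j u * E u)).
Proof.
split=> //.
  under eq_fun do rewrite -mulN1r.
  by apply: rapidZ; exact: rpsiE.
(* Two extra orders: the increment of [phi] is of size [|h| (1 + |u|)] and enters squared in
   [expRN_taylor2]. *)
move=> N; have [A A0 hA] := E_shift (N + 2).
exists (((M + M) ^+ 2 + M) * A) => [|u h h1].
  by rewrite mulr_ge0// addr_ge0// sqr_ge0.
rewrite mulrN opprK; set a := phi u; set b := phi (u + h *: e_ j).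
have hb : `|b - a - h * psi j u| <= h ^+ 2 * M := phi_taylor j u h.
have hba : `|b - a| <= `|h| * ((M + M) * (1 + enorm u)).
  have -> : b - a = (b - a - h * psi j u) + h * psi j u by ring.
  apply: le_trans (ler_normD _ _) _.
  have hp : `|h * psi j u| <= `|h| * (enorm u * M) by rewrite normrM ler_wpM2l// psi_le.
  have hh : h ^+ 2 * M <= `|h| * M.
    by rewrite ler_wpM2r// -(real_normK (num_real h)) expr2 ler_piMl.
  have p1 : 0 <= `|h| * M by rewrite mulr_ge0.
  have p2 : 0 <= `|h| * (enorm u * M) by rewrite !mulr_ge0// enorm_ge0.
  lra.
have h2 : 0 <= h ^+ 2 by exact: sqr_ge0.
have hba2 : (b - a) ^+ 2 <= h ^+ 2 * ((M + M) ^+ 2 * (1 + enorm u) ^+ 2).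
  rewrite -(real_normK (num_real (b - a))) -(real_normK (num_real h)) -!exprMn.
  by rewrite ler_pXn2r ?nnegrE ?mulr_ge0 ?addr_ge0 ?enorm_ge0.
have -> : E (u + h *: e_ j) - E u + h * (psi j u * E u) =
  (expR (- b) - expR (- a) + expR (- a) * (b - a)) - expR (- a) * (b - a - h * psi j u).
  by rewrite /E -/a -/b; move: (expR _) (expR _) (psi j u) => ? ? ?; ring.
apply: le_trans (ler_normB _ _) _.
have hE := hA j u h h1; rewrite /E -/a -/b in hE.
have Ea := expR_ge0 (- a); have Eb := expR_ge0 (- b).
have t1 := expRN_taylor2 a b.
have t2 : `|expR (- a) * (b - a - h * psi j u)| <= h ^+ 2 * (M * (A * (1 + enorm u) ^- (N + 2))).
  have hEa : expR (- a) <= A * (1 + enorm u) ^- (N + 2) by apply: le_trans hE; rewrite lerDl.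
  rewrite normrM (ger0_norm Ea); apply: le_trans (ler_pM Ea (normr_ge0 _) hEa hb) _.
  by rewrite mulrC -mulrA.
have t3 : (b - a) ^+ 2 * (expR (- a) + expR (- b)) <=
    h ^+ 2 * ((M + M) ^+ 2 * (1 + enorm u) ^+ 2) * (A * (1 + enorm u) ^- (N + 2)).
  by rewrite ler_pM// ?sqr_ge0// addr_ge0.
apply: le_trans (lerD (le_trans t1 t3) t2) _.
have nn : (1 + enorm u) ^+ 2 * (1 + enorm u) ^- (N + 2) = (1 + enorm u) ^- N.
  by rewrite exprD invfM mulrCA divff ?mulr1// gt_eqF// enorm1_expr_gt0.
have n2 : (1 + enorm u) ^- (N + 2) <= (1 + enorm u) ^- N.
  by rewrite lef_pV2 ?posrE ?enorm1_expr_gt0// enorm1_expr_le// leq_addr.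
have -> : h ^+ 2 * ((M + M) ^+ 2 * (1 + enorm u) ^+ 2) * (A * (1 + enorm u) ^- (N + 2)) =
   h ^+ 2 * ((M + M) ^+ 2 * (A * (1 + enorm u) ^- N)).
  by rewrite -nn; ring.
rewrite -mulrDr ler_wpM2l// -mulrA mulrDl lerD2l ler_wpM2l// ler_wpM2l//.
Qed.

(** Integration by parts, as [rdiff_integral0] for [G E cos (<u, x> + th + pi / 2)]. Differentiating
    the cosine gives [- x_j sin (<u, x> + th + pi / 2) = - x_j cos (<u, x> + th)], which is why the
    phase is shifted beforehand. *)
Let ibp j G G' th x : pdiff j G G' -> x ord0 j * ft (fun u => G u * E u) th x =
  ft (fun u => G' u * E u) (th + pi / 2) x -
  ft (fun u => psi j u * (G u * E u)) (th + pi / 2) x.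
Proof.
move=> pG; have rd := rdiffM (pdiff_cos j x (th + pi / 2)) (rdiffM pG (rdiff_E j)).
have rGE := pdiff_rapid pG rE; have rG'E := pdiff_rapid' pG rE.
have rpGE := rpsiE j rGE.
have := rdiff_integral0 rd.
have i1 := rapid_integrable (rapid_cos x th rGE).
have i2 := rapid_integrable (rapid_cos x (th + pi / 2) rG'E).
have i3 := rapid_integrable (rapid_cos x (th + pi / 2) rpGE).
rewrite (_ : (\int[Leb]_u _) = \int[Leb]_u (G' u * E u * cos (dotv u x + (th + pi / 2)) -
    psi j u * (G u * E u) * cos (dotv u x + (th + pi / 2)) -
    x ord0 j * (G u * E u * cos (dotv u x + th)))); last first.
  by apply: eq_Rintegral => u _; rewrite [_ + (th + _)]addrA sinDpihalf cosDpihalf; ring.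
rewrite RintegralB//; last 2 first.
- exact: (integrableB measurableT i2 i3).
- exact: (integrableZl measurableT _ i1).
rewrite RintegralB// RintegralZl// => /eqP; rewrite subr_eq0 => /eqP h.
by rewrite /ft h.
Qed.

(** After Fubini, the product [sin <u, y> cos (<u, x> + th)] is half a difference of two sines, that
    is, of cosines with phase [th - pi / 2] at [x + y] and [x - y]. One factor [|y|] comes from
    [y_j], another from the mean value inequality, and [|y| ^ 2] is [nu]-integrable on [D]. *)
Let psi_ft_le j F th x (B : R) : rapid F ->
  (forall i z, enorm (z - x) <= 1 -> `|ft (fun u => u ord0 i * F u) th z| <= B) ->
  `|ft (fun u => psi j u * F u) th x| <= d%:R * B * M.
Proof.
move=> rF hB.
pose K := ft F (th - pi / 2).
have B0 : 0 <= d%:R * B.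
  rewrite mulr_ge0//; apply: le_trans (normr_ge0 _) (hB j x _).
  by rewrite subrr enorm0.
have mG : measurable_fun setT (fun p : 'rV[R]_d * 'rV[R]_d =>
    \1_D p.2 * (p.2 ord0 j * sin (dotv p.1 p.2)) * (F p.1 * cos (dotv p.1 x + th))).
  apply: measurable_funM.
    apply: measurable_funM => //; apply: measurable_funM.
      exact: (measurableT_comp (measurable_coord j) measurable_snd).
    have := @measurable_sin_dotv R d _ _ fst snd 0 measurable_fst measurable_snd.
    by under eq_fun do rewrite addr0.
  exact: (measurableT_comp (rapid_cos x th rF).1 measurable_fst).
have Gle u y : `|\1_D y * (y ord0 j * sin (dotv u y)) * (F u * cos (dotv u x + th))| <=
    enorm u * `|F u| * q y.
  rewrite normrM mulrAC ler_pM ?psi_int_le//.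
  by rewrite normrM ler_piMr// norm_cos_le1.
have iuF : Leb.-integrable setT (EFin \o (fun u => enorm u * `|F u|)).
  apply: rapid_integrable; apply: (rapidM (C := 1) (k := 1%N)) (rapid_norm rF) _ _.
    exact: measurable_enorm.
  by move=> u; rewrite expr1 mul1r ger0_norm ?enorm_ge0// lerDr.
have -> : ft (fun u => psi j u * F u) th x =
    \int[nu]_y (\1_D y * (y ord0 j * ((K (x + y) - K (x - y)) / 2))).
  transitivity (\int[Leb]_u \int[nu]_y (\1_D y * (y ord0 j * sin (dotv u y)) *
      (F u * cos (dotv u x + th)))).
    apply: eq_Rintegral => u _; rewrite RintegralZr ?mulrA//.
    exact: integrable_q (psi_int_le j u).
  rewrite (Rintegral_Fubini mG Gle iuF iD); apply: eq_Rintegral => y _ /=.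
  have i1 := rapid_integrable (rapid_cos (x + y) (th - pi / 2) rF).
  have i2 := rapid_integrable (rapid_cos (x - y) (th - pi / 2) rF).
  rewrite /K /ft -RintegralB// -RintegralZr//; last exact: (integrableB measurableT i1 i2).
  rewrite mulrA -RintegralZl//; last first.
    by under eq_fun do rewrite mulrC; exact: (integrableZl measurableT _ (integrableB measurableT i1 i2)).
  apply: eq_Rintegral => u _.
  have -> : dotv u (x + y) + (th - pi / 2) = dotv u x + th + dotv u y - pi / 2.
    by rewrite dotvDr; ring.
  have -> : dotv u (x - y) + (th - pi / 2) = dotv u x + th - dotv u y - pi / 2.
    by rewrite dotvBr; ring.
  have cospi z : cos (z - pi / 2) = sin z :> R.
    by rewrite -[in RHS](subrK (pi / 2) z) sinDpihalf.
  by rewrite !cospi sinD sinB; field.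
apply: integral_q.
  apply: measurable_funM => //; apply: measurable_funM; first exact: measurable_coord.
  apply: measurable_funM => //; apply: measurable_funB.
    apply: (measurableT_comp (measurable_ft _ rF)).
    by apply: measurable_rVD => //; exact: measurable_cst.
  apply: (measurableT_comp (measurable_ft _ rF)).
  by apply: measurable_rVD; [exact: measurable_cst|exact: measurable_rVN].
move=> y; rewrite normrM ger0_norm// /q [leRHS]mulrCA.
have [Dy|nDy] := pselect (D y); last by rewrite indicE memNset// !mul0r.
rewrite ler_wpM2l// normrM.
have -> : d%:R * B * enorm y ^+ 2 = enorm y * (d%:R * B * enorm y) by rewrite expr2; ring.
apply: ler_pM => //; first exact: coord_le.
rewrite normrM (ger0_norm (x := 2^-1)) ?invr_ge0// ler_pdivrMr//.
(* All points of the segment from [x - y] to [x + y] lie within [|y| <= 1] of [x], where [hB]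
   applies. *)
have -> : x + y = 2 *: y + (x - y).
  by apply/rowP => i; rewrite !mxE; ring.
have := @ft_segment_le R d F (th - pi / 2) (x - y) (2 *: y) B rF.
rewrite (subrK (pi / 2) th) enormZ (ger0_norm (ler0n R 2)) => hseg.
have -> : d%:R * B * enorm y * 2 = 2 * enorm y * (d%:R * B) by ring.
apply: hseg => i t /andP[t0 t1]; apply: hB.
have -> : t *: (2 *: y) + (x - y) - x = (t * 2 - 1) *: y.
  by apply/rowP => k; rewrite !mxE; ring.
rewrite enormZ.
have := D1 Dy; have := enorm_ge0 y.
have : `|t * 2 - 1| <= 1 by rewrite ler_norml; lra.
move: `|t * 2 - 1| => z z1 y0 y1; have [z0|z0] := leP 0 z; nra.
Qed.

(* Induction on [m]: [x_j ft (G E)] is, up to a phase, the transform of the j-th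
   derivative of [G E].  Differentiating [E] produces an integral over the small
   jumps [y] of [y_j (ft (G E) (x + y) - ft (G E) (x - y)) / 2], and the mean value
   inequality turns the difference into a factor [|y|], at the cost of one more
   coordinate in the polynomial but none in the decay order. *)
Theorem small_jump_decay (m : nat) G th : symb G ->
  exists A : R, forall x, `|ft (fun u => G u * E u) th x| * (1 + enorm x) ^+ m <= A.
Proof.
elim: m G th => [|m IH] G th sG.
  have rG : rapid (fun u => G u * E u).
    exact: symb_rapid.
  by eexists => x; rewrite mulr1; exact: ft_bound.
have [A0 hA0] := IH G th sG.
have key j : exists A : R, forall x,
    `|x ord0 j| * (`|ft (fun u => G u * E u) th x| * (1 + enorm x) ^+ m) <= A.
  have [G' sG' pG] := symb_pdiff j sG.
  have [A1 hA1] := IH G' (th + pi / 2) sG'.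
  have /fin_all_exists[A hA] : forall i, exists A : R, forall x,
      `|ft (fun u => u ord0 i * G u * E u) (th + pi / 2) x| * (1 + enorm x) ^+ m <= A.
    by move=> i; apply: IH; exact: symb_coord.
  have rGE := pdiff_rapid pG rE.
  have As i : 0 <= A i by apply: le_trans (hA i 0); rewrite mulr_ge0// enorm1_expr_ge0.
  (* [A1] bounds the term with [G']. The rest bounds the [psi] term: [2 ^ m] compares
     [(1 + |x|) ^ m] with [(1 + |z|) ^ m] for [|z - x| <= 1], and the sum makes the bound
     independent of the coordinate. *)
  exists (A1 + d%:R * (2 ^+ m * \sum_i A i) * M) => x.
  rewrite mulrA -normrM (ibp th x pG).
  have p0 := enorm1_expr_gt0 x m.
  rewrite -ler_pdivlMr//; apply: le_trans (ler_normB _ _) _.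
  rewrite [leRHS]mulrDl; apply: lerD; first by rewrite ler_pdivlMr.
  rewrite (mulrAC _ M) -(mulrA d%:R).
  apply: psi_ft_le => // i z zx.
  have -> : (fun u => u ord0 i * (G u * E u)) = (fun u => u ord0 i * G u * E u).
    by apply/funext => u; rewrite mulrA.
  rewrite ler_pdivlMr//.
  have xz : (1 + enorm x) ^+ m <= 2 ^+ m * (1 + enorm z) ^+ m.
    rewrite -exprMn lerXn2r ?nnegrE ?mulr_ge0 ?addr_ge0 ?enorm_ge0//.
    have := enormD z (x - z); rewrite addrC subrK enormB => h.
    by have := enorm_ge0 z; lra.
  apply: le_trans (ler_wpM2l (normr_ge0 _) xz) _.
  rewrite mulrCA ler_wpM2l ?exprn_ge0//; apply: le_trans (hA i z) _.
  by rewrite (bigD1 i)//= lerDl sumr_ge0.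
have [A hA] := fin_all_exists key.
exists (A0 + \sum_j A j) => x.
rewrite exprS mulrCA mulrDl mul1r lerD//.
apply: le_trans (ler_wpM2r _ (enorm_le_sum x)) _.
  by rewrite mulr_ge0// enorm1_expr_ge0.
by rewrite mulr_suml ler_sum.
Qed.

End small_jumps.

Section mrestr_integral.
Context d (T : measurableType d) (R : realType).
Variables (m : {measure set T -> \bar R}) (A : set T) (mA : measurable A).

Lemma ge0_integral_mrestr (f : T -> \bar R) :
  measurable_fun setT f -> (forall x, 0 <= f x)%E ->
  (\int[mrestr m mA]_x f x = \int[m]_x (f x * (\1_A x)%:E))%E.
Proof.
move=> mf f0; apply: ge0_integral_density => //.
move=> B mB; rewrite integral_mkcond.
rewrite (eq_integral (fun x => (\1_(B `&` A) x)%:E)); last first.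
  move=> x _; rewrite patchE !indicE in_setI.
  by case: ifPn => //= /negbTE ->.
by rewrite integral_indic ?setIT//; exact: measurableI.
Qed.

End mrestr_integral.

Lemma eq_indic (T T' : Type) (R : realType) (A : set T) (B : set T') x y :
  (A x <-> B y) -> \1_A x = \1_B y :> R.
Proof.
move=> AB; rewrite !indicE; have [Ax|nAx] := pselect (A x).
  by rewrite !mem_set//; exact/AB.
by rewrite !memNset// => /AB.
Qed.

(** * Scaling, symmetry and finite tail of the Levy measure *)

Section levy_facts.
Context {R : realType} {d : nat}.
Variables (alpha : R) (mu : {finite_measure set 'rV[R]_d -> \bar R}).
Hypotheses (alpha0 : 0 < alpha) (alpha2 : alpha < 2) (smu : spectral_measure mu).
Notation nu := (levy_measure alpha mu).
Notation leb := (@lebesgue_measure R).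
Implicit Types (u x y z : 'rV[R]_d) (D : set 'rV[R]_d).

Let w D (p : 'rV[R]_d * R) : R :=
  \1_D (p.2 *: p.1) * p.2 `^ (- 1 - alpha) * \1_(`]0%R, +oo[) p.2.

Let w_ge0 D p : 0 <= w D p.
Proof. by rewrite /w !mulr_ge0// ?powR_ge0// indicE. Qed.

Let inner D x : \bar R := (\int[leb]_r (w D (x, r))%:E)%E.

Let inner_ge0 D x : (0 <= inner D x)%E.
Proof. by apply: integral_ge0 => r _; rewrite lee_fin. Qed.

Let levyE D : nu D = (\int[mu]_(x in usphere) inner D x)%E.
Proof.
apply: eq_integral => x _; rewrite integral_mkcond; apply: eq_integral => r _.
rewrite patchE /w /= [\1_(`]0, +oo[) r]indicE.
by case: ifPn => _; rewrite ?mulr1 ?mulr0.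
Qed.

Let mscale2 : measurable_fun setT (fun p : 'rV[R]_d * R => p.2 *: p.1).
Proof.
apply: measurable_fun_coord => i.
apply: (eq_measurable_fun (fun p : 'rV[R]_d * R => p.2 * p.1 ord0 i)).
  by move=> p _; rewrite mxE.
apply: measurable_funM; first exact: measurable_snd.
exact: (measurableT_comp (measurable_coord i) measurable_fst).
Qed.

Let mw D : measurable D -> measurable_fun setT (EFin \o w D).
Proof.
move=> mD; apply/measurable_EFinP; apply: measurable_funM.
  apply: measurable_funM.
    exact: (measurableT_comp (measurable_indic mD) mscale2).
  exact: (measurableT_comp (measurable_powR (- 1 - alpha)) measurable_snd).
have mI : measurable (`]0%R, +oo[ : set R) by exact: measurable_itv.
exact: (measurableT_comp (measurable_indic mI) measurable_snd).
Qed.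

Let mw1 D x : measurable D -> measurable_fun setT (fun r : R => (w D (x, r))%:E).
Proof. by move=> mD; exact: (measurableT_comp (mw mD) (pair1_measurable x)). Qed.

Let minner D : measurable D -> measurable_fun setT (inner D).
Proof.
move=> mD; apply: (@measurable_fun_fubini_tonelli_F _ _ 'rV[R]_d (measurableTypeR R) R leb
  (EFin \o w D)); first exact: mw.
by move=> p; rewrite lee_fin.
Qed.

Lemma levy_measure_scale (l : R) D : 0 < l -> measurable D ->
  nu ((fun y => l *: y) @^-1` D) = ((l `^ alpha)%:E * nu D)%E.
Proof.
move=> l0 mD; rewrite !levyE -ge0_integralZl//.
- apply: eq_integral => x _; rewrite /inner.
  rewrite [in RHS](@ge0_integral_affine1 R l 0)//; last first.
  + by move=> r; rewrite lee_fin.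
  + exact: mw1.
  + by rewrite gt_eqF.
  rewrite muleA -EFinM -ge0_integralZl//.
  + apply: eq_integral => r _; rewrite -EFinM; congr EFin.
    rewrite /w /= addr0.
    rewrite [\1_(`]0, +oo[) (l * r)](_ : _ = \1_(`]0, +oo[) r); last first.
      by apply: eq_indic; rewrite /= !in_itv/= !andbT pmulr_rgt0.
    rewrite [\1_(_ @^-1` _) _](_ : _ = \1_D ((l * r) *: x)); last first.
      by apply: eq_indic; rewrite /= scalerA.
    have [r0|r0] := ltP 0 r; last first.
      by rewrite [\1_(`]0, +oo[) r]indicE memNset ?mulr0//= in_itv/= andbT; apply/negP; rewrite -leNgt.
    rewrite (powRM _ (ltW l0) (ltW r0)) (gtr0_norm l0).
    (* The factor [l] is the Jacobian of [r -> l r] in the radial integral, and the last one comes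
       from the radial density. *)
    suff : l `^ alpha * l * l `^ (- 1 - alpha) = 1.
      move: (l `^ alpha) (l `^ (-1 - alpha)) (r `^ (-1 - alpha)) => p q s e.
      by rewrite -[LHS]mul1r -e; ring.
    have l00 : l != 0 by rewrite gt_eqF.
    rewrite -[X in _ * X * _](powRr1 (ltW l0)) -!powRD ?l00 ?implybT//.
    by rewrite (_ : _ + _ = 0) ?powRr0//; ring.
  + under eq_fun do rewrite addr0.
    exact: (measurableT_comp (mw1 x mD) (mulrl_measurable l)).
  + by move=> r _; rewrite lee_fin.
  + by rewrite lee_fin mulr_ge0 ?powR_ge0.
- exact: measurable_usphere.
- by apply: measurable_funTS; exact: minner.
- by rewrite lee_fin powR_ge0.
Qed.

Let muN A : measurable A -> mu ((fun y => - y) @^-1` A) = mu A.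
Proof.
move=> mA; rewrite -(spectral_symmetric smu mA); congr (mu _).
apply/seteqP; split => [y Ay|y [x Ax <-]]; last by rewrite /= opprK.
by exists (- y) => //; rewrite opprK.
Qed.

Lemma levy_measureN D : measurable D -> nu ((fun y => - y) @^-1` D) = nu D.
Proof.
move=> mD; rewrite !levyE.
have mN : measurable_fun setT (fun y : 'rV[R]_d => - y) by exact: measurable_rVN.
transitivity (\int[mu]_(x in (fun y : 'rV[R]_d => (- y)%R) @^-1` usphere) inner D (- x)%R)%E.
  rewrite (_ : (fun y => - y) @^-1` usphere = usphere); last first.
    by apply/seteqP; split => y; rewrite /usphere /= enormN.
  apply: eq_integral => x _; apply: eq_integral => r _; congr EFin.
  rewrite /w /=; congr (_ * _ * _).
  by apply: eq_indic; rewrite /= scalerN.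
have := @ge0_integral_pushforward _ _ _ _ R _ mN mu usphere (inner D)
  measurable_usphere (measurable_funTS (minner mD)) (fun y _ => inner_ge0 D y).
move=> /= <-; apply: eq_measure_integral => A mA _.
by rewrite /= /pushforward muN.
Qed.

Lemma levy_measure_set0 : nu [set 0] = 0%E.
Proof.
rewrite levyE integral0_eq// => x x1; rewrite /inner integral0_eq// => r _.
rewrite /w /= !indicE; case: (boolP (r \in _)) => [|_]; last by rewrite mulr0.
rewrite inE/= in_itv/= andbT => r0; rewrite memNset ?mul0r// => /eqP.
rewrite scaler_eq0 gt_eqF//= => /eqP x0; move: x1; rewrite x0 /usphere /= enorm0.
by move=> /esym/eqP; rewrite oner_eq0.
Qed.

Definition far : set 'rV[R]_d := [set y | 1 <= enorm y].
Definition near0 : set 'rV[R]_d := [set y | enorm y < 1].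

Lemma measurable_far : measurable far.
Proof.
rewrite (_ : far = (@enorm R d) @^-1` `[1, +oo[).
  by rewrite -[X in measurable X]setTI; exact: measurable_enorm.
by apply/seteqP; split => y /=; rewrite /far /= in_itv /= andbT.
Qed.

Lemma near0E : near0 = ~` far.
Proof.
by apply/seteqP; split => y; rewrite /near0 /far /= => h; [apply/negP; rewrite -ltNge|
  rewrite ltNge; apply/negP].
Qed.

Lemma measurable_near0 : measurable near0.
Proof. by rewrite near0E; apply: measurableC; exact: measurable_far. Qed.

Let mu_sphere_fin : (mu usphere < +oo)%E.
Proof. by rewrite ltey_eq fin_num_measure//; exact: measurable_usphere. Qed.

(** For [r >= 1] the radial density is at most [2 ^ (1 + alpha) (1 + r) ^ (- 1 - alpha)], so
    [dyadic_integral] bounds the radial integral uniformly over the sphere, and [mu] is finite. *)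
Lemma levy_measure_far : (nu far < +oo)%E.
Proof.
pose K : R := 2 `^ (1 + alpha) * 2 / (1 - 2 `^ (1 - (1 + alpha))).
have a1 : 0 <= 1 + alpha by rewrite addr_ge0// ltW.
have tail : (\int[leb]_r (\1_(setT : set R) r * (1 + `|r|) `^ (- (1 + alpha)))%:E <= K%:E)%E.
  apply: (@dyadic_integral _ _ R leb setT (fun r : R => `|r|) (1 + alpha) 1 2) => //.
  - exact: measurableT_comp.
  - by rewrite ltrDl.
  - move=> k; rewrite setTI (_ : [set x : R | _] = ball (0 : R) (2 ^+ k)); last first.
      by apply/seteqP; split => r; rewrite /ball/= sub0r normrN.
    rewrite le_eqVlt; apply/predU1P; left.
    apply: (etrans (@lebesgue_measure_ball R 0 (2 ^+ k) _)); first by rewrite exprn_ge0.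
    by rewrite powRr1 ?exprn_ge0// mulr_natl.
have b x : usphere x -> (inner far x <= (2 `^ (1 + alpha) * K)%:E)%E.
  move=> x1; apply: (@le_trans _ _ ((2 `^ (1 + alpha))%:E *
     \int[leb]_r (\1_(setT : set R) r * (1 + `|r|) `^ (- (1 + alpha)))%:E)%E); last first.
    by rewrite EFinM lee_pmul2l ?lte_fin ?powR_gt0.
  have mtail : measurable_fun setT
      (fun r : R => \1_(setT : set R) r * (1 + `|r|) `^ (- (1 + alpha))).
    apply: measurable_funM; first exact: measurable_indic.
    apply: (measurableT_comp (measurable_powR _)).
    by apply: measurable_funD => //; exact: measurableT_comp.
  rewrite -ge0_integralZl//; [|exact/measurable_EFinP].
  apply: ge0_le_integral => //.
  - by move=> r _; rewrite lee_fin.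
  - by apply: mw1; exact: measurable_far.
  - by apply: measurable_funeM; exact/measurable_EFinP.
  move=> r _; rewrite -EFinM lee_fin [\1_setT r]indicE in_setT mul1r.
  have rhs0 : 0 <= 2 `^ (1 + alpha) * (1 + `|r|) `^ (- (1 + alpha)) by rewrite mulr_ge0 ?powR_ge0.
  rewrite /w /= !indicE; case: (boolP (r \in _)) => [|_]; last by rewrite mulr0.
  rewrite inE/= in_itv/= andbT => r0; case: (boolP (_ \in far)) => [|_]; last by rewrite !mul0r.
  rewrite inE /far /= enormZ x1 mulr1 gtr0_norm// => r1; rewrite mul1r mulr1.
  have -> : - 1 - alpha = - (1 + alpha) by ring.
  rewrite !powRN ler_pdivlMr ?powR_gt0 ?addr_gt0// mulrC ler_pdivrMr ?powR_gt0//.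
  rewrite -powRM ?(ltW r0)// ge0_ler_powR ?nnegrE//.
  - by rewrite addr_ge0// ltW.
  - by rewrite mulr_ge0// ltW.
  - lra.
rewrite levyE; apply: (@le_lt_trans _ _ (\int[mu]_(x in usphere) (2 `^ (1 + alpha) * K)%:E)%E).
  apply: ge0_le_integral => //.
  - exact: measurable_usphere.
  - by apply: measurable_funTS; apply: minner; exact: measurable_far.
rewrite integral_cst//; last exact: measurable_usphere.
have K0 : (0 <= K%:E)%E.
  by apply: le_trans tail; apply: integral_ge0 => r _; rewrite lee_fin mulr_ge0 ?powR_ge0// indicE.
by rewrite lte_mul_pinfty// lee_fin mulr_ge0 ?powR_ge0// -lee_fin.
Qed.

(** The radial density is at least 1 on []0, 1[], so each direction in the cone contributes at least
    1. This carries null sets of [nu] near the origin over to [mu], where nondegeneracy is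
    assumed. *)
Lemma levy_measure_cone_ge (U : set 'rV[R]_d) : measurable U ->
  (forall (r : R) x, 0 < r -> U x -> U (r *: x)) ->
  (mu (U `&` usphere) <= nu (near0 `&` U))%E.
Proof.
move=> mU coneU; rewrite levyE -integral_indic//; last exact: measurable_usphere.
have mnU : measurable (near0 `&` U) by apply: measurableI => //; exact: measurable_near0.
apply: ge0_le_integral => //.
- exact: measurable_usphere.
- by apply/measurable_EFinP; apply: measurable_funTS; exact: measurable_indic.
- by apply: measurable_funTS; exact: minner.
move=> x x1; have [Ux|nUx] := pselect (U x); last by rewrite indicE memNset.
rewrite indicE mem_set//.
have mI : measurable (`]0, 1[ : set R) by exact: measurable_itv.
apply: (@le_trans _ _ (\int[leb]_r (\1_(`]0%R, 1%R[) r)%:E)%E).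
  have L1 : leb (`]0%R, 1%R[%classic : set R) = 1%E.
    by rewrite lebesgue_measure_itv/= lte_fin ltr01 -EFinB subr0.
  rewrite le_eqVlt; apply/predU1P; left.
  by rewrite integral_indic// setIT; exact/esym/L1.
apply: ge0_le_integral => //.
- by apply/measurable_EFinP; exact: measurable_indic.
- exact: mw1.
move=> r _; rewrite lee_fin; have [|nr] := boolP (r \in (`]0%R, 1%R[%classic : set R)); last first.
  by rewrite indicE (negbTE nr).
rewrite inE/= in_itv/= => /andP[r0 r1]; rewrite /w /= !indicE !mem_set//=.
- rewrite mul1r mulr1 -[leLHS]expR0 /powR gt_eqF// ler_expR.
  have l0 : ln r <= 0 by rewrite ln_le0// ltW.
  by apply: mulr_le0 => //; rewrite -opprD oppr_le0 addr_ge0// ltW.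
- by rewrite in_itv/= r0.
- split; last exact: coneU.
  by rewrite /near0 /= enormZ x1 mulr1 gtr0_norm.
- by rewrite in_itv/= r0.
Qed.

End levy_facts.

Lemma pow2_lt1 (R : realType) (e : R) : e < 0 -> 2 `^ e < 1 :> R.
Proof. by move=> e0; rewrite /powR gt_eqF// expR_lt1 pmulr_llt0 ?ln_gt0 ?ltr1n. Qed.

(** With [p = |x|] and [q = |x - z|]: the two situations in which the weight at [x - z] is directly
    comparable to the weight at [x]. *)
Lemma far_quarter (R : realType) (p q : R) : 0 <= q -> p / 4 <= q \/ p < 1 ->
  1 + p <= 4 * (1 + q).
Proof. by move=> q0 [|]; lra. Qed.

(** * Second moment, masses of balls, and convolution of the weight with large jumps *)

Section levy_moments.
Context {R : realType} {d : nat}.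
Variables (alpha : R) (mu : {finite_measure set 'rV[R]_d -> \bar R}).
Hypotheses (alpha0 : 0 < alpha) (alpha2 : alpha < 2) (smu : spectral_measure mu).
Notation nu := (levy_measure alpha mu).
Implicit Types (u v x y z : 'rV[R]_d) (D : set 'rV[R]_d).

Lemma ge0_integral_levy_scale (l : R) (f : 'rV[R]_d -> \bar R) : 0 < l ->
  measurable_fun setT f -> (forall x, 0 <= f x)%E ->
  (\int[nu]_x f (l *: x)%R = (l `^ alpha)%:E * \int[nu]_x f x)%E.
Proof.
move=> l0 mf f0; pose nl : {nonneg R} := NngNum (powR_ge0 l alpha).
have := @ge0_integral_pushforward _ _ _ _ R _ (measurable_rVZ l) nu setT f measurableT mf
  (fun y _ => f0 y).
rewrite preimage_setT /= => <-; rewrite -(@ge0_integral_mscale _ _ _ nu setT measurableT nl)//.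
apply: eq_measure_integral => [|hm A mA _]; first exact: measurable_rVZ.
exact: levy_measure_scale.
Qed.

Lemma levy_measure_far_scale (l : R) : 0 < l ->
  nu [set y | 1 <= l * enorm y] = ((l `^ alpha)%:E * nu far)%E.
Proof.
move=> l0; rewrite (_ : mkset _ = (fun y => l *: y) @^-1` far).
  by apply: levy_measure_scale => //; exact: measurable_far.
by apply/seteqP; split => y; rewrite /far /= enormZ gtr0_norm.
Qed.

Lemma measurable_far_scale (l : R) : measurable [set y : 'rV[R]_d | 1 <= l * enorm y].
Proof.
rewrite (_ : mkset _ = (fun y => l * enorm y) @^-1` `[1, +oo[).
  rewrite -[X in measurable X]setTI.
  by apply: (measurable_funM (measurable_cst l) measurable_enorm).
by apply/seteqP; split => y /=; rewrite in_itv /= andbT.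
Qed.

(** Fubini and measurability of parametric integrals require this, while [nu] may have infinite mass
    near the origin. The exhausting sets [|y| >= 1 / (k + 1)] have finite mass by scaling, and the
    origin is not charged. *)
Lemma levy_measure_sigma_finite : sigma_finite setT nu.
Proof.
exists (fun k : nat => [set 0] `|` [set y | 1 <= k.+1%:R * enorm y]).
  apply/seteqP; split => // y _; have [->|y0] := eqVneq y 0; first by exists 0%N => //; left.
  have ny := enorm_gt0 y0; have [k] := ltr_add_invr ny.
  rewrite add0r => hk; exists k => //; right => /=.
  by rewrite -ler_pdivrMl// mulr1 ltW.
have m0 : measurable [set 0 : 'rV[R]_d].
  have -> : [set 0 : 'rV[R]_d] = (@enorm R d) @^-1` [set 0].
    apply/seteqP; split => y /=; first by move=> ->; rewrite enorm0.
    exact: enorm0_eq0.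
  by rewrite -[X in measurable X]setTI; apply: measurable_enorm => //; exact: measurable_set1.
move=> k; split; first by apply: measurableU => //; exact: measurable_far_scale.
apply: (@le_lt_trans _ _ (nu [set 0%R] + nu [set y | (1 <= k.+1%:R * enorm y)%R])%E).
  by apply: measureU2 => //; exact: measurable_far_scale.
rewrite levy_measure_set0// add0e levy_measure_far_scale//.
by rewrite lte_mul_pinfty// ?lee_fin ?powR_ge0// levy_measure_far.
Qed.

(** Dyadic summation with [rho = 1 / |y|]: scaling gives mass of order [2 ^ (k alpha)] outside
    radius [2 ^ (- k)], and [|y| ^ 2 <= 4 (1 + 1 / |y|) ^ (- 2)] inside the unit ball. Convergence
    is the condition [alpha < 2]. *)
Lemma levy_second_moment :
  nu.-integrable setT (EFin \o (fun y => \1_near0 y * enorm y ^+ 2)).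
Proof.
(* The origin is removed because there the inverse of the norm is 0 by convention, so [rho] would be
   small instead of infinite. *)
pose A := [set y : 'rV[R]_d | enorm y != 0] `&` near0.
have mA : measurable A.
  apply: measurableI; last exact: measurable_near0.
  rewrite (_ : mkset _ = ~` ((@enorm R d) @^-1` [set 0])); last first.
    by apply/seteqP; split => y /= /eqP.
  by apply: measurableC; rewrite -[X in measurable X]setTI;
    apply: measurable_enorm => //; exact: measurable_set1.
have minv : measurable_fun setT (fun y : 'rV[R]_d => (enorm y)^-1).
  under eq_fun => y do rewrite -powR_inv1 ?enorm_ge0//.
  exact: (measurableT_comp (measurable_powR (- 1)) measurable_enorm).
have nufin : nu far \is a fin_num by rewrite ge0_fin_numE// levy_measure_far.
have tail := @dyadic_integral _ _ R nu A (fun y => (enorm y)^-1) 2 alpha (fine (nu far)) mA minv _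
  (ltW (ltr0n R 2)) alpha2 _ _.
have {}tail : (\int[nu]_y (\1_A y * (1 + (enorm y)^-1) `^ (- 2))%:E < +oo)%E.
  apply: le_lt_trans (tail _ _ _) (ltry _).
  - by move=> y; rewrite invr_ge0 enorm_ge0.
  - by rewrite fine_ge0.
  - move=> k; rewrite EFinM fineK// muleC -(levy_measure_far_scale (exprn_gt0 k (ltr0n R 2))).
    apply: le_measure; rewrite ?inE.
    + apply: measurableI => //.
      rewrite (_ : mkset _ = (fun y : 'rV[R]_d => (enorm y)^-1) @^-1` `]-oo, 2 ^+ k[).
        by rewrite -[X in measurable X]setTI; exact: minv.
      by apply/seteqP; split => y /=; rewrite in_itv.
    + exact: measurable_far_scale.
    + move=> y [[y0 _]] /= h; have ny : 0 < enorm y by rewrite lt0r y0 enorm_ge0.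
      by rewrite -ler_pdivrMr// div1r ltW.
have mf : measurable_fun setT (fun y : 'rV[R]_d => \1_near0 y * enorm y ^+ 2).
  apply: measurable_funM; first by apply: measurable_indic; exact: measurable_near0.
  by apply: measurable_funX; exact: measurable_enorm.
have mg : measurable_fun setT (fun y : 'rV[R]_d => \1_A y * (1 + (enorm y)^-1) `^ (- 2)).
  apply: measurable_funM; first exact: measurable_indic.
  apply: (measurableT_comp (measurable_powR _)).
  exact: measurable_funD.
apply: (@integrable_dominated _ _ _ _ _ (fun y => 4 * (\1_A y * (1 + (enorm y)^-1) `^ (- 2)))) => //.
  move=> y; rewrite normrM !ger0_norm ?sqr_ge0 ?indicE//.
  have r0 : 0 <= 4 * ((y \in A)%:R * (1 + (enorm y)^-1) `^ (- 2)) by rewrite !mulr_ge0 ?powR_ge0.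
  have [y1|y1] := boolP (y \in near0); last by rewrite mul0r.
  have [y0|y0] := eqVneq (enorm y) 0; first by rewrite y0 expr0n mulr0.
  have ny : 0 < enorm y by rewrite lt0r y0 enorm_ge0.
  rewrite inE in y1; rewrite mem_set ?mul1r; last by split.
  rewrite powRN powR_mulrn ?addr_ge0 ?invr_ge0 ?enorm_ge0//.
  rewrite ler_pdivlMr ?exprn_gt0 ?addr_gt0 ?invr_gt0// -exprMn mulrDr mulr1 divff//.
  have y1' : enorm y < 1 := y1.
  by rewrite expr2; nra.
suff ig : nu.-integrable setT (EFin \o (fun y => \1_A y * (1 + (enorm y)^-1) `^ (- 2))).
  exact: (integrableZl measurableT 4 ig).
apply/integrableP; split; first exact/measurable_EFinP.
rewrite (eq_integral (fun y => (\1_A y * (1 + (enorm y)^-1) `^ (- 2))%:E))// => y _.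
by rewrite gee0_abs// lee_fin mulr_ge0 ?powR_ge0// indicE.
Qed.

(** Dilating by [1 / |x|] puts the centre on the unit sphere; [|x| ^ (- alpha)] comes from the
    scaling of [nu] and [|x| ^ (- gamma)] from the rescaled radius. *)
Lemma levy_measure_ball (gamma c : R) x (r : R) : 0 <= c ->
  (forall x r, enorm x = 1 -> 0 < r < 1 / 2 -> (nu (eball x r) <= (c * r `^ gamma)%:E)%E) ->
  0 < r < enorm x / 2 ->
  (nu (eball x r) <= (c * enorm x `^ (- (alpha + gamma)) * r `^ gamma)%:E)%E.
Proof.
move=> c0 hg /andP[r0 rx]; have x0 : 0 < enorm x by lra.
have xi0 : 0 < (enorm x)^-1 by rewrite invr_gt0.
have -> : eball x r = (fun y => (enorm x)^-1 *: y) @^-1` eball ((enorm x)^-1 *: x) ((enorm x)^-1 * r).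
  apply/seteqP; split => y; rewrite /eball /= -scalerBr enormZ gtr0_norm// ltr_pM2l//.
rewrite levy_measure_scale//; last exact: measurable_eball.
apply: (@le_trans _ _ (((enorm x)^-1 `^ alpha)%:E * (c * ((enorm x)^-1 * r) `^ gamma)%:E)%E).
  rewrite lee_pmul2l ?lte_fin ?powR_gt0//; apply: hg.
    by rewrite enormZ gtr0_norm// mulVf// gt_eqF.
  by rewrite mulr_gt0// mulrC ltr_pdivrMr//; lra.
rewrite -EFinM lee_fin powRM ?(ltW xi0) ?(ltW r0)//.
have -> : enorm x `^ (- (alpha + gamma)) = (enorm x)^-1 `^ alpha * (enorm x)^-1 `^ gamma.
  rewrite -powRD; last by rewrite (gt_eqF xi0) implybT.
  by rewrite -powR_inv1 ?enorm_ge0// -powRrM; congr (_ `^ _); ring.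
by rewrite le_eqVlt; apply/predU1P; left; ring.
Qed.

Definition Vw (a : R) x : R := (1 + enorm x) `^ (- a).

Lemma Vw_ge0 a x : 0 <= Vw a x.
Proof. exact: powR_ge0. Qed.

Lemma measurable_Vw a : measurable_fun setT (Vw a).
Proof.
apply: (measurableT_comp (measurable_powR _)).
by apply: measurable_funD => //; exact: measurable_enorm.
Qed.

Lemma Vw_le a x y (k : R) : 0 <= a -> 0 < k -> 1 + enorm y <= k * (1 + enorm x) ->
  Vw a x <= k `^ a * Vw a y.
Proof.
move=> a0 k0 xy; rewrite /Vw !powRN ler_pdivlMr ?powR_gt0 ?enorm1_gt0//.
rewrite mulrC ler_pdivrMr ?powR_gt0 ?enorm1_gt0// -powRM ?(ltW k0) ?(ltW (enorm1_gt0 _))//.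
apply: ge0_ler_powR => //; rewrite nnegrE; first exact/ltW/enorm1_gt0.
by rewrite mulr_ge0 ?(ltW k0)//; exact/ltW/enorm1_gt0.
Qed.

(* Outside [B(x, |x|/4)] the weight is already at most [4^a Vw a x]; inside, sum
   over dyadic balls around [x], whose [nu]-mass is at most
   [c rho^gamma |x|^(-alpha-gamma)] by the scaling of [nu]. *)
Lemma Vw_convolution (gamma c : R) (nu2 : {finite_measure set 'rV[R]_d -> \bar R}) :
  0 <= gamma -> 0 <= c -> (forall A, measurable A -> nu2 A <= nu A)%E ->
  (forall x r, enorm x = 1 -> 0 < r < 1 / 2 -> (nu (eball x r) <= (c * r `^ gamma)%:E)%E) ->
  exists2 C : R, 0 <= C & forall x,
    nu2.-integrable setT (EFin \o (fun z => Vw (alpha + gamma) (x - z))) /\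
    \int[nu2]_z Vw (alpha + gamma) (x - z) <= C * Vw (alpha + gamma) x.
Proof.
move=> g0 c0 nu2le hg; set a := alpha + gamma; have a0 : 0 < a by rewrite ltr_wpDr.
pose M : R := fine (nu2 setT).
have mV x : measurable_fun setT (fun z => Vw a (x - z)).
  apply: (measurableT_comp (measurable_Vw a)); apply: measurable_rVD; first exact: measurable_cst.
  exact: measurable_rVN.
have V1 x : Vw a x <= 1.
  rewrite /Vw powRN invf_le1 ?powR_gt0 ?enorm1_gt0//.
  apply: (@le_trans _ _ (1 `^ a)); first by rewrite powR1.
  apply: ge0_ler_powR; rewrite ?nnegrE ?(ltW a0)//.
    exact/ltW/enorm1_gt0.
  exact: enorm1_ge1.
have iV x : nu2.-integrable setT (EFin \o (fun z => Vw a (x - z))).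
  apply: (@integrable_dominated _ _ _ _ _ (cst 1)) => //.
    by move=> z; rewrite ger0_norm ?Vw_ge0// V1.
  exact: finite_measure_integrable_cst.
pose B : R := 2 `^ a * (c * 2 `^ a) / (1 - 2 `^ (gamma - a)).
have z1 : 0 <= 1 - 2 `^ (gamma - a).
  by rewrite subr_ge0 ltW//; apply: pow2_lt1; rewrite /a opprD addrCA subrr addr0 oppr_lt0.
have B0 : 0 <= B by rewrite divr_ge0 ?mulr_ge0 ?powR_ge0.
have M0 : 0 <= M by exact: fine_ge0.
exists (4 `^ a * M + B) => [|x]; first by rewrite addr_ge0// mulr_ge0 ?powR_ge0.
split=> //; pose near := eball x (enorm x / 4).
have mnear : measurable near by exact: measurable_eball.
have inear : nu2.-integrable setT (EFin \o (fun z => \1_near z * Vw a (x - z))).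
  apply: (@integrable_dominated _ _ _ _ _ (fun z => Vw a (x - z))) => //.
    by apply: measurable_funM => //; exact: measurable_indic.
  move=> z; rewrite normrM ger0_norm ?indicE// (ger0_norm (Vw_ge0 _ _)).
  by rewrite ler_piMl ?Vw_ge0//; case: (_ \in _).
have near_le : \int[nu2]_z (\1_near z * Vw a (x - z)) <= B * Vw a x \/ enorm x < 1.
  have [x1|] := leP 1 (enorm x); [left|by right].
  have x0 : 0 < enorm x by lra.
  rewrite -lee_fin EFin_Rintegral//.
  pose K := c * enorm x `^ (- a).
  have K0 : 0 <= K by rewrite mulr_ge0// powR_ge0.
  have mrho : measurable_fun setT (fun z : 'rV[R]_d => enorm (z - x)).
    apply: (measurableT_comp measurable_enorm).
    by apply: measurable_rVD => //; exact: measurable_cst.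
  have := @dyadic_integral _ _ R nu2 near (fun z => enorm (z - x)) a gamma K mnear mrho
    (fun z => enorm_ge0 _) (ltW a0) _ K0 _.
  rewrite -/(eball _ _) => hd.
  apply: (@le_trans _ _ (\int[nu2]_z (\1_near z * (1 + enorm (z - x)) `^ (- a))%:E)%E).
    by rewrite le_eqVlt; apply/predU1P; left; apply: eq_integral => z _; rewrite /Vw enormB.
  apply: le_trans (hd _ _) _.
  - by rewrite /a ltrDr.
  (* Truncating at [|x| / 4] keeps the radius below [|x| / 2], as [levy_measure_ball] demands. *)
  - move=> k; pose s := Num.min (2 ^+ k) (enorm x / 4).
    have s0 : 0 < s by rewrite lt_min exprn_gt0// divr_gt0.
    have -> : near `&` [set z | enorm (z - x) < 2 ^+ k] = eball x s.
      apply/seteqP; split => z; rewrite /near /eball /s /= lt_min.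
        by move=> [-> ->].
      by move=> /andP[-> ->].
    apply: le_trans (nu2le _ _) _; first exact: measurable_eball.
    apply: le_trans (levy_measure_ball c0 hg _) _.
      rewrite s0 /=; apply: (@le_lt_trans _ _ (enorm x / 4)); first by rewrite ge_min lexx orbT.
      by lra.
    rewrite lee_fin ler_wpM2l// ge0_ler_powR ?nnegrE ?(ltW s0) ?exprn_ge0//.
    by rewrite ge_min lexx.
  have xa : enorm x `^ (- a) <= 2 `^ a * Vw a x.
    rewrite /Vw !powRN ler_pdivlMr ?powR_gt0 ?enorm1_gt0//.
    rewrite mulrC ler_pdivrMr ?powR_gt0// -powRM ?(ltW x0)//.
    apply: ge0_ler_powR; rewrite ?nnegrE ?(ltW a0) ?(ltW (enorm1_gt0 _))//; last by lra.
    by rewrite mulr_ge0// ltW.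
  rewrite lee_fin.
  have -> : 2 `^ a * K / (1 - 2 `^ (gamma - a)) =
      2 `^ a * c / (1 - 2 `^ (gamma - a)) * enorm x `^ (- a) by rewrite /K; ring.
  have -> : B * Vw a x = 2 `^ a * c / (1 - 2 `^ (gamma - a)) * (2 `^ a * Vw a x).
    by rewrite /B; ring.
  by rewrite ler_wpM2l// divr_ge0// mulr_ge0// powR_ge0.
have ic : nu2.-integrable setT (EFin \o (fun=> 4 `^ a * Vw a x)).
  exact: finite_measure_integrable_cst.
have Mc : \int[nu2]_z (4 `^ a * Vw a x) = 4 `^ a * M * Vw a x.
  by rewrite Rintegral_cst// /M; ring.
case: near_le => [near_le|x1].
  rewrite mulrDl -Mc; apply: le_trans (lerD (lexx _) near_le).
  rewrite -RintegralD//; apply: le_Rintegral => //; first exact: integrableD ic inear.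
  move=> z _; have [zn|zn] := pselect (near z).
    by rewrite [\1_near z]indicE mem_set// mul1r lerDr mulr_ge0 ?powR_ge0.
  rewrite [\1_near z]indicE memNset// mul0r addr0; apply: Vw_le; rewrite ?(ltW a0)//.
  move: zn; rewrite /near /eball /= => /negP; rewrite -leNgt enormB => zn.
  have zx := enorm_ge0 (z - x).
  by apply: far_quarter => //; left.
apply: (@le_trans _ _ (4 `^ a * M * Vw a x)); last first.
  by rewrite ler_wpM2r ?Vw_ge0// lerDl.
rewrite -Mc; apply: le_Rintegral => // z _; apply: Vw_le; rewrite ?(ltW a0)//.
by apply: far_quarter; [exact: enorm_ge0|right].
Qed.

End levy_moments.

(** * Comparison of the Euclidean and sup norms, continuity criteria *)

Section rV_continuity.
Context {R : realType} {d : nat}.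
Implicit Types x y : 'rV[R]_d.

Lemma enorm_le_norm x : enorm x <= d%:R * `|x|.
Proof.
apply: le_trans (enorm_le_sum x) _.
have -> : d%:R * `|x| = \sum_(i < d) `|x| by rewrite sumr_const card_ord mulr_natl.
apply: ler_sum => i _; rewrite [leRHS]/Num.norm /= mx_normrE.
by apply/bigmax_geP; right => /=; exists (ord0, i).
Qed.

Lemma norm_le_enorm x : `|x| <= enorm x.
Proof.
rewrite /Num.norm /= mx_normrE; apply/bigmax_leP; split => [|/= -[i k] _ /=].
  exact: enorm_ge0.
by rewrite ord1 coord_le.
Qed.

Lemma measurable_continuous_rV (f : 'rV[R]_d -> R) : continuous f -> measurable_fun setT f.
Proof.
move=> cf; apply: (measurability _ (RGenOpens.measurableE R)).
move=> _ [_ [a [b ->]] <-]; rewrite setTI; apply: measurable_open_rV.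
by apply: open_comp => [x _|]; [exact: cf|exact: interval_open].
Qed.

Lemma continuous_enorm (f : 'rV[R]_d -> R) x (e : R) : {for x, continuous f} -> 0 < e ->
  exists2 r : R, 0 < r & forall y, enorm (y - x) < r -> `|f y - f x| <= e.
Proof.
move=> /cvgrPdist_le h e0.
have /nbhs_ballP[r r0 hr] := h e e0.
exists r => // y yx; rewrite distrC; apply: hr.
by rewrite -ball_normE /= distrC (le_lt_trans (norm_le_enorm _)).
Qed.

Lemma locally_lipschitz_continuous (f : 'rV[R]_d -> R) :
  (forall x, exists C : R, forall y, enorm (y - x) <= 1 -> `|f y - f x| <= C * enorm (y - x)) ->
  continuous f.
Proof.
move=> fL x; have [C hC] := fL x; apply/(@cvgrPdist_le _ R _ (nbhs x) (nbhs_filter x)) => e e0.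
have C1 : 0 < `|C| + 1 by rewrite ltr_wpDl.
pose m := Num.min 1 (e / (`|C| + 1)).
have m0 : 0 < m by rewrite lt_min ltr01 divr_gt0.
have d1 : 0 < d%:R + 1 :> R by rewrite ltr_wpDl.
near=> y; rewrite distrC.
have yx : `|y - x| <= m / (d%:R + 1).
  rewrite distrC; near: y; apply/nbhs_ballP; exists (m / (d%:R + 1)); first exact: divr_gt0.
  by move=> z; rewrite -ball_normE /= => /ltW.
have nle : enorm (y - x) <= m.
  apply: le_trans (enorm_le_norm _) _.
  apply: (@le_trans _ _ ((d%:R + 1) * (m / (d%:R + 1)))).
    by rewrite ler_pM// lerDl.
  by rewrite mulrCA mulfV ?mulr1// gt_eqF.
apply: le_trans (hC y _) _; first by rewrite (le_trans nle)// ge_min lexx.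
apply: (@le_trans _ _ ((`|C| + 1) * (e / (`|C| + 1)))).
  apply: le_trans (ler_wpM2r (enorm_ge0 _) (ler_norm C)) _.
  apply: ler_pM => //; [exact: enorm_ge0|by rewrite lerDl|].
  by rewrite (le_trans nle)// ge_min lexx orbT.
by rewrite mulrCA mulfV ?mulr1// gt_eqF.
Unshelve. all: by end_near. Qed.

End rV_continuity.

Section sigma_finite_pack.
Context {disp} {T : measurableType disp} {R : realType}.
Variables (m : {measure set T -> \bar R}) (ms : sigma_finite setT m).
(** The argument lets an instance mention the proof [ms]; since [f ms] unfolds to [m], facts about
    [m] transfer by conversion. *)
Let f (ms' : sigma_finite setT m) : set T -> \bar R := m.
HB.instance Definition _ := Measure.on (f ms).
HB.instance Definition _ := Measure_isSigmaFinite.Build _ _ _ (f ms) ms.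
Definition sigma_finite_pack : {sigma_finite_measure set T -> \bar R} := f ms.
End sigma_finite_pack.

(** * Lower bound for the small-jump exponent and decay of its exponential *)

Section lower_bound.
Context {R : realType} {d : nat}.
Variables (alpha : R) (mu : {finite_measure set 'rV[R]_d -> \bar R}).
Hypotheses (alpha0 : 0 < alpha) (alpha2 : alpha < 2) (smu : spectral_measure mu).
Implicit Types (u v x y z : 'rV[R]_d) (D : set 'rV[R]_d).

Definition sigma_finite_levy : {sigma_finite_measure set 'rV[R]_d -> \bar R} :=
  sigma_finite_pack (levy_measure_sigma_finite mu alpha0).

Notation nu := sigma_finite_levy.
Let q y : R := \1_near0 y * enorm y ^+ 2.
Let iq : nu.-integrable setT (EFin \o q) := levy_second_moment mu alpha0 alpha2.
Let M := \int[nu]_y q y.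
Let Q v := \int[nu]_y (\1_near0 y * dotv v y ^+ 2).

Let mind : measurable_fun setT (fun y => \1_(@near0 R d) y : R).
Proof. by apply: measurable_indic; exact: measurable_near0. Qed.

Let mdot v : measurable_fun setT (dotv v).
Proof. by apply: measurable_dotv => //; exact: measurable_cst. Qed.

Let mQ v : measurable_fun setT (fun y => \1_near0 y * dotv v y ^+ 2).
Proof. by apply: measurable_funM => //; exact: measurable_funX. Qed.

Let Q_le v y : `|\1_near0 y * dotv v y ^+ 2| <= enorm v ^+ 2 * q y.
Proof.
rewrite normrM ger0_norm ?indicE// /q mulrCA indicE ler_wpM2l//.
rewrite normrX -exprMn lerXn2r ?nnegrE ?mulr_ge0 ?enorm_ge0//; exact: dotv_le.
Qed.

Let iQ v : nu.-integrable setT (EFin \o (fun y => \1_near0 y * dotv v y ^+ 2)).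
Proof.
by apply: integrable_dominated (mQ v) (Q_le v) _; exact: (integrableZl measurableT _ iq).
Qed.

Let Q_continuous : continuous Q.
Proof.
apply: locally_lipschitz_continuous => x.
exists ((2 * enorm x + 1) * M) => y yx.
have M0 : 0 <= M.
  by apply: Rintegral_ge0 => z _; rewrite mulr_ge0 ?sqr_ge0// indicE.
rewrite /Q -RintegralB//.
have -> : (2 * enorm x + 1) * M * enorm (y - x) = \int[nu]_z ((2 * enorm x + 1) * enorm (y - x) * q z).
  by rewrite RintegralZl// /M; ring.
apply: norm_Rintegral_le.
- exact: measurable_funB.
- move=> z; rewrite -mulrBr normrM ger0_norm ?indicE// /q indicE mulrCA ler_wpM2l//.
  have -> : dotv y z ^+ 2 - dotv x z ^+ 2 = (dotv (y - x) z + 2 * dotv x z) * dotv (y - x) z.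
    by rewrite dotvDl dotvNl; ring.
  rewrite normrM expr2 mulrACA; apply: ler_pM => //; last exact: dotv_le.
  apply: le_trans (ler_normD _ _) _; rewrite normrM (ger0_norm (ler0n R 2)).
  have h1 := dotv_le (y - x) z; have h2 := dotv_le x z; have nz := enorm_ge0 z.
  have : enorm (y - x) * enorm z <= enorm z by rewrite ler_piMl.
  by lra.
- exact: (integrableZl measurableT _ iq).
Qed.

(** If [Q v = 0], then [nu] does not charge [<v, y> <> 0] near the origin. This set is an open cone,
    so [mu] does not charge it and the support of [mu] lies in the hyperplane orthogonal to [v].
    Nondegeneracy makes that hyperplane the whole space, forcing [<v, v> = 0]. *)
Let Q_gt0 v : enorm v = 1 -> 0 < Q v.
Proof.
move=> v1; rewrite lt0r; apply/andP; split; last first.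
  by apply: Rintegral_ge0 => y _; rewrite mulr_ge0 ?sqr_ge0// indicE.
apply/eqP => Q0.
pose U := [set y | dotv v y != 0].
have dv_cont : continuous (dotv v).
  apply: locally_lipschitz_continuous => x; exists 1 => y _.
  by rewrite -dotvBr (le_trans (dotv_le _ _))// v1.
have oU : open U.
  rewrite (_ : U = dotv v @^-1` [set r | r != 0]).
    by apply: open_comp => // y _; exact: dv_cont.
  by [].
have mU : measurable U by exact: measurable_open_rV.
have mnU : measurable (near0 `&` U) by apply: measurableI => //; exact: measurable_near0.
have nuU : nu (near0 `&` U) = 0%E.
  have : (\int[nu]_y `|(\1_near0 y * dotv v y ^+ 2)%:E| = 0)%E.
    have := EFin_Rintegral (iQ v); rewrite -/(Q v) Q0 => h; apply: etrans (esym h).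
    by apply: eq_integral => y _; rewrite gee0_abs// lee_fin mulr_ge0 ?sqr_ge0// indicE.
  move=> /(ae_eq_integral_abs _ measurableT); case.
    by apply/measurable_EFinP; exact: mQ.
  move=> N [mN N0 hN]; apply/eqP; rewrite eq_le measure_ge0 andbT -N0.
  apply: le_measure; rewrite ?inE// => y [y1 yU]; apply: hN => /= /(_ I).
  rewrite indicE mem_set// mul1r => /eqP; rewrite eqe sqrf_eq0.
  by move: yU => /negP.
have muU : mu U = 0%E.
  apply/eqP; rewrite eq_le measure_ge0 andbT.
  have coneU (r : R) x : 0 < r -> U x -> U (r *: x).
    by move=> r0 xv; rewrite /U /= dotvZr; apply: mulf_neq0; [rewrite gt_eqF|exact: xv].
  have h : (mu (U `&` usphere) <= 0)%E.
    have /le_trans := levy_measure_cone_ge mu alpha0 mU coneU; apply.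
    by rewrite le_eqVlt; apply/predU1P; left; exact: nuU.
  have mS : measurable (@usphere R d) by exact: measurable_usphere.
  rewrite (measureDI mu mU mS) -[leRHS]adde0 leeD//.
  rewrite -(spectral_sphere smu); apply: le_measure; rewrite ?inE.
  - exact: measurableD.
  - exact: measurableC.
  - by move=> y [].
have /(spectral_nondegenerate smu) : msupport mu `<=` [set` lker (linfun (mulmxr v^T))].
  move=> x sx; apply: contrapT => nx.
  have : U x.
    apply/negP => /eqP xv; apply: nx; rewrite /= memv_ker lfunE /=.
    apply/eqP/rowP => i; rewrite !mxE ord1 -[RHS]xv dotvC; apply: eq_bigr => k _.
    by rewrite mxE.
  by move/(sx U oU); rewrite muU ltxx.
move=> kv; have : v \in lker (linfun (mulmxr v^T)) by rewrite kv memvf.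
rewrite memv_ker lfunE /= => /eqP/rowP/(_ ord0); rewrite !mxE => vv.
have : dotv v v = 0 by rewrite -[RHS]vv; apply: eq_bigr => k _; rewrite mxE.
by move/eqP; rewrite -sqr_enorm v1 expr1n oner_eq0.
Qed.

Let Q_lower : exists2 c : R, 0 < c & forall v, enorm v = 1 -> c <= Q v.
Proof.
(* The minimum over the compact sphere exists only if the sphere is nonempty; otherwise any constant
   works. *)
have [[v0 v01]|nS] := pselect (exists v, enorm v = 1); last first.
  by exists 1 => // v v1; exfalso; apply: nS; exists v.
have en_cont : continuous (@enorm R d).
  apply: locally_lipschitz_continuous => x; exists 1 => y _; rewrite mul1r ler_norml.
  have := enormD (y - x) x; have := enormD (x - y) y; rewrite !subrK enormB.
  by move=> h1 h2; apply/andP; split; lra.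
have cS : compact (@usphere R d).
  apply: bounded_closed_compact.
    exists 1; split => // M' M1 y /= y1; apply: le_trans (ltW M1).
    by rewrite (le_trans (norm_le_enorm _))// y1.
  rewrite (_ : usphere = (@enorm R d) @^-1` [set 1]); last by apply/seteqP; split.
  by apply: closed_comp => [x _|]; [exact: en_cont|exact: closed_eq].
have [|v vS vmin] := @compact_EVT_min _ R Q usphere _ cS (continuous_subspaceT Q_continuous).
  by exists v0.
exists (Q v); first by apply: Q_gt0; move: vS; rewrite inE.
by move=> w w1; apply: vmin; rewrite inE.
Qed.

Lemma small_exponent_integrable u :
  nu.-integrable setT (EFin \o (fun y => \1_near0 y * (1 - cos (dotv u y)))).
Proof.
have mc : measurable_fun setT (fun y => cos (dotv u y)).
  have := @measurable_cos_dotv R d _ _ (cst u) id 0 (measurable_cst _) (@measurable_id _ _ _).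
  by under eq_fun do rewrite addr0.
apply: (@integrable_dominated _ _ _ _ _ (fun y => enorm u ^+ 2 * q y)).
- by apply: measurable_funM => //; exact: measurable_funB.
- move=> y; rewrite normrM !ger0_norm ?onem_cos_ge0 ?indicE// /q indicE mulrCA ler_wpM2l//.
  apply: le_trans (onem_cos_le _) _; rewrite -exprMn.
  by rewrite -(real_normK (num_real (dotv u y))) lerXn2r ?nnegrE ?mulr_ge0 ?enorm_ge0// dotv_le.
- exact: (integrableZl measurableT _ iq).
Qed.

(** Write [u = l v] with [|v| = 1]. On [|y| < 1 / l], which lies in the unit ball as [l >= 1], one
    has [|<u, y>| < 1] and [onem_cos_ge] bounds the integrand below by [<u, y> ^ 2 / 8]. Scaling of
    [nu] turns the integral of this into [l ^ alpha * Q v / 8]. *)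
Lemma small_exponent_lower : exists2 c : R, 0 < c &
  forall u, 1 <= enorm u -> c * enorm u `^ alpha <= small_exponent nu near0 u.
Proof.
have [c c0 cQ] := Q_lower; exists (c / 8); first by rewrite divr_gt0.
move=> u u1; set l := enorm u; have l0 : 0 < l by exact: lt_le_trans u1.
pose v := l^-1 *: u.
have v1 : enorm v = 1 by rewrite enormZ gtr0_norm ?invr_gt0// mulVf// gt_eqF.
have uv : u = l *: v by rewrite scalerA mulfV ?scale1r// gt_eqF.
pose f y : \bar R := (\1_near0 y * dotv v y ^+ 2 * 8^-1)%:E.
have mf : measurable_fun setT f.
  by apply/measurable_EFinP; apply: measurable_funM => //; exact: mQ.
have f0 y : (0 <= f y)%E by rewrite lee_fin divr_ge0// mulr_ge0 ?sqr_ge0 ?indicE.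
have fl : (\int[nu]_y f (l *: y)%R = (l `^ alpha)%:E * \int[nu]_y f y)%E.
  have := ge0_integral_levy_scale alpha mu l0 mf f0.
  move=> h; apply: etrans; first exact: h.
  by [].
have fQ : (\int[nu]_y f y = (Q v / 8)%:E)%E.
  rewrite -RintegralZr// EFin_Rintegral//.
  exact: (integrableZr measurableT _ (iQ v)).
rewrite -lee_fin (EFin_Rintegral (small_exponent_integrable u)) [c / 8 * _]mulrC.
apply: (@le_trans _ _ (\int[nu]_y f (l *: y)%R)%E).
  rewrite fl fQ -EFinM lee_fin ler_wpM2l ?powR_ge0// ler_wpM2r//.
  exact: cQ.
apply: ge0_le_integral => //.
- by apply: (measurableT_comp mf); exact: measurable_rVZ.
- by move/integrableP: (small_exponent_integrable u) => [].
move=> y _; rewrite lee_fin /f dotvZr -dotvZl -uv.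
have [yn|yn] := pselect (near0 (l *: y)); last first.
  by rewrite indicE memNset// !mul0r mulr_ge0 ?onem_cos_ge0// indicE.
have ly : l * enorm y < 1 by move: yn; rewrite /near0 /= enormZ gtr0_norm.
have yn' : near0 y.
  by apply: le_lt_trans ly; rewrite ler_peMl ?enorm_ge0.
rewrite !indicE !mem_set// !mul1r onem_cos_ge//.
by rewrite (le_trans (dotv_le _ _))// ltW.
Qed.

Lemma measurable_small_exponent : measurable_fun setT (small_exponent nu near0).
Proof.
apply: (measurable_Rintegral nu
  (F := fun p : 'rV[R]_d * 'rV[R]_d => \1_near0 p.2 * (1 - cos (dotv p.1 p.2)))).
apply: measurable_funM; first exact: (measurableT_comp mind measurable_snd).
apply: measurable_funB => //.
have := @measurable_cos_dotv R d _ _ fst snd 0 measurable_fst measurable_snd.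
by under eq_fun do rewrite addr0.
Qed.

Lemma small_jump_rapid : rapid (fun u => expR (- small_exponent nu near0 u)).
Proof.
split.
  apply: measurableT_comp; first exact: measurable_expR.
  by apply: measurableT_comp => //; exact: measurable_small_exponent.
move=> N; have [c c0 cE] := small_exponent_lower.
(* With [s = |u| ^ alpha], the bound [exp (- c s) <= (k + 1)! / (c s) ^ (k + 1)] must beat
   [|u| ^ N], so [alpha (k + 1) >= N] is wanted. *)
pose k := Num.truncn (N%:R / alpha).
have kN : N%:R <= alpha * k.+1%:R.
  by rewrite -ler_pdivrMl// mulrC ltW// truncnS_gt.
pose B := c ^- k.+1 * (k.+1)`!%:R : R.
have B0 : 0 <= B by rewrite mulr_ge0// invr_ge0 exprn_ge0// ltW.
exists (2 ^+ N * (1 + B)) => u; rewrite ger0_norm ?expR_ge0//.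
have e1 : expR (- small_exponent nu near0 u) <= 1.
  by rewrite -[leRHS]expR0 ler_expR oppr_le0; apply: small_exponent_ge0.
have [u1|u1] := leP (enorm u) 1.
  rewrite mulrC ler_pM ?expR_ge0 ?exprn_ge0 ?addr_ge0 ?enorm_ge0//.
    by rewrite lerXn2r ?nnegrE ?addr_ge0 ?enorm_ge0// -[leRHS]/(1 + 1) lerD2l.
  by rewrite (le_trans e1)// lerDl.
have u0 : 0 < enorm u by exact: lt_trans u1.
set s := enorm u `^ alpha.
have s0 : 0 < s by rewrite powR_gt0.
have es : expR (- small_exponent nu near0 u) <= B / s ^+ k.+1.
  have h1 : expR (- small_exponent nu near0 u) <= expR (- (c * s)).
    by rewrite ler_expR lerN2 cE// ltW.
  apply: le_trans h1 _; rewrite expRN.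
  have h2 : (c * s) ^+ k.+1 / (k.+1)`!%:R <= expR (c * s).
    have := @expR_ge1Dxn _ (c * s) k; move=> /(_ (mulr_ge0 (ltW c0) (ltW s0))).
    by apply: le_trans; rewrite lerDr.
  have h3 : 0 < (c * s) ^+ k.+1 / (k.+1)`!%:R.
    by rewrite divr_gt0 ?exprn_gt0 ?mulr_gt0// ltr0n fact_gt0.
  rewrite (le_trans (_ : _ <= ((c * s) ^+ k.+1 / (k.+1)`!%:R)^-1))//.
    by rewrite lef_pV2 ?posrE ?expR_gt0.
  by rewrite invfM invrK exprMn invfM /B mulrAC.
have us : enorm u ^+ N <= s ^+ k.+1.
  rewrite -!powR_mulrn ?(ltW u0) ?(ltW s0)// -powRrM.
  by rewrite ler_powR// ltW.
apply: (@le_trans _ _ (B / s ^+ k.+1 * (2 * enorm u) ^+ N)).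
  rewrite ler_pM ?expR_ge0 ?exprn_ge0 ?addr_ge0 ?enorm_ge0//.
  rewrite lerXn2r ?nnegrE ?mulr_ge0 ?addr_ge0 ?enorm_ge0//.
  by move: (ltW u1); lra.
rewrite exprMn mulrCA ler_wpM2l ?exprn_ge0//.
apply: (@le_trans _ _ B); last by rewrite lerDr.
rewrite -mulrA -[leRHS]mulr1 ler_wpM2l// mulrC ler_pdivrMr ?exprn_gt0//.
by rewrite mul1r.
Qed.

End lower_bound.

(** * Multiplying by the exponential of a cosine transform *)

Section exponential_series.
Context {R : realType} {d : nat}.
Notation Leb := (@lebesgue_rV R d).
Implicit Types (F N : 'rV[R]_d -> R) (x u : 'rV[R]_d).

Lemma series_exp_le_expR (t : R) n : 0 <= t -> series (exp_coeff t) n <= expR t.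
Proof.
move=> t0; rewrite /expR; apply: nondecreasing_cvgn_le; last exact: is_cvg_series_exp_coeff.
apply/nondecreasing_seqP => k; rewrite /series /= big_nat_recr//= lerDl.
by rewrite /exp_coeff /= divr_ge0// exprn_ge0.
Qed.

Lemma rapid_mul_bounded F N (M : R) : rapid F -> measurable_fun setT N ->
  (forall u, `|N u| <= M) -> rapid (fun u => N u * F u).
Proof.
by move=> rF mN NM; apply: (rapidM (C := M) (k := 0)) => // u; rewrite expr0 mulr1.
Qed.

Lemma rapid_mul_exprn F N (M : R) n : rapid F -> measurable_fun setT N ->
  (forall u, `|N u| <= M) -> rapid (fun u => N u ^+ n * F u).
Proof.
move=> rF mN NM; apply: (rapid_mul_bounded (M := M ^+ n)) => //; first exact: measurable_funX.
by move=> u; rewrite normrX lerXn2r ?nnegrE// (le_trans _ (NM u)).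
Qed.

(** Partial sums of the exponential series have transforms at most [A] times partial sums of
    [exp C]. The bound [M] on [N] only dominates the passage to the limit and does not enter the
    estimate. *)
Lemma ft_expR F N (M A C : R) th x : rapid F -> measurable_fun setT N ->
  (forall u, `|N u| <= M) -> 0 <= A -> 0 <= C ->
  (forall n, `|ft (fun u => N u ^+ n * F u) th x| <= A * C ^+ n) ->
  `|ft (fun u => expR (N u) * F u) th x| <= A * expR C.
Proof.
move=> rF mN NM A0 C0 hn.
have M0 : 0 <= M := le_trans (normr_ge0 _) (NM 0).
have rn n := rapid_mul_exprn n rF mN NM.
pose S n u := series (exp_coeff (N u)) n.
have rS n : rapid (fun u => n`!%:R^-1 * (N u ^+ n * F u)) by exact: rapidZ.
have SE n u : S n u * F u = \sum_(i <- index_iota 0 n) i`!%:R^-1 * (N u ^+ i * F u).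
  by rewrite /S /series /= mulr_suml; apply: eq_bigr => i _; rewrite mulrA (mulrC _^-1).
have SM n u : `|S n u| <= expR M.
  apply: le_trans (series_exp_le_expR n M0); rewrite /S /series /=.
  apply: le_trans (ler_norm_sum _ _ _) _; apply: ler_sum => i _.
  by rewrite normrM normfV normrX normr_nat ler_wpM2r// lerXn2r ?nnegrE.
have fS n : `|ft (fun u => S n u * F u) th x| <= A * expR C.
  under [fun u => _]eq_fun do rewrite SE.
  rewrite ft_sum//; apply: le_trans (ler_norm_sum _ _ _) _.
  apply: (@le_trans _ _ (A * series (exp_coeff C) n)); last first.
    by rewrite ler_wpM2l// series_exp_le_expR.
  rewrite /series /= mulr_sumr; apply: ler_sum => i _.
  rewrite ftZ// normrM normfV normr_nat /exp_coeff /= mulrA mulrC ler_wpM2r ?invr_ge0//.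
have cS : ft (fun u => S n u * F u) th x @[n --> \oo] --> ft (fun u => expR (N u) * F u) th x.
  apply: (Rintegral_dct (g := fun u => expR M * `|F u|)).
  - move=> n; under eq_fun do rewrite SE.
    have := rapid_cos x th (@rapid_sum _ _ _ (index_iota 0 n) _ rS); exact: proj1.
  - apply: (rapid_cos x th _).1; apply: (rapid_mul_bounded (M := expR M)) => //.
      by apply: measurableT_comp.
    by move=> u; rewrite ger0_norm ?expR_ge0// ler_expR (le_trans (ler_norm _)).
  - move=> u; apply: cvgMl; apply: cvgMl; exact: is_cvg_series_exp_coeff.
  - exact: rapid_integrable (rapidZ _ (rapid_norm rF)).
  - move=> n u; rewrite !normrM -[leRHS]mulr1 ler_pM ?mulr_ge0 ?norm_cos_le1//.
    by rewrite ler_wpM2r.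
rewrite -(cvg_lim _ (cvg_norm cS))//; apply: limr_le; last by apply: nearW => n; exact: fS.
by apply/cvg_ex; eexists; exact: (cvg_norm cS).
Qed.

(** Each factor of the cosine transform convolves with [m], and convolving [W] with [m] costs one
    factor [C]. *)
Lemma ft_exprn_convolution (m : {finite_measure set 'rV[R]_d -> \bar R}) (W : 'rV[R]_d -> R)
    F th (A C : R) n x : rapid F ->
  (forall u, \int[m]_z sin (dotv u z) = 0) -> 0 <= A -> 0 <= C ->
  (forall x, m.-integrable setT (EFin \o (fun z => W (x - z))) /\
     \int[m]_z W (x - z) <= C * W x) ->
  (forall x, `|ft F th x| <= A * W x) ->
  `|ft (fun u => (\int[m]_z cos (dotv u z)) ^+ n * F u) th x| <= A * C ^+ n * W x.
Proof.
move=> rF m0 A0 C0 WC FW; set N := fun u => \int[m]_z cos (dotv u z).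
have mcos : measurable_fun setT (fun p : 'rV[R]_d * 'rV[R]_d => cos (dotv p.1 p.2)).
  have := @measurable_cos_dotv R d _ _ fst snd 0 measurable_fst measurable_snd.
  by under eq_fun do rewrite addr0.
have mN : measurable_fun setT N := measurable_Rintegral m mcos.
have NM u : `|N u| <= \int[m]_z (cst 1 z).
  apply: norm_Rintegral_le.
  - exact: (measurableT_comp mcos (pair1_measurable u)).
  - by move=> z; rewrite norm_cos_le1.
  - exact: finite_measure_integrable_cst.
elim: n x => [|n IH] x.
  by under eq_fun do rewrite expr0 mul1r; rewrite expr0 mulr1; exact: FW.
have rn := rapid_mul_exprn n rF mN NM.
under [fun u => _]eq_fun do rewrite exprS -mulrA.
rewrite -(ft_convolution th x rn m0).
have [iW lW] := WC x.
apply: (@le_trans _ _ (\int[m]_z (A * C ^+ n * W (x - z)))).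
  apply: norm_Rintegral_le.
  - apply: (measurableT_comp (measurable_ft th rn)).
    by apply: measurable_rVD => //; exact: measurable_rVN.
  - by move=> z; exact: IH.
  - exact: (integrableZl measurableT _ iW).
rewrite RintegralZl// exprSr mulrA -!mulrA ler_wpM2l// ler_wpM2l ?exprn_ge0//.
Qed.

End exponential_series.

Section finite_pack.
Context {disp} {T : measurableType disp} {R : realType}.
Variables (m : {measure set T -> \bar R}) (mfin : (m setT < +oo)%E).
Let f (mfin' : (m setT < +oo)%E) : set T -> \bar R := m.
HB.instance Definition _ := Measure.on (f mfin).
Let f_fin : fin_num_fun (f mfin).
Proof. by apply: lty_fin_num_fun. Qed.
HB.instance Definition _ := Measure_isFinite.Build _ _ _ (f mfin) f_fin.
Definition finite_pack : {finite_measure set T -> \bar R} := f mfin.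
End finite_pack.

(** The splitting is done with extended nonnegative integrals; finiteness of the total is then a
    consequence of finiteness of both parts. *)
Lemma Rintegral_split_mrestr disp (T : measurableType disp) (R : realType)
    (m : {measure set T -> \bar R}) (A : set T) (mA : measurable A) (f : T -> R) :
  measurable_fun setT f -> (forall x, 0 <= f x) ->
  m.-integrable setT (EFin \o (fun x => \1_(~` A) x * f x)) ->
  (mrestr m mA).-integrable setT (EFin \o f) ->
  \int[m]_x f x = \int[m]_x (\1_(~` A) x * f x) + \int[mrestr m mA]_x f x.
Proof.
move=> mf f0 i1 i2; apply: EFin_inj.
rewrite EFinD (EFin_Rintegral i1) (EFin_Rintegral i2).
have mEf : measurable_fun setT (EFin \o f) by exact/measurable_EFinP.
have E2 := @ge0_integral_mrestr _ _ _ m A mA (EFin \o f) mEf (fun x => f0 x).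
rewrite E2.
have D : (\int[m]_x (f x)%:E =
    \int[m]_x (\1_(~` A) x * f x)%:E + \int[m]_x ((f x)%:E * (\1_A x)%:E))%E.
  rewrite -ge0_integralD//.
  - apply: eq_integral => x _; rewrite -EFinM -EFinD mulrC -mulrDr !indicE in_setC.
    by case: (x \in A); rewrite ?add0r ?addr0 mulr1.
  - by move=> x _; rewrite lee_fin mulr_ge0// indicE.
  - by case/integrableP: i1.
  - by move=> x _; rewrite mule_ge0 ?lee_fin// indicE.
  - by apply: emeasurable_funM => //; apply/measurable_EFinP; exact: measurable_indic.
have h1 : (0 <= \int[m]_x (\1_(~` A) x * f x)%:E)%E.
  by apply: integral_ge0 => x _; rewrite lee_fin mulr_ge0// indicE.
have h2 : (0 <= \int[m]_x ((f x)%:E * (\1_A x)%:E))%E.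
  by apply: integral_ge0 => x _; rewrite mule_ge0 ?lee_fin// indicE.
have l1 : (\int[m]_x (\1_(~` A) x * f x)%:E < +oo)%E.
  by rewrite -(EFin_Rintegral i1) ltry.
have l2 : (\int[m]_x ((f x)%:E * (\1_A x)%:E) < +oo)%E.
  by move: E2; rewrite -(EFin_Rintegral i2) => <-; rewrite ltry.
apply: etrans (D); rewrite fineK// D; by rewrite fin_numD !ge0_fin_numE// l1 l2.
Qed.

Lemma mulrCA4 (R : comPzRingType) (a b c e : R) : a * (b * (c * e)) = b * (c * (a * e)).
Proof. by rewrite mulrCA; congr (_ * _); rewrite mulrCA. Qed.

(** * The full exponent as small jumps plus large jumps, and decay of its transforms *)

Section stable_exponent.
Context {R : realType} {d : nat}.
Variables (alpha : R) (mu : {finite_measure set 'rV[R]_d -> \bar R}).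
Hypotheses (alpha0 : 0 < alpha) (alpha2 : alpha < 2) (smu : spectral_measure mu).
Implicit Types (u v x y z : 'rV[R]_d) (G : 'rV[R]_d -> R).
Notation nu := (levy_measure alpha mu).

Lemma far_levy_exists : exists m : {finite_measure set 'rV[R]_d -> \bar R},
  forall A, measurable A -> m A = nu (A `&` far).
Proof.
have far_fin : (mrestr nu (@measurable_far R d) setT < +oo)%E.
  by rewrite /mrestr setTI; exact: levy_measure_far.
by exists (finite_pack far_fin).
Qed.

Variables (m2 : {finite_measure set 'rV[R]_d -> \bar R}).
Hypothesis m2E : forall A, measurable A -> m2 A = nu (A `&` far).

Let phi := small_exponent (sigma_finite_levy mu alpha0) near0.
Let N u := \int[m2]_z cos (dotv u z).
Let M := \int[m2]_z (cst 1 z).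

Let mcos u : measurable_fun setT (fun y => cos (dotv u y)).
Proof.
have := @measurable_cos_dotv R d _ _ (cst u) id 0 (measurable_cst _) (@measurable_id _ _ _).
by under eq_fun do rewrite addr0.
Qed.

Let msin u : measurable_fun setT (fun y => sin (dotv u y)).
Proof.
have := @measurable_sin_dotv R d _ _ (cst u) id 0 (measurable_cst _) (@measurable_id _ _ _).
by under eq_fun do rewrite addr0.
Qed.

Let i1 : m2.-integrable setT (EFin \o cst 1).
Proof. exact: finite_measure_integrable_cst. Qed.

Let icos u : m2.-integrable setT (EFin \o (fun y => cos (dotv u y))).
Proof.
by apply: integrable_dominated (mcos u) _ i1 => z; rewrite norm_cos_le1.
Qed.

Let m2N A : measurable A -> m2 ((fun z => - z) @^-1` A) = m2 A.
Proof.
move=> mA; have mNA : measurable ((fun z : 'rV[R]_d => - z) @^-1` A).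
  by rewrite -[X in measurable X]setTI; apply: (@measurable_rVN _ _ _ _ id).
apply: etrans (m2E mNA) _; apply: etrans _ (esym (m2E mA)).
have mAf := measurableI _ _ mA (@measurable_far R d).
apply: etrans _ (levy_measureN alpha smu mAf).
apply: congr1; apply/seteqP; split => z [Az fz]; split => //.
  by move: fz; rewrite /far /= enormN.
by move: fz; rewrite /far /= enormN.
Qed.

Lemma far_levy_sin u : \int[m2]_z sin (dotv u z) = 0.
Proof.
have isinN : m2.-integrable setT ((EFin \o (fun z => sin (dotv u z))) \o (fun z => - z)).
  apply: (integrable_dominated (f := fun z => sin (dotv u (- z)))) _ _ i1.
    by apply: (measurableT_comp (msin u)); exact: measurable_rVN.
  by move=> z; rewrite norm_sin_le1.
have mN : measurable_fun setT (fun z : 'rV[R]_d => - z) by exact: measurable_rVN.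
have ms : measurable_fun setT (EFin \o (fun z => sin (dotv u z))).
  by apply/measurable_EFinP; exact: msin.
have h := @integral_pushforward _ _ _ _ R _ mN m2 setT _ ms isinN measurableT.
have h2 : \int[m2]_z sin (dotv u z) = \int[m2]_z sin (dotv u (- z)).
  congr fine; apply: etrans; last exact: h.
  by apply: eq_measure_integral => A mA _; exact: esym (m2N mA).
have h3 : \int[m2]_z sin (dotv u (- z)) = - \int[m2]_z sin (dotv u z).
  rewrite -mulN1r -RintegralZl//; last first.
    by apply: integrable_dominated (msin u) _ i1 => z; rewrite norm_sin_le1.
  by apply: eq_Rintegral => z _; rewrite dotvNr sinN mulN1r.
by move: h2; rewrite h3; move: (\int[m2]_z _) => a; lra.
Qed.

Lemma levy_exponentE u : levy_exponent nu u = phi u + (M - N u).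
Proof.
have m2r A : measurable A -> A `<=` setT -> m2 A = mrestr nu (@measurable_far R d) A.
  by move=> mA _; exact: m2E.
have mc : measurable_fun setT (fun y => 1 - cos (dotv u y)) by exact: measurable_funB.
have i2 : m2.-integrable setT (EFin \o (fun y => 1 - cos (dotv u y))).
  apply: (integrable_dominated _ _ (integrableZl measurableT 2 i1)) => //.
  by move=> y; rewrite mulr1 ger0_norm ?onem_cos_ge0 ?onem_cos_le2.
have i3 : (mrestr nu (@measurable_far R d)).-integrable setT
    (EFin \o (fun y => 1 - cos (dotv u y))).
  move/integrableP : i2 => [m i2]; apply/integrableP; split => //.
  by rewrite -(eq_measure_integral _ m2r).
have is_ := small_exponent_integrable mu alpha0 alpha2 u.
rewrite near0E in is_.
have := Rintegral_split_mrestr (A := far) mc (fun y => onem_cos_ge0 _) is_ i3.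
rewrite -near0E => h; apply: etrans h _; congr (_ + _).
transitivity (\int[m2]_y (1 - cos (dotv u y))).
  by congr fine; apply: esym; exact: eq_measure_integral _ m2r.
exact: (RintegralB measurableT i1 (icos u)).
Qed.

Let NM u : `|N u| <= M.
Proof.
apply: norm_Rintegral_le => //.
by move=> z; rewrite norm_cos_le1.
Qed.

Let mN : measurable_fun setT N.
Proof.
apply: (measurable_Rintegral m2 (F := fun p : 'rV[R]_d * 'rV[R]_d => cos (dotv p.1 p.2))).
have := @measurable_cos_dotv R d _ _ fst snd 0 measurable_fst measurable_snd.
by under eq_fun do rewrite addr0.
Qed.

Let rE : rapid (fun u => expR (- phi u)) := small_jump_rapid alpha0 alpha2 smu.

Let HE u : expR (- levy_exponent nu u) = expR (- M) * (expR (N u) * expR (- phi u)).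
Proof.
by rewrite levy_exponentE -!expRD; congr expR; ring.
Qed.

Lemma stable_charf_rapid : rapid (fun u => expR (- levy_exponent nu u)).
Proof.
rewrite (funext HE); apply: rapidZ; apply: (rapid_mul_bounded (M := expR M)) => //.
  exact: measurableT_comp.
by move=> u; rewrite ger0_norm ?expR_ge0// ler_expR (le_trans (ler_norm _)).
Qed.

Lemma ft_stable_decay (gamma c : R) G th : 0 <= gamma -> 0 <= c ->
  (forall x (r : R), enorm x = 1 -> 0 < r < 1 / 2 ->
     (nu (eball x r) <= (c * r `^ gamma)%:E)%E) ->
  symb G -> exists2 A : R, 0 <= A & forall x,
    `|ft (fun u => G u * expR (- levy_exponent nu u)) th x| <= A * Vw (alpha + gamma) x.
Proof.
move=> g0 c0 hnu sG.
have m2nu A : measurable A -> (m2 A <= nu A)%E.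
  move=> mA; rewrite (m2E mA); apply: le_measure; rewrite ?inE; [|exact: mA|by move=> y []].
  exact: measurableI mA (@measurable_far R d).
have [C C0 hC] := Vw_convolution alpha0 g0 c0 m2nu hnu.
(* An integer above [alpha + gamma], so that the decay of the small-jump transform is at least that
   of the weight. *)
pose m := (Num.truncn (alpha + gamma)).+1.
have [|A hA] := @small_jump_decay R d (sigma_finite_levy mu alpha0) near0
  (@measurable_near0 R d) _ (levy_second_moment mu alpha0 alpha2)
   rE m G th sG.
  by move=> y; exact: ltW.
have rGE : rapid (fun u => G u * expR (- phi u)) by exact: symb_rapid.
have A0 : 0 <= A.
  by apply: le_trans (hA 0); rewrite mulr_ge0// exprn_ge0// addr_ge0// enorm_ge0.
have base x : `|ft (fun u => G u * expR (- phi u)) th x| <= A * Vw (alpha + gamma) x.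
  have w1 : 1 <= 1 + enorm x by rewrite lerDl enorm_ge0.
  have w0 : 0 < 1 + enorm x by exact: lt_le_trans w1.
  rewrite /Vw powRN -ler_pdivrMr ?invr_gt0 ?powR_gt0// invrK.
  apply: le_trans (hA x); rewrite ler_wpM2l//.
  rewrite -powR_mulrn ?ler_powR//; last exact: ltW.
  by rewrite ltW// truncnS_gt.
exists (expR (- M) * (A * expR C)); first by rewrite !mulr_ge0 ?expR_ge0.
move=> x.
have -> : (fun u => G u * expR (- levy_exponent nu u)) =
    (fun u => expR (- M) * (expR (N u) * (G u * expR (- phi u)))).
  apply/funext => u; apply: etrans (congr1 (fun t => G u * t) (HE u)) _.
  exact: mulrCA4.
rewrite ftZ; last first.
  apply: (rapid_mul_bounded (M := expR M)) => //; first exact: measurableT_comp.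
  by move=> u; rewrite ger0_norm ?expR_ge0// ler_expR (le_trans (ler_norm _)).
rewrite normrM ger0_norm ?expR_ge0// -!mulrA ler_wpM2l ?expR_ge0//.
rewrite (mulrC (expR C)) mulrA.
have := @ft_expR _ _ _ N M (A * Vw (alpha + gamma) x) C th x rGE mN NM; apply => //.
  by rewrite mulr_ge0// Vw_ge0.
move=> n; rewrite mulrAC.
exact: (ft_exprn_convolution (m := m2) n x rGE far_levy_sin A0 C0 hC base).
Qed.

End stable_exponent.

(** * Fourier inversion by an approximate identity *)

Section inversion.
Context {R : realType} {d : nat}.
Notation Leb := (@lebesgue_rV R d).
Implicit Types (x y z u : 'rV[R]_d).
Variables (E H : 'rV[R]_d -> R) (P : probability 'rV[R]_d R) (p : 'rV[R]_d -> R).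
Hypotheses (rE : rapid E) (E1 : forall u, `|E u| <= 1) (E01 : E 0 = 1)
  (cE : forall u, E ((n.+1%:R^-1 : R) *: u) @[n --> \oo] --> E 0)
  (kE : forall m, exists A : R, forall x, `|ft E 0 x| * (1 + enorm x) ^+ m <= A)
  (rH : rapid H)
  (Pcos : forall u, \int[P]_y cos (dotv u y) = H u)
  (Psin : forall u, \int[P]_y sin (dotv u y) = 0)
  (dP : density P p) (cp : continuous p).

Let k := ft E 0.
Let kappa := \int[Leb]_x k x.
Let w x : R := (1 + enorm x) ^- d.+1.

Let mp : measurable_fun setT p.
Proof. exact: measurable_continuous_rV. Qed.

Let p0 x : 0 <= p x := density_ge0 dP x.

Let ip1 : (\int[Leb]_x (p x)%:E = 1)%E.
Proof. by rewrite -(densityE dP)// probability_setT. Qed.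

Let ip : Leb.-integrable setT (EFin \o p).
Proof.
apply/integrableP; split; first exact/measurable_EFinP.
under eq_integral do rewrite gee0_abs ?lee_fin//.
by rewrite ip1 ltry.
Qed.

(** The density formula holds for nonnegative integrands; apply it to [f + C] and cancel [C], both
    measures having mass 1. *)
Lemma Rintegral_density (f : 'rV[R]_d -> R) (C : R) : measurable_fun setT f ->
  (forall y, `|f y| <= C) -> \int[P]_y f y = \int[Leb]_y (f y * p y).
Proof.
move=> mf fC.
have iPc : P.-integrable setT (EFin \o cst C) by exact: finite_measure_integrable_cst.
have iPf : P.-integrable setT (EFin \o f) by exact: (integrable_dominated mf fC iPc).
have iCp : Leb.-integrable setT (EFin \o (fun y => C * p y)).
  exact: (integrableZl measurableT C ip).
have ifp : Leb.-integrable setT (EFin \o (fun y => f y * p y)).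
  apply: (integrable_dominated _ _ iCp); first exact: measurable_funM.
  by move=> y; rewrite normrM (ger0_norm (p0 y)) ler_wpM2r.
have fC0 y : 0 <= f y + C by rewrite -lerBlDr sub0r; case/ler_normlP: (fC y); rewrite lerNl.
have mfC : measurable_fun setT (fun y => (f y + C)%:E).
  by apply/measurable_EFinP; exact: measurable_funD.
have h := ge0_integral_density mp p0 (fun A mA => densityE dP mA) mfC (fun y => fC0 y).
have h1 : \int[P]_y (f y + C) = \int[Leb]_y (f y * p y + C * p y).
  congr fine; apply: etrans h _; apply: eq_integral => y _.
  by rewrite -EFinM mulrDl.
rewrite RintegralD// in h1.
have h2 : \int[Leb]_y (f y * p y + C * p y) = \int[Leb]_y (f y * p y) + C.
  rewrite RintegralD//; congr (_ + _); rewrite RintegralZl//.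
  by rewrite /Rintegral ip1 mulr1.
have h3 : \int[P]_y C = C.
  by rewrite /Rintegral integral_cst//= probability_setT mule1.
by move: h1; rewrite h2 h3 => /addIr.
Qed.

Let scaled (l : R) x : l != 0 ->
  ft (fun u => E (l^-1 *: u)) 0 x = `|l| ^+ d * k (l *: x).
Proof.
move=> l0; have rl : Leb.-integrable setT (EFin \o (fun u => E u * cos (dotv u (l *: x) + 0))).
  exact: rapid_integrable (rapid_cos _ _ rE).
have li0 : l^-1 != 0 by rewrite invr_eq0.
have [_ h] := Rintegral_affine 0 li0 rl.
rewrite /k /ft h mulrA -exprMn normfV mulfV ?normr_eq0// expr1n mul1r.
apply: eq_Rintegral => u _; rewrite !addr0; congr (_ * cos _).
by rewrite dotvZl dotvZr mulrA mulVf// mul1r.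
Qed.

Let rapid_scaled (l : R) : 1 <= l -> rapid (fun u => E (l^-1 *: u)).
Proof.
move=> l1; have l0 : 0 < l by exact: lt_le_trans l1.
split.
  by apply: (measurableT_comp rE.1); exact: measurable_rVZ.
move=> N; have [A hA] := rE.2 N; exists (l ^+ N * A) => u.
apply: (@le_trans _ _ (l ^+ N * (`|E (l^-1 *: u)| * (1 + enorm (l^-1 *: u)) ^+ N))).
  rewrite mulrCA ler_wpM2l// -exprMn lerXn2r ?nnegrE ?mulr_ge0 ?addr_ge0 ?enorm_ge0 ?(ltW l0)//.
  rewrite enormZ gtr0_norm ?invr_gt0// mulrDr mulr1 mulrA mulfV ?gt_eqF// mul1r.
  by rewrite lerD2r.
by rewrite ler_wpM2l ?exprn_ge0// ltW.
Qed.

(** The dilated kernel [l ^ d k (l .)] is the transform of [E (. / l)]; convolving it with [P]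
    multiplies by the characteristic function [H]. *)
Let convolution (l : R) x : 1 <= l ->
  \int[P]_z (l ^+ d * k (l *: (x - z))) = ft (fun u => H u * E (l^-1 *: u)) 0 x.
Proof.
move=> l1; have l0 : 0 < l by exact: lt_le_trans l1.
rewrite (_ : (fun u => _) = (fun u => \int[P]_z cos (dotv u z) * E (l^-1 *: u))); last first.
  by apply/funext => u; rewrite Pcos.
rewrite -(ft_convolution (m := P) 0 x (rapid_scaled l1) Psin).
by apply: eq_Rintegral => z _; rewrite scaled ?gt_eqF// gtr0_norm.
Qed.

Let limit x : ft (fun u => H u * E ((n.+1%:R^-1 : R) *: u)) 0 x @[n --> \oo] --> ft H 0 x.
Proof.
apply: (Rintegral_dct (g := fun u => `|H u|)).
- move=> n; apply: (rapid_cos x 0 _).1.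
  under eq_fun do rewrite mulrC; apply: (rapid_mul_bounded (M := 1)) => //.
  by apply: (measurableT_comp rE.1); exact: measurable_rVZ.
- exact: (rapid_cos x 0 rH).1.
- move=> u; apply: cvgMl.
  have h : H u * E ((n.+1%:R^-1 : R) *: u) @[n --> \oo] --> H u * E 0.
    by apply: cvgMr; exact: cE.
  by rewrite E01 mulr1 in h.
- exact: rapid_integrable (rapid_norm rH).
- move=> n u; rewrite !normrM -[leRHS]mulr1 ler_pM ?mulr_ge0 ?norm_cos_le1//.
  by rewrite -[leRHS]mulr1 ler_wpM2l.
Qed.

Let mk : measurable_fun setT k := measurable_ft 0 rE.

(** Two factors [w]: away from the centre one of them provides smallness in [l], while the other
    keeps the bound integrable. *)
Let k_le : exists2 A : R, 0 <= A & forall x, `|k x| <= A * (w x * w x).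
Proof.
have [A hA] := kE (d.+1 + d.+1); exists A.
  by apply: le_trans (hA 0); rewrite mulr_ge0// exprn_ge0// addr_ge0// enorm_ge0.
move=> x; have x0 : 0 < 1 + enorm x by rewrite ltr_wpDr// enorm_ge0.
by rewrite /w -invfM -exprD ler_pdivlMr ?exprn_gt0.
Qed.

Let w0 x : 0 < w x.
Proof. by rewrite invr_gt0 exprn_gt0// ltr_wpDr// enorm_ge0. Qed.

Let w1 x : w x <= 1.
Proof. by rewrite invf_le1 ?exprn_ege1 ?exprn_gt0 ?ltr_wpDr ?enorm_ge0// lerDl enorm_ge0. Qed.

Let iw : Leb.-integrable setT (EFin \o w) := @integrable_weight R d.

Let ik : Leb.-integrable setT (EFin \o k).
Proof.
have [A A0 kA] := k_le; apply: (integrable_dominated mk (g := fun x => A * w x)).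
  by move=> x; rewrite (le_trans (kA x))// ler_wpM2l// ler_piMr ?w1// ltW.
exact: (integrableZl measurableT A iw).
Qed.

Let recentre (l : R) x (F : 'rV[R]_d -> R) : 0 < l -> Leb.-integrable setT (EFin \o F) ->
  Leb.-integrable setT (EFin \o (fun z => l ^+ d * F (l *: (x - z)))) /\
  \int[Leb]_z (l ^+ d * F (l *: (x - z))) = \int[Leb]_z F z.
Proof.
move=> l0 iF; have nl0 : - l != 0 by rewrite oppr_eq0 gt_eqF.
have [h1 h2] := Rintegral_affine (l *: x) nl0 iF.
have e z : l *: (x - z) = - l *: z + l *: x.
  by rewrite scalerBr scaleNr addrC.
under eq_fun do rewrite e; split; first exact: (integrableZl measurableT _ h1).
by rewrite RintegralZl// h2 normrN gtr0_norm.
Qed.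

Let W := \int[Leb]_z w z.

(* Near [x] by continuity of [p]; away from [x] the decay of [k] beats the
   normalisation [l ^+ d] by one power of [l], which needs no bound on [p]. *)
Let pointwise x z (A e r l : R) : 0 <= A -> (forall y, `|k y| <= A * (w y * w y)) ->
  0 < e -> 0 < r -> (forall y, enorm (y - x) < r -> `|p y - p x| <= e / (A + 1)) -> 1 <= l ->
  l ^+ d * `|k (l *: (x - z))| * `|p z - p x| <= e * (l ^+ d * w (l *: (x - z))) +
   (A * r ^- d.+1 / l * p z + A * r ^- d.+1 / l * p x * (l ^+ d * w (l *: (x - z)))).
Proof.
move=> A0 kA e0 r0 hr l1; have l0 : 0 < l by exact: lt_le_trans l1.
have A1 : 0 < A + 1 by rewrite ltr_wpDl.
set t := l *: (x - z); have wt0 := ltW (w0 t); have wt1 := w1 t; have kt := kA t.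
have ld0 : 0 < l ^+ d by rewrite exprn_gt0.
have ld1 : 1 <= l ^+ d by exact: exprn_ege1.
have lw0 : 0 <= l ^+ d * w t by rewrite mulr_ge0// ltW.
set D := A * r ^- d.+1; have D0 : 0 <= D / l.
  by rewrite divr_ge0 ?(ltW l0)// mulr_ge0// invr_ge0 exprn_ge0// ltW.
have pz := p0 z; have px := p0 x.
have [zr|zr] := ltP (enorm (z - x)) r.
  apply: (@le_trans _ _ (e * (l ^+ d * w t))); last first.
    by rewrite lerDl addr_ge0//; [exact: mulr_ge0|apply: mulr_ge0 => //; exact: mulr_ge0].
  apply: (@le_trans _ _ (l ^+ d * (A * (w t * w t)) * (e / (A + 1)))).
    by rewrite ler_pM ?mulr_ge0 ?(ltW ld0)// ?hr// ler_wpM2l// ltW.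
  have -> : l ^+ d * (A * (w t * w t)) * (e / (A + 1)) = e * (l ^+ d * w t) * (A / (A + 1) * w t).
    by rewrite !mulrA; ring.
  rewrite ler_piMr ?mulr_ge0 ?(ltW e0) ?(ltW ld0)// mulr_ile1 ?divr_ge0 ?(ltW A1)//.
  by rewrite ler_pdivrMr// mul1r lerDl.
have wl : w t <= r ^- d.+1 * (l ^+ d)^-1 / l.
  rewrite (_ : _ / l = (r * l) ^- d.+1); last by rewrite exprMn (exprSr l) !invfM !mulrA.
  rewrite /w lef_pV2 ?posrE ?exprn_gt0 ?mulr_gt0 ?ltr_wpDr ?enorm_ge0//.
  rewrite lerXn2r ?nnegrE ?mulr_ge0 ?addr_ge0 ?enorm_ge0 ?(ltW l0) ?(ltW r0)//.
  rewrite (le_trans (_ : _ <= enorm t)) ?lerDr//.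
  by rewrite /t enormZ gtr0_norm// mulrC ler_wpM2l ?(ltW l0)// -enormN opprB.
have h1 : l ^+ d * `|k t| <= D / l * w t.
  apply: (@le_trans _ _ (l ^+ d * (A * (w t * (r ^- d.+1 * (l ^+ d)^-1 / l))))).
    rewrite ler_wpM2l ?(ltW ld0)// (le_trans kt)// ler_wpM2l// ler_wpM2l//.
  have -> : l ^+ d * (A * (w t * (r ^- d.+1 * (l ^+ d)^-1 / l))) = (l ^+ d * (l ^+ d)^-1) * (D / l * w t).
    by rewrite /D; ring.
  by rewrite mulfV ?mul1r// gt_eqF.
have h2 : `|p z - p x| <= p z + p x by rewrite (le_trans (ler_normB _ _))// !ger0_norm.
apply: (@le_trans _ _ (D / l * p z + D / l * p x * (l ^+ d * w t))); last first.
  by rewrite lerDr mulr_ge0 ?(ltW e0)// mulr_ge0// ltW.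
apply: le_trans (ler_pM _ _ h1 h2) _; rewrite ?mulr_ge0 ?(ltW ld0)//.
rewrite mulrDr; apply: lerD.
  by rewrite ler_wpM2r// ler_piMr.
rewrite mulrAC; apply: ler_wpM2l; [exact: mulr_ge0|exact: ler_peMl].
Qed.

Let approximation x (e : R) : 0 < e -> exists B : R, forall l : R, 1 <= l ->
  `|\int[P]_z (l ^+ d * k (l *: (x - z))) - kappa * p x| <= e * W + B / l.
Proof.
move=> e0; have [A A0 kA] := k_le.
have A1 : 0 < A + 1 by rewrite ltr_wpDl.
have [r r0 hr] := continuous_enorm (@cp x) (divr_gt0 e0 A1).
(* [D / l] multiplies [p z + p x * l ^ d w] in [pointwise]; integrating gives the mass 1 of [p] plus
   [p x * W]. *)
pose D := A * r ^- d.+1; exists (D * (1 + p x * W)) => l l1; have l0 : 0 < l by exact: lt_le_trans l1.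
have [ikl Ekl] := recentre x l0 ik.
have [iwl Ewl] := recentre x l0 iw.
have ikp : Leb.-integrable setT (EFin \o (fun z => l ^+ d * k (l *: (x - z)) * p z)).
  apply: (integrable_dominated _ _ (integrableZl measurableT (l ^+ d * A) ip)).
    by apply: measurable_funM => //; case/integrableP: ikl => /measurable_EFinP.
  move=> z; rewrite normrM (ger0_norm (p0 z)) ler_wpM2r// normrM ger0_norm ?exprn_ge0 ?(ltW l0)//.
  rewrite ler_wpM2l ?exprn_ge0 ?(ltW l0)// (le_trans (kA _))// ler_piMr//.
  by rewrite mulr_ile1 ?w1// ltW.
rewrite (Rintegral_density (C := l ^+ d * A)); last 2 first.
  by case/integrableP: ikl => /measurable_EFinP.
  move=> z; rewrite normrM ger0_norm ?exprn_ge0 ?(ltW l0)//.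
  rewrite ler_wpM2l ?exprn_ge0 ?(ltW l0)// (le_trans (kA _))// ler_piMr//.
  by rewrite mulr_ile1 ?w1// ltW.
rewrite /kappa -Ekl -RintegralZr// -RintegralB//; last exact: (integrableZr measurableT _ ikl).
have -> : e * W + D * (1 + p x * W) / l =
   \int[Leb]_z (e * (l ^+ d * w (l *: (x - z))) +
     (D / l * p z + D / l * p x * (l ^+ d * w (l *: (x - z))))).
  rewrite RintegralD//; last 2 first.
  - exact: (integrableZl measurableT _ iwl).
  - apply: (integrableD measurableT (integrableZl measurableT _ ip) (integrableZl measurableT _ iwl)).
  rewrite RintegralD//; last 2 first.
  - exact: (integrableZl measurableT _ ip).
  - exact: (integrableZl measurableT _ iwl).
  rewrite (RintegralZl e measurableT iwl) (RintegralZl (D / l) measurableT ip).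
  rewrite (RintegralZl (D / l * p x) measurableT iwl) Ewl -/W /Rintegral ip1 /= mulr1.
  by move: W (p x) l^-1 => a b f; ring.
apply: norm_Rintegral_le.
- apply: measurable_funB; first by case/integrableP: ikp => /measurable_EFinP.
  by apply: measurable_funM => //; case/integrableP: ikl => /measurable_EFinP.
- move=> z; rewrite -mulrBr normrM normrM ger0_norm ?exprn_ge0 ?(ltW l0)//.
  exact: (@pointwise x z A e r l A0 kA e0 r0 hr l1).
- exact: (integrableD measurableT (integrableZl measurableT e iwl)
    (integrableD measurableT (integrableZl measurableT (D / l) ip)
      (integrableZl measurableT (D / l * p x) iwl))).
Qed.

(** The convolutions of [P] with the dilated kernels have two limits: [kappa * p x] by
    [approximation], since [p] is continuous, and [ft H 0 x] by [limit], since [E (u / l)] tends to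
    1. *)
Theorem fourier_inversion x : kappa * p x = ft H 0 x.
Proof.
apply/eqP; rewrite -subr_eq0 -normr_le0; apply/ler_addgt0Pr => e e0; rewrite add0r.
have W0 : 0 <= W by apply: Rintegral_ge0 => z _; exact: ltW.
have W1 : 0 < W + 1 by rewrite ltr_wpDl.
have [B hB] := approximation x (divr_gt0 e0 W1).
apply: (@le_trans _ _ (e / (W + 1) * W)); last first.
  by rewrite -mulrA ler_piMr ?(ltW e0)// mulrC ler_pdivrMr// mul1r lerDl.
have c1 : `|ft (fun u => H u * E ((n.+1%:R^-1 : R) *: u)) 0 x - kappa * p x| @[n --> \oo]
    --> `|ft H 0 x - kappa * p x|.
  by apply: cvg_norm; apply: cvgB; [exact: limit|exact: cvg_cst].
have c2 : e / (W + 1) * W + B / n.+1%:R @[n --> \oo] --> e / (W + 1) * W + B * 0.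
  apply: cvgD; [exact: cvg_cst|apply: cvgMr; exact: cvg_harmonic].
rewrite mulr0 addr0 in c2; rewrite distrC.
apply: (ler_cvg_to c1 c2); apply: nearW => n.
by rewrite -convolution ?hB// ler1n.
Qed.

(** Otherwise inversion at 0 makes the integral of the positive function [H] vanish, so the whole
    space is Lebesgue null and [P], having a density, would have mass 0. *)
Lemma fourier_inversion_neq0 : (forall u, 0 < H u) -> kappa != 0.
Proof.
move=> H0; apply/eqP => k0.
have := fourier_inversion 0; rewrite k0 mul0r => /esym h.
have iH : Leb.-integrable setT (EFin \o H) by exact: rapid_integrable.
have iH0 : (\int[Leb]_u `|(H u)%:E| = 0)%E.
  have := EFin_Rintegral iH.
  have -> : \int[Leb]_u H u = 0.
    by rewrite -h; apply: eq_Rintegral => u _; rewrite dotv0r addr0 cos0 mulr1.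
  move=> h'; apply: etrans (esym h').
  by apply: eq_integral => u _; rewrite gee0_abs// lee_fin ltW.
have mH : measurable_fun setT (EFin \o H) by apply/measurable_EFinP; exact: rH.1.
have [N [mN N0 hN]] := (ae_eq_integral_abs Leb measurableT mH).1 iH0.
have NT : N = setT.
  apply/seteqP; split => // u _; apply: hN => /= /(_ I) /eqP.
  by rewrite eqe gt_eqF.
have := probability_setT P; rewrite (densityE dP)// -NT null_set_integral//.
  by move=> /eqP; rewrite eq_sym onee_eq0.
by apply: measurable_funTS; exact/measurable_EFinP.
Qed.

End inversion.

(** * Behaviour of the small-jump exponent along rays into the origin *)

Section small_exponent_origin.
Context {R : realType} {d : nat}.
Variables (alpha : R) (mu : {finite_measure set 'rV[R]_d -> \bar R}).
Hypotheses (alpha0 : 0 < alpha) (alpha2 : alpha < 2).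
Notation phi := (small_exponent (sigma_finite_levy mu alpha0) near0).

Lemma small_exponent0 : phi 0 = 0.
Proof.
rewrite /small_exponent /Rintegral integral0_eq// => y _.
by rewrite dotv0l cos0 subrr mulr0.
Qed.

Lemma small_exponent_cvg0 (u : 'rV[R]_d) :
  expR (- phi ((n.+1%:R^-1 : R) *: u)) @[n --> \oo] --> expR (- phi 0).
Proof.
apply: continuous_cvg; first exact: continuous_expR.
rewrite small_exponent0; apply: cvgN.
pose q (y : 'rV[R]_d) := \1_near0 y * enorm y ^+ 2.
have iq : (sigma_finite_levy mu alpha0).-integrable setT (EFin \o q).
  exact: levy_second_moment mu alpha0 alpha2.
have <- : \int[sigma_finite_levy mu alpha0]_y (cst 0 y : R) = 0.
  by rewrite /Rintegral integral0_eq.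
apply: (Rintegral_dct (g := fun y => enorm u ^+ 2 * q y)).
- by move=> n; case/integrableP: (small_exponent_integrable mu alpha0 alpha2
    ((n.+1%:R^-1 : R) *: u)) => /measurable_EFinP.
- exact: measurable_cst.
- move=> y; rewrite -[X in _ --> X](mulr0 (\1_near0 y)); apply: cvgMr.
  have h : dotv ((n.+1%:R^-1 : R) *: u) y @[n --> \oo] --> 0 * dotv u y.
    by under eq_fun do rewrite dotvZl; apply: cvgMl; exact: cvg_harmonic.
  rewrite mul0r in h; have h1 : cos (dotv ((n.+1%:R^-1 : R) *: u) y) @[n --> \oo] --> (cos 0 : R).
    by apply: continuous_cvg; [exact: continuous_cos|exact: h].
  have h2 : 1 - cos (dotv ((n.+1%:R^-1 : R) *: u) y) @[n --> \oo] --> (1 - cos 0 : R).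
    by apply: cvgB; [exact: cvg_cst|exact: h1].
  by rewrite cos0 subrr in h2.
- exact: (integrableZl measurableT _ iq).
- move=> n y; rewrite normrM !ger0_norm ?onem_cos_ge0 ?indicE// /q indicE mulrCA ler_wpM2l//.
  apply: le_trans (onem_cos_le _) _; rewrite -exprMn.
  rewrite -(real_normK (num_real (dotv _ y))) lerXn2r ?nnegrE ?mulr_ge0 ?enorm_ge0//.
  rewrite dotvZl normrM -[leRHS]mul1r ler_pM// ?dotv_le//.
  by rewrite ger0_norm// invf_le1 ?ler1n.
Qed.

End small_exponent_origin.

(** * Iterated partial derivatives of a transform *)

Section monomials.
Context {R : realType} {d : nat}.
Implicit Types (s : seq 'I_d) (F : 'rV[R]_d -> R).

Definition monomial s (u : 'rV[R]_d) : R := foldr (fun i a => u ord0 i * a) 1 s.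

(** Each derivative adds [pi / 2]; the folds of [monomial] and [phase] mirror that of [partials], so
    the induction matches step by step. *)
Definition phase s : R := foldr (fun _ t => t + pi / 2) 0 s.

Lemma symb_monomial s : symb (monomial s).
Proof. by elim: s => [|i s IH]; [exact: symb_cst|exact: symb_coord]. Qed.

Lemma partials_ft F (c : R) s : rapid F ->
  partials s (fun x => c * ft F 0 x) =
  fun x => c * ft (fun u => monomial s u * F u) (phase s) x.
Proof.
move=> rF; elim: s => [|i s IH] /=.
  by apply/funext => x; under [in RHS]eq_fun do rewrite mul1r.
rewrite IH; apply/funext => x.
have rs : rapid (fun u => monomial s u * F u) by apply: symb_rapid => //; exact: symb_monomial.
have dx := is_derive_ft (phase s) x (delta_mx ord0 i) rs.
have dcx : is_derive x (delta_mx ord0 i : 'rV[R]_d)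
  (fun x => c * ft (fun u => monomial s u * F u) (phase s) x)
  (c * ft (fun u => dotv u (delta_mx ord0 i) * (monomial s u * F u)) (phase s + pi / 2) x).
  exact: is_deriveZ.
rewrite /partial derive_val; congr (c * ft _ _ _).
by apply/funext => u; rewrite dotv_delta mulrA.
Qed.

End monomials.

(** * From decay to increments, and the conclusion *)

Section increments.
Context {R : realType} {d : nat}.

(** For [|y - x| > 1] the triangle inequality gives the term [2 A]; for [|y - x| <= 1] the mean
    value inequality gives the term with [B]. *)
Lemma ft_increment_le (F : 'rV[R]_d -> R) (th a A B r : R) x y : rapid F -> 0 <= a ->
  0 <= A -> 0 <= B -> (forall z, `|ft F th z| <= A * Vw a z) ->
  (forall i z, `|ft (fun u => u ord0 i * F u) (th + pi / 2) z| <= B * Vw a z) ->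
  0 < r -> r <= enorm x -> r <= enorm y -> enorm (y - x) < r / 4 ->
  `|ft F th y - ft F th x| <=
    (d%:R * B * 2 `^ a + 2 * A) * (1 + r) `^ (- a) * Num.min (enorm (y - x)) 1.
Proof.
move=> rF a0 A0 B0 hA hB r0 rx ry xy.
have Vwr z : r <= enorm z -> Vw a z <= (1 + r) `^ (- a).
  move=> rz; rewrite /Vw !powRN lef_pV2 ?posrE ?powR_gt0 ?ltr_wpDr ?enorm_ge0 ?(ltW r0)//.
  by rewrite ge0_ler_powR ?nnegrE ?addr_ge0 ?enorm_ge0 ?(ltW r0)// lerD2l.
have V0 : 0 <= (1 + r) `^ (- a) by exact: powR_ge0.
have P0 : 0 <= 2 `^ a :> R by exact: powR_ge0.
have d0 : 0 <= d%:R :> R by exact: ler0n.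
have [h1|h1] := leP (enorm (y - x)) 1; last first.
  rewrite mulr1 mulrDl; apply: le_trans (ler_normB _ _) _.
  apply: (@le_trans _ _ (A * (1 + r) `^ (- a) + A * (1 + r) `^ (- a))).
    by apply: lerD; [apply: le_trans (hA y) _|apply: le_trans (hA x) _];
      rewrite ler_wpM2l// Vwr.
  by rewrite -mulr2n -[X in X <= _]mulr_natl mulrA lerDr !mulr_ge0.
have /le_trans : `|ft F th y - ft F th x| <=
    enorm (y - x) * (d%:R * (B * 2 `^ a * (1 + r) `^ (- a))).
  rewrite -[X in ft F th X - _](subrK x); apply: ft_segment_le => //.
  move=> i t /andP[t0 t1]; apply: le_trans (hB i _) _; rewrite -mulrA ler_wpM2l//.
  set z := t *: (y - x) + x.
  (* Since [|y - x| < r / 4], the segment stays outside the ball of radius [3 r / 4]; replacing the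
     weight there by that of [r] costs at most [2 ^ a]. *)
  have rz : (1 + r) / 2 <= 1 + enorm z.
    have hz : enorm x <= enorm z + enorm (t *: (x - y)).
      have := enormD z (t *: (x - y)); rewrite (_ : z + _ = x)//.
      by rewrite /z addrAC -scalerDr addrA subrK subrr scaler0 add0r.
    have : enorm (t *: (x - y)) <= r / 4.
      rewrite enormZ ger0_norm// -enormN opprB (le_trans _ (ltW xy))//.
      by rewrite ler_piMl ?enorm_ge0.
    by move: (enorm z) (enorm x) (enorm (t *: _)) rx hz r0 => b e f; lra.
  have -> : 2 `^ a * (1 + r) `^ (- a) = ((1 + r) / 2) `^ (- a).
    rewrite powRM ?addr_ge0 ?(ltW r0)// mulrC; congr (_ * _).
    by rewrite -[2^-1]powR_inv1// -powRrM mulN1r opprK.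
  rewrite /Vw !powRN lef_pV2 ?posrE ?powR_gt0 ?divr_gt0 ?ltr_wpDr ?enorm_ge0 ?(ltW r0)//.
  by rewrite ge0_ler_powR ?nnegrE ?divr_ge0 ?addr_ge0 ?enorm_ge0 ?(ltW r0).
apply; rewrite mulrC ler_wpM2r ?enorm_ge0// mulrDl !mulrA lerDl !mulr_ge0//.
Qed.

End increments.

(** A ball of radius below 1/2 centred on the sphere lies in [|y| >= 1/2], a set of finite
    [nu]-mass, so exponent 0 is always admissible. Raising a negative [gamma] to 0 only strengthens
    the decay to be proved. *)
Lemma gamma_measure_nonneg (R : realType) (d : nat) (alpha gamma : R)
    (mu : {finite_measure set 'rV[R]_d -> \bar R}) : 0 < alpha ->
  gamma_measure (levy_measure alpha mu) gamma ->
  exists c g : R, [/\ 0 <= c, 0 <= g, gamma <= g & forall (x : 'rV[R]_d) (r : R),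
    enorm x = 1 -> 0 < r < 1 / 2 -> (levy_measure alpha mu (eball x r) <= (c * r `^ g)%:E)%E].
Proof.
move=> a0 [c hc]; have [g0|g0] := leP 0 gamma.
  exists `|c|, gamma; split => // x r x1 r1; apply: le_trans (hc x r x1 r1) _.
  by rewrite lee_fin ler_wpM2r ?powR_ge0// ler_norm.
have E := levy_measure_far_scale alpha mu (ltr0n R 2).
have fin : (levy_measure alpha mu [set y | (1 <= 2 * enorm y)%R] < +oo)%E.
  rewrite E lte_mul_pinfty ?lee_fin ?powR_ge0//; exact: levy_measure_far.
exists (fine (levy_measure alpha mu [set y | 1 <= 2 * enorm y])), 0; split => //.
- by apply: fine_ge0.
- exact: ltW.
move=> x r x1 /andP[r0 r1].
have finr := ge0_fin_numE
  (measure_ge0 (levy_measure alpha mu) [set y | (1 <= 2 * enorm y)%R]).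
rewrite powRr0 mulr1 fineK; last by rewrite finr.
apply: le_measure; rewrite ?inE; [exact: measurable_eball|exact: measurable_far_scale|].
move=> y; rewrite /eball /= => yx.
have := enormD (x - y) y; rewrite subrK x1 -enormN opprB => h.
by move: (enorm y) (enorm (y - x)) yx h r1 => b e; lra.
Qed.

Theorem lemma3 (R : realType) (d : nat) (alpha gamma : R)
    (mu : {finite_measure set 'rV[R]_d -> \bar R}) :
  (2 <= d)%N -> 0 < alpha < 2 ->
  spectral_measure mu ->
  gamma_measure (levy_measure alpha mu) gamma ->
  forall beta : 'I_d -> nat, exists c : R,
    forall (P : R -> probability 'rV[R]_d R) (p1 : 'rV[R]_d -> R),
      levy_semigroup (levy_measure alpha mu) P ->
      density (P 1) p1 -> smooth p1 ->
    forall (r : R) (x y : 'rV[R]_d), 0 < r ->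
      ~ eball 0 r x -> ~ eball 0 r y -> enorm (y - x) < r / 4 ->
      `|mderiv beta p1 y - mderiv beta p1 x| <=
        c * (1 + r) `^ (- alpha - gamma) * Num.min (enorm (y - x)) 1.
Proof.
move=> _ /andP[a0 a2] smu /(gamma_measure_nonneg a0)[c [g [c0 g0 gg hc]]] beta.
pose H (u : 'rV[R]_d) := expR (- levy_exponent (levy_measure alpha mu) u).
pose E (u : 'rV[R]_d) := expR (- small_exponent (sigma_finite_levy mu a0) near0 u).
have [m2 m2E] := far_levy_exists mu a0.
have rH : rapid H := stable_charf_rapid a0 a2 smu m2E.
have rE : rapid E := small_jump_rapid a0 a2 smu.
have decay G th := ft_stable_decay a0 a2 smu m2E (G := G) th g0 c0 hc.
set s := flatten [seq nseq (beta i) i | i <- enum 'I_d].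
have [A A0 hA] := decay (monomial s) (phase s) (symb_monomial s).
have /choice[B hB] : forall i, exists B : R, 0 <= B /\ forall x,
    `|ft (fun u => u ord0 i * (monomial s u * H u)) (phase s + pi / 2) x| <= B * Vw (alpha + g) x.
  move=> i; have [B B0 hB] := decay _ (phase s + pi / 2) (symb_coord i (symb_monomial s)).
  exists B; split=> // x; under eq_fun do rewrite mulrA; exact: hB.
pose kappa := \int[lebesgue_rV d]_x ft E 0 x.
pose K := d%:R * (\sum_i B i) * 2 `^ (alpha + g) + 2 * A.
(* Everything here is built from [mu], [alpha], [beta] and the ball bound, before [P] and [p1] are
   introduced. *)
exists (`|kappa^-1| * K).
move=> P p1 sP dp sp r x y r0 xr yr xy.
have cp : continuous p1 by exact: (sp [::]).1.
have /all_and2[Pcos Psin] : forall u, \int[P 1]_y cos (dotv u y) = H u /\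
    \int[P 1]_y sin (dotv u y) = 0.
  move=> u; have /eqP := semigroup_charf sP u ltr01.
  by rewrite eq_complex /= mul1r => /andP[/eqP-> /eqP->].
have E1 u : `|E u| <= 1.
  by rewrite ger0_norm ?expR_ge0// -expR0 ler_expR oppr_le0; exact: small_exponent_ge0.
have E01 : E 0 = 1 by rewrite /E small_exponent0 oppr0 expR0.
have kE m : exists A' : R, forall x, `|ft E 0 x| * (1 + enorm x) ^+ m <= A'.
  have [|A' hA'] := @small_jump_decay R d (sigma_finite_levy mu a0) near0 (@measurable_near0 R d)
    _ (levy_second_moment mu a0 a2) rE m (fun=> 1) 0 (symb_cst 1).
    by move=> z; exact: ltW.
  by exists A' => z; have := hA' z; under eq_fun do rewrite mul1r.
have cE := @small_exponent_cvg0 R d alpha mu a0 a2.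
have inv : forall x, kappa * p1 x = ft H 0 x.
  exact: (fourier_inversion rE E1 E01 cE kE rH Pcos Psin dp cp).
have k0 : kappa != 0.
  apply: (fourier_inversion_neq0 rE E1 E01 cE kE rH Pcos Psin dp cp).
  by move=> u; exact: expR_gt0.
have p1E : p1 = fun x => kappa^-1 * ft H 0 x.
  by apply/funext => z; rewrite -inv mulKf.
rewrite /mderiv -/s p1E partials_ft// -mulrBr normrM.
have xr' : r <= enorm x by move/negP: xr; rewrite /eball /= subr0 -leNgt.
have yr' : r <= enorm y by move/negP: yr; rewrite /eball /= subr0 -leNgt.
have rs : rapid (fun u => monomial s u * H u) by apply: symb_rapid => //; exact: symb_monomial.
have B0 i : 0 <= B i := (hB i).1.
have SB0 : 0 <= \sum_i B i by exact: sumr_ge0.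
have hB' i z : `|ft (fun u => u ord0 i * (monomial s u * H u)) (phase s + pi / 2) z| <=
    (\sum_i B i) * Vw (alpha + g) z.
  apply: le_trans ((hB i).2 z) _; rewrite ler_wpM2r ?Vw_ge0//.
  by rewrite (bigD1 i)//= lerDl sumr_ge0.
have ag0 : 0 <= alpha + g by rewrite addr_ge0// ltW.
have := ft_increment_le rs ag0 A0 SB0 hA hB' r0 xr' yr' xy.
rewrite -/K => incr; have K0 : 0 <= K by rewrite addr_ge0 ?mulr_ge0 ?powR_ge0.
apply: le_trans (ler_wpM2l (normr_ge0 _) incr) _; rewrite !mulrA.
apply: ler_wpM2r; first by rewrite le_min enorm_ge0 ler01.
apply: ler_wpM2l; first exact: mulr_ge0.
(* Return from [g] to [gamma <= g]: the base [1 + r] is at least 1, so the exponent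
   [- alpha - gamma] gives the larger power. *)
by rewrite ler_powR ?lerDl ?(ltW r0)// opprD lerD2l lerN2.
Qed.
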